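(* Let $n\ge 3$, $N\ge 1$, $m\ge 1$ be integers and $0<\alpha<1$. Let $a=a(p_{-1},p_0,p_1,\ldots,p_{2m-1})$ be an $\mathbb{R}^N$-valued function of class $\mathcal{C}^{1,\alpha}$, where $p_{-1}\in\mathbb{R}^n$ is the slot of the variable $x$ and $p_j$ is the slot of $\nabla^j u$. For any given appropriate initial data $\{c_j\}_{0\le j\le 2m-1}$, there exist infinitely many solutions $u=(u_1,\ldots,u_N)$ in the class $\mathcal{C}^{2m,\alpha}$, in some small neighborhood of $0\in\mathbb{R}^n$, to the initial value system $$\triangle^m u(x)=a(x,u,\nabla u,\ldots,\nabla^{2m-1}u),\qquad \nabla^j u(0)=c_j\quad (0\le j\le 2m-1).$$ Moreover, all those solutions are of vanishing order at most $2m$ at $0$ and are not radially symmetric.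
   Context: $\triangle$ is the Laplacian on $\mathbb{R}^n$ (acting componentwise) and $\triangle^m$ its $m$-th iterate. $\nabla^j u$ denotes the collection of all $j$-th order partial derivatives of all components of $u$, i.e. $(D^\beta u_l)_{|\beta|=j,\,1\le l\le N}$, with $\nabla^0u=u$. The data $\{c_j\}_{0\le j\le 2m-1}$ is called appropriate if it satisfies the symmetry conditions satisfied by the derivatives of a vector-valued function, i.e. there is a smooth $\mathbb{R}^N$-valued function $\varphi$ near $0$ with $\nabla^j\varphi(0)=c_j$ for $0\le j\le 2m-1$. The function $a$ is defined on the whole Euclidean space of its variables; $\mathcal{C}^{1,\alpha}$ means that its first-order derivatives exist and are Hölder continuous with exponent $\alpha$ on bounded sets. $u$ is of class $\mathcal{C}^{2m,\alpha}$ on a neighborhood if its partial derivatives up to order $2m$ exist and are continuous and those of order $2m$ are Hölder continuous with exponent $\alpha$. A function $u\in\mathcal{C}^k$ is of vanishing order $l$ ($l\le k$) at $0$ if $\nabla^j u(0)=0$ for $0\le j\le l-1$ and $\nabla^l u(0)\ne 0$. A function is radially symmetric if it depends only on $|x|$. ''All those solutions'' refers to the infinitely many solutions asserted to exist. *)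

(* Defs.v *)
From HB Require Import structures.
From mathcomp Require Import all_boot all_order all_algebra.
From mathcomp Require Import all_classical all_reals all_analysis.

Set Implicit Arguments.
Unset Strict Implicit.
Unset Printing Implicit Defensive.

Import Order.TTheory GRing.Theory Num.Theory numFieldNormedType.Exports.
Local Open Scope classical_set_scope.
Local Open Scope ring_scope.

(* The library norm on 'rV[R]_d is the sup norm; this is the Euclidean one. *)
Definition enorm (R : realType) (d : nat) (x : 'rV[R]_d) : R :=
  Num.sqrt (\sum_(i < d) x ord0 i ^+ 2).

Definition eball (R : realType) (d : nat) (r : R) : set 'rV[R]_d :=
  [set x | enorm x < r].

Definition component (R : realType) (d N : nat) (u : 'rV[R]_d -> 'rV[R]_N)
  (l : 'I_N) : 'rV[R]_d -> R := fun x => u x ord0 l.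

Definition partial (R : realType) (d : nat) (i : 'I_d) (f : 'rV[R]_d -> R) :
  'rV[R]_d -> R := fun x => 'D_(delta_mx ord0 i) f x.

Definition laplacian (R : realType) (d : nat) (f : 'rV[R]_d -> R) :
  'rV[R]_d -> R := fun x => \sum_(i < d) partial i (partial i f) x.

(* Multi-indices of length j in d variables; every entry is at most j, which
   makes the type finite. *)
Definition multiindex (d j : nat) : finType :=
  {b : {ffun 'I_d -> 'I_j.+1} | (\sum_(i < d) b i == j)%N}.

(* D_0^(b 0) (D_1^(b 1) (... f)); all derivatives below are taken of functions
   of class C^j, for which the order of differentiation is irrelevant. *)
Definition multi_partial (R : realType) (d j : nat) (b : multiindex d j)
  (f : 'rV[R]_d -> R) : 'rV[R]_d -> R :=
  foldr (fun i g => iter (val b i) (partial i) g) f (enum 'I_d).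

Definition nabla_size (d N j : nat) : nat := #|{: multiindex d j * 'I_N}|.

(* The vector (D^b u_l) with |b| = j and l < N, in the enumeration order of
   the pairs (b, l). *)
Definition nabla (R : realType) (d N j : nat) (u : 'rV[R]_d -> 'rV[R]_N)
  (x : 'rV[R]_d) : 'rV[R]_(nabla_size d N j) :=
  \row_s multi_partial (enum_val s).1 (component u (enum_val s).2) x.

Definition jet_size (d N k : nat) : nat := (\sum_(j < k) nabla_size d N j)%N.

(* (u, nabla u, ..., nabla^(k-1) u) *)
Definition jet (R : realType) (d N k : nat) (u : 'rV[R]_d -> 'rV[R]_N)
  (x : 'rV[R]_d) : 'rV[R]_(jet_size d N k) :=
  mxrow (fun j : 'I_k => nabla j u x).

(* For open A: all iterated partial derivatives of f up to order k exist and
   are continuous on A. *)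
Fixpoint Ck_on (R : realType) (d : nat) (A : set 'rV[R]_d) (k : nat)
  (f : 'rV[R]_d -> R) : Prop :=
  (forall x, A x -> {for x, continuous f}) /\
  (if k is k'.+1 then
     forall i : 'I_d,
       (forall x, A x -> derivable f x (delta_mx ord0 i)) /\
       Ck_on A k' (partial i f)
   else True).

Definition holder_on (R : realType) (d : nat) (A : set 'rV[R]_d) (alpha : R)
  (f : 'rV[R]_d -> R) : Prop :=
  exists C : R, forall x y, A x -> A y ->
    `|f x - f y| <= C * enorm (x - y) `^ alpha.

Definition Ck_holder_on (R : realType) (d N : nat) (A : set 'rV[R]_d)
  (k : nat) (alpha : R) (u : 'rV[R]_d -> 'rV[R]_N) : Prop :=
  forall l : 'I_N, Ck_on A k (component u l) /\
    forall b : multiindex d k,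
      holder_on A alpha (multi_partial b (component u l)).

Definition C1_holder (R : realType) (d N : nat) (alpha : R)
  (a : 'rV[R]_d -> 'rV[R]_N) : Prop :=
  forall (l : 'I_N) (i : 'I_d),
    (forall p, derivable (component a l) p (delta_mx ord0 i)) /\
    forall A : set 'rV[R]_d, bounded_set A ->
      holder_on A alpha (partial i (component a l)).

Definition appropriate (R : realType) (d N k : nat)
  (c : forall j : 'I_k, 'rV[R]_(nabla_size d N j)) : Prop :=
  exists (phi : 'rV[R]_d -> 'rV[R]_N) (r : R),
    [/\ 0 < r,
        forall (q : nat) (l : 'I_N), Ck_on (eball r) q (component phi l) &
        forall j : 'I_k, nabla j phi 0 = c j].

Definition vanishing_order (R : realType) (d N : nat)
  (u : 'rV[R]_d -> 'rV[R]_N) (l : nat) : Prop :=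
  (forall j : nat, (j < l)%N -> nabla j u 0 = 0) /\ nabla l u 0 <> 0.

Definition radially_symmetric_on (R : realType) (d N : nat)
  (A : set 'rV[R]_d) (u : 'rV[R]_d -> 'rV[R]_N) : Prop :=
  exists g : R -> 'rV[R]_N, forall x, A x -> u x = g (enorm x).

Definition solution_on (R : realType) (n N m : nat) (A : set 'rV[R]_n)
  (a : 'rV[R]_(n + jet_size n N (2 * m)) -> 'rV[R]_N)
  (c : forall j : 'I_(2 * m), 'rV[R]_(nabla_size n N j))
  (u : 'rV[R]_n -> 'rV[R]_N) : Prop :=
  (forall x, A x -> forall l : 'I_N,
     iter m (@laplacian R n) (component u l) x =
     component a l (row_mx x (jet (2 * m) u x))) /\
  (forall j : 'I_(2 * m), nabla j u 0 = c j).

(* Main.v *)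
Require Import Defs.
From mathcomp Require Import all_boot all_order all_algebra.
From mathcomp Require Import all_classical all_reals all_analysis.
From mathcomp Require Import ring lra zify.

Set Implicit Arguments.
Unset Strict Implicit.
Unset Printing Implicit Defensive.

Import Order.TTheory GRing.Theory Num.Theory numFieldNormedType.Exports.
Local Open Scope classical_set_scope.
Local Open Scope ring_scope.

(** Let [p0] be the point of jet space that the data prescribe over the origin and
[a0 = a p0].  A solution is sought as [u = P + w].  The polynomial [P] ([leading])
consists of the Taylor polynomial of the data, of [a0 x_1^(2m) / (2m)!], and of
[lam (x_1^(2m) - x_2^(2m)) / (2m)!] with a free parameter [lam]; so its [m]-th Laplacian
is [a0] for every [lam].  The correction [w] vanishes to order [2m] at the origin and
solves [laplacian^m w = F] with [F = a (x, jet of u) - a0].  As [F] is of order [rho] on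
the cube of radius [rho], and as the inverse of the [m]-th Laplacian gains derivatives,
[w] is a perturbation when [rho] is small: the equation for [F] has a solution by
contraction, and the derivatives of [w] of order [2m] at the origin are [O(rho^(1/2))].

Hence [D_1^(2m) u - D_2^(2m) u] at the origin is [a0 + 2 lam] up to a small error.  For
large [lam] it is not 0, so the derivatives of order [2m] do not all vanish, and [u] is
not radial, since all axes look alike to a radial function.  Different [lam] give
different solutions, as [D_1^(2m-1) u] at a point of the first axis shows.

The inverse of the [m]-th Laplacian is built without integrals.  The fundamental solution
is mollified at a scale [eps = 1 / p] to [H (eps^2 + |x|^2)], where [H] is an [m]-th
primitive of [t^(- n/2)]; its [m]-th Laplacian is a positive bubble of width [eps]
([iter_laplacian_kernel]).  Potentials are finite sums over a lattice of mesh [eps^3].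
The estimates of Schauder hold for them, uniformly in the scale and up to errors that
vanish with it ([pot_bounds_exist]): sums of the weights
[(eps^2 + |x - y|^2)^(- (n - delta)/2)] are bounded ([lattice_sum_bound]), and one
derivative moves from the kernel to the density as a difference quotient whose step is
the mesh ([quotient_error]).

At each scale the nonlinear equation, with [a] truncated to a Lipschitz function, has an
exact solution with these potentials ([density_exists]), whose density is Lipschitz with
a constant independent of the scale ([density_lipschitz]).  This gives smooth functions
that solve the system up to an error that goes to 0 ([approximate_family]).  All their
derivatives up to order [2m] converge along an ultrafilter; the uniform modulus of
continuity [|x - y|^alpha + o(1)] makes the limits derivatives of one another and Hoelder
continuous ([is_derive_modulus], [limit_family]), and the equation becomes exact. *)

(** * Words of partial derivatives and mean values *)

Lemma eqr_le {R : realType} (x y : R) : x = y -> x <= y.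
Proof. by move->. Qed.

Section Words.
Context {R : realType} {n : nat}.
Implicit Types (f g : 'rV[R]_n -> R) (s : seq 'I_n) (x : 'rV[R]_n).

Definition ebasis (i : 'I_n) : 'rV[R]_n := delta_mx ord0 i.

(** A word of directions rather than a multi-index, so that the order of
differentiation is explicit and concatenation composes derivatives. *)
Definition Dw s f : 'rV[R]_n -> R := foldr (@partial R n) f s.

Lemma ebasisE i j : ebasis i ord0 j = (j == i)%:R.
Proof. by rewrite mxE eqxx. Qed.

Lemma Dw_cat s t f : Dw (s ++ t) f = Dw s (Dw t f).
Proof. by rewrite /Dw foldr_cat. Qed.

Lemma Dw_nseq k i f : Dw (nseq k i) f = iter k (partial i) f.
Proof. by elim: k => //= k ->. Qed.

Definition word_of j (b : multiindex n j) : seq 'I_n :=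
  flatten [seq nseq (val b i) i | i <- enum 'I_n].

Lemma multi_partialE j (b : multiindex n j) f : multi_partial b f = Dw (word_of b) f.
Proof.
rewrite /multi_partial /word_of; elim: (enum 'I_n) => //= i s IH.
by rewrite Dw_cat IH Dw_nseq.
Qed.

Lemma count_word_of j (b : multiindex n j) i : count_mem i (word_of b) = val b i.
Proof.
rewrite /word_of count_flatten -map_comp sumnE big_map big_enum /=.
under eq_bigr do rewrite count_nseq /=.
by rewrite (bigD1 i) //= eqxx mul1n big1 ?addn0 // => k /negPf ->.
Qed.

Lemma size_word_of j (b : multiindex n j) : size (word_of b) = j.
Proof.
rewrite /word_of size_flatten /shape -map_comp sumnE big_map big_enum /=.
under eq_bigr do rewrite size_nseq.
exact/eqP/(valP b).
Qed.

Lemma sum_count s : (\sum_(i < n) count_mem i s)%N = size s.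
Proof.
elim: s => [|k s IH]; first by rewrite big1.
under eq_bigr do rewrite /=.
rewrite big_split /= IH (bigD1 k) //= eqxx big1 ?addn0 // => i.
by rewrite eq_sym => /negPf ->.
Qed.

Lemma multiindex_of_subproof s :
  (\sum_(i < n) [ffun i => inord (count_mem i s) : 'I_(size s).+1] i == size s)%N.
Proof.
apply/eqP; rewrite -[RHS](sum_count s); apply: eq_bigr => i _.
by rewrite ffunE inordK // ltnS count_size.
Qed.

Definition multiindex_of s : multiindex n (size s) :=
  exist _ [ffun i => inord (count_mem i s)] (multiindex_of_subproof s).

Lemma multiindex_ofE s i : val (multiindex_of s) i = count_mem i s :> nat.
Proof. by rewrite /= ffunE inordK // ltnS count_size. Qed.

Lemma perm_word_of s : perm_eq (word_of (multiindex_of s)) s.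
Proof.
by apply/allP => i _ /=; rewrite count_word_of multiindex_ofE.
Qed.

Lemma Dw_perm f s t :
  (forall i j r, partial i (partial j (Dw r f)) = partial j (partial i (Dw r f))) ->
  perm_eq s t -> Dw s f = Dw t f.
Proof.
move=> C.
have ins i s1 s2 : Dw (s1 ++ i :: s2) f = Dw (i :: s1 ++ s2) f.
  elim: s1 => //= k s1 IH; rewrite -/(Dw _ _) IH /=.
  exact: C.
elim: s t => [|i s IH] t.
  by rewrite perm_sym => /perm_nilP ->.
move=> pst.
have it : i \in t by rewrite -(perm_mem pst) mem_head.
have [t1 [t2 et]] : exists t1 t2, t = t1 ++ i :: t2.
  by case/splitPr: it => p1 p2; exists p1, p2.
move: pst; rewrite et => pst.
rewrite ins /= -/(Dw _ _); congr partial; apply: IH.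
rewrite -(perm_cons i); apply: (perm_trans pst).
by rewrite -cat1s perm_catCA.
Qed.

Lemma is_derive_line f x (v : 'rV[R]_n) (t df : R) :
  is_derive (x + t *: v) v f df -> is_derive t 1 (fun s : R => f (x + s *: v)) df.
Proof.
case=> H1 H2.
have E : (fun h : R => h^-1 *: ((f \o shift (x + t *: v)) (h *: v) - f (x + t *: v)))
  = (fun h : R => h^-1 *: (((fun s : R => f (x + s *: v)) \o shift t) (h *: 1) -
       (fun s : R => f (x + s *: v)) t)).
  apply/funext => h /=; congr (_ *: (f _ - _)).
  by rewrite scalerDl [h%:A]mulr1 addrC -addrA (addrC (t *: v)).
split; first by rewrite /derivable -E.
by rewrite -H2 /derive E.
Qed.

Lemma line_is_derive f x (v : 'rV[R]_n) (df : R) :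
  is_derive (0 : R) 1 (fun s : R => f (x + s *: v)) df -> is_derive x v f df.
Proof.
case=> H1 H2.
have E : (fun h : R => h^-1 *: ((f \o shift x) (h *: v) - f x))
  = (fun h : R => h^-1 *: (((fun s : R => f (x + s *: v)) \o shift 0) (h *: 1) -
       (fun s : R => f (x + s *: v)) 0)).
  apply/funext => h /=; congr (_ *: (f _ - f _)).
    by rewrite [h%:A]mulr1 addr0 addrC.
  by rewrite scale0r addr0.
split; first by rewrite /derivable E.
by rewrite -H2 /derive E.
Qed.

Lemma is_derive_chain (h : R -> R) f x (v : 'rV[R]_n) (dh df : R) :
  is_derive (f x) 1 h dh -> is_derive x v f df ->
  is_derive x v (fun y => h (f y)) (dh * df).
Proof.
move=> Hh Hf; apply: line_is_derive.
have H1 : is_derive ((fun s : R => f (x + s *: v)) 0) 1 h dh.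
  by rewrite scale0r addr0.
have H2 : is_derive (0 : R) 1 (fun s : R => f (x + s *: v)) df.
  by apply: is_derive_line; rewrite scale0r addr0.
exact: (is_derive1_comp H1 H2).
Qed.

Lemma mvt1 (g dg : R -> R) (a b : R) : a <= b ->
  (forall t, a <= t <= b -> is_derive t 1 g (dg t)) ->
  exists2 t, a <= t <= b & g b - g a = dg t * (b - a).
Proof.
move=> ab H.
have [||t] := @MVT_segment R g dg a b ab.
- by move=> t /itvP tab; apply: H; rewrite !tab.
- apply: derivable_within_continuous => t; rewrite in_itv /= => /H [].
  by [].
by rewrite in_itv /=; exists t.
Qed.

Lemma mvt_line f (df : 'rV[R]_n -> R) x (v : 'rV[R]_n) (a : R) :
  (forall t, `|t| <= `|a| -> 0 <= t * a -> is_derive (x + t *: v) v f (df (x + t *: v))) ->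
  exists2 t, `|t| <= `|a| /\ 0 <= t * a & f (x + a *: v) - f x = a * df (x + t *: v).
Proof.
move=> H.
pose g (t : R) := f (x + t *: v); pose dg (t : R) := df (x + t *: v).
have [a0|a0] := leP 0 a.
  have [t /andP[t0 ta] E] : exists2 t, 0 <= t <= a & g a - g 0 = dg t * (a - 0).
    apply: mvt1 => // t /andP[t0 ta]; apply: is_derive_line; apply: H.
      by rewrite !ger0_norm.
    exact: mulr_ge0.
  exists t; first by rewrite !ger0_norm // mulr_ge0.
  by move: E; rewrite /g /dg scale0r addr0 subr0 mulrC.
have [t /andP[t0 ta] E] : exists2 t, a <= t <= 0 & g 0 - g a = dg t * (0 - a).
  apply: mvt1; first exact: ltW.
  move=> t /andP[t0 ta]; apply: is_derive_line; apply: H.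
    by rewrite !ler0_norm ?lerN2 // ltW.
  by apply: mulr_le0 => //; apply: ltW.
exists t.
  split; last by apply: mulr_le0 => //; apply: ltW.
  by rewrite !ler0_norm ?lerN2 // ltW.
move: E; rewrite /g /dg scale0r addr0 sub0r mulrN => E.
by rewrite -opprB E opprK mulrC.
Qed.

Definition hull (x y z : 'rV[R]_n) :=
  forall i, (x ord0 i <= z ord0 i <= y ord0 i) || (y ord0 i <= z ord0 i <= x ord0 i).

(** The path that changes the coordinates one at a time stays in the box. *)
Lemma mvt_box f (df : 'I_n -> 'rV[R]_n -> R) (M : R) x y :
  (forall z i, hull x y z -> is_derive z (ebasis i) f (df i z)) ->
  (forall z i, hull x y z -> `|df i z| <= M) ->
  `|f y - f x| <= M * \sum_(i < n) `|y ord0 i - x ord0 i|.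
Proof.
move=> H B.
pose z (k : nat) := \row_(i < n) (if (i < k)%N then y ord0 i else x ord0 i) : 'rV[R]_n.
have z0 : z 0%N = x by apply/rowP => i; rewrite mxE.
have zn : z n = y by apply/rowP => i; rewrite mxE ltn_ord.
have -> : f y - f x = \sum_(i < n) (f (z i.+1) - f (z i)).
  rewrite -[in LHS]z0 -[in LHS]zn -(big_mkord predT (fun i => f (z i.+1) - f (z i))).
  by rewrite telescope_sumr.
rewrite mulr_sumr; apply: le_trans (ler_norm_sum _ _ _) _; apply: ler_sum => i _.
set a := y ord0 i - x ord0 i.
have zS : z i.+1 = z i + a *: ebasis i.
  apply/rowP => j; rewrite !mxE ltnS leq_eqVlt -[j == i :> nat]/(j == i).
  have [->|ji] := eqVneq j i; first by rewrite ltnn /= mulr1 /a; ring.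
  by rewrite /= mulr0 addr0.
have hz t : `|t| <= `|a| -> 0 <= t * a -> hull x y (z i + t *: ebasis i).
  move=> ta ta0 j; rewrite !mxE.
  have [->|ji] := eqVneq j i; last first.
    by rewrite mulr0 addr0; case: ifP => _; rewrite !lexx ?andbT /=; apply: le_total.
  rewrite ltnn mulr1.
  move: ta ta0; rewrite /a => ta ta0.
  have [xy|xy] := leP (x ord0 i) (y ord0 i).
    have a0 : 0 <= y ord0 i - x ord0 i by rewrite subr_ge0.
    rewrite (ger0_norm a0) in ta.
    have : 0 <= t \/ y ord0 i - x ord0 i = 0.
      have [->|an0] := eqVneq (y ord0 i - x ord0 i) 0; first by right.
      by left; move: ta0; rewrite pmulr_lge0 // lt_def an0.
    move: ta; rewrite ler_norml; lra.
  have a0 : y ord0 i - x ord0 i < 0 by rewrite subr_lt0.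
  rewrite (ltr0_norm a0) in ta.
  have t0 : t <= 0 by move: ta0; rewrite nmulr_lge0.
  by move: ta; rewrite ler_norml; lra.
have [t [ta ta0] E] := @mvt_line f (df i) (z i) (ebasis i) a
  (fun t h1 h2 => H _ _ (hz t h1 h2)).
rewrite zS E normrM mulrC ler_wpM2r //.
exact: B _ _ (hz t ta ta0).
Qed.

Lemma coord_le_norm x i : `|x ord0 i| <= `|x|.
Proof.
rewrite [leRHS]/Num.Def.normr /= mx_normrE.
by apply/bigmax_geP; right => /=; exists (ord0, i).
Qed.

Lemma norm_le_coord x r : 0 <= r -> (forall i, `|x ord0 i| <= r) -> `|x| <= r.
Proof.
move=> r0 H; rewrite [leLHS]/Num.Def.normr /= mx_normrE.
by apply: bigmax_le => //= -[i j] _ /=; rewrite ord1.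
Qed.

Lemma hull_norm x y z r : hull x y z -> `|x| <= r -> `|y| <= r -> `|z| <= r.
Proof.
move=> h hx hy; apply: norm_le_coord; first exact: le_trans hx.
move=> j; have := le_trans (coord_le_norm x j) hx.
have := le_trans (coord_le_norm y j) hy; move: (h j).
by rewrite !ler_norml; lra.
Qed.

Lemma hull_sub x y z i : hull x y z -> `|z ord0 i - x ord0 i| <= `|y ord0 i - x ord0 i|.
Proof.
move=> /(_ i); have [xy|xy] := leP (x ord0 i) (y ord0 i).
  rewrite (@ger0_norm _ (y ord0 i - _)) ?subr_ge0 // ler_norml; lra.
by rewrite (@ltr0_norm _ (y ord0 i - _)) ?subr_lt0 // ler_norml; lra.
Qed.

End Words.

(** * Smooth functions, monomials and Taylor polynomials *)

Section PointwiseRules.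
Context {R : realType} {V : normedModType R}.
Implicit Types (f g : V -> R) (x v : V) (a df dg : R).

Lemma is_derive_addf f g x v df dg : is_derive x v f df -> is_derive x v g dg ->
  is_derive x v (fun y => f y + g y) (df + dg).
Proof. exact: is_deriveD. Qed.

Lemma is_derive_mulf f g x v df dg : is_derive x v f df -> is_derive x v g dg ->
  is_derive x v (fun y => f y * g y) (f x * dg + df * g x).
Proof.
move=> Hf Hg; apply: is_derive_eq (is_deriveM Hf Hg) _.
by rewrite [g x *: _]mulrC.
Qed.

Lemma is_derive_scalef a f x v df : is_derive x v f df ->
  is_derive x v (fun y => a * f y) (a * df).
Proof. exact: is_deriveZ. Qed.

Lemma is_derive_sumf (I : Type) (r : seq I) (F : I -> V -> R) x v (dF : I -> R) :
  (forall i, is_derive x v (F i) (dF i)) ->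
  is_derive x v (fun y => \sum_(i <- r) F i y) (\sum_(i <- r) dF i).
Proof.
move=> H; elim: r => [|i r IH].
  rewrite big_nil; under eq_fun do rewrite big_nil.
  exact: is_derive_cst.
rewrite big_cons; under eq_fun do rewrite big_cons.
exact: is_derive_addf.
Qed.

End PointwiseRules.

Section Smooth.
Context {R : realType} {n : nat}.
Implicit Types (f g : 'rV[R]_n -> R) (s : seq 'I_n) (x y : 'rV[R]_n) (e : 'I_n -> nat).

Lemma is_derive_partial f g i : (forall x, is_derive x (ebasis i) f (g x)) -> partial i f = g.
Proof. by move=> H; apply/funext => x; rewrite /partial; case: (H x). Qed.

Variant smooth f : Prop := Smooth of forall s x i, derivable (Dw s f) x (ebasis i).

Lemma smoothP f s x i : smooth f -> is_derive x (ebasis i) (Dw s f) (Dw (i :: s) f x).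
Proof. by case=> sf; apply: derivableP; apply: sf. Qed.

(** Any family closed under derivation up to its own index consists of smooth
functions, and computes their derivatives. *)
Lemma Dw_family (F : seq 'I_n -> 'rV[R]_n -> R) :
  (forall s x i, is_derive x (ebasis i) (F s) (F (i :: s) x)) ->
  forall s, Dw s (F [::]) = F s.
Proof.
by move=> H; elim=> //= i s ->; apply: is_derive_partial => x; apply: H.
Qed.

Lemma smooth_family (F : seq 'I_n -> 'rV[R]_n -> R) :
  (forall s x i, is_derive x (ebasis i) (F s) (F (i :: s) x)) -> smooth (F [::]).
Proof. by move=> H; split=> s x i; rewrite (Dw_family H); case: (H s x i). Qed.

Section Closure.
Variables (f g : 'rV[R]_n -> R) (sf : smooth f) (sg : smooth g).

Let addF s x i : is_derive x (ebasis i) (fun x => Dw s f x + Dw s g x)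
  (Dw (i :: s) f x + Dw (i :: s) g x).
Proof. by apply: is_derive_addf; apply: smoothP. Qed.

Lemma smoothD : smooth (fun x => f x + g x).
Proof. exact: (smooth_family addF). Qed.

Lemma DwD s : Dw s (fun x => f x + g x) = (fun x => Dw s f x + Dw s g x).
Proof. exact: (Dw_family addF). Qed.

Let scaleF a s x i : is_derive x (ebasis i) (fun x => a * Dw s f x) (a * Dw (i :: s) f x).
Proof. by apply: is_derive_scalef; apply: smoothP. Qed.

Lemma smoothZ a : smooth (fun x => a * f x).
Proof. exact: (smooth_family (scaleF a)). Qed.

Lemma DwZ a s : Dw s (fun x => a * f x) = (fun x => a * Dw s f x).
Proof. exact: (Dw_family (scaleF a)). Qed.

Let shiftF y s x i :
  is_derive x (ebasis i) (fun x => Dw s f (x - y)) (Dw (i :: s) f (x - y)).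
Proof.
apply: line_is_derive; under eq_fun do rewrite addrAC.
by apply: is_derive_line; rewrite scale0r addr0; apply: smoothP.
Qed.

Lemma smooth_shift y : smooth (fun x => f (x - y)).
Proof. exact: (smooth_family (shiftF y)). Qed.

Lemma Dw_shift y s : Dw s (fun x => f (x - y)) = (fun x => Dw s f (x - y)).
Proof. exact: (Dw_family (shiftF y)). Qed.

End Closure.

Section ClosureSum.
Variables (I : Type) (r : seq I) (F : I -> 'rV[R]_n -> R) (sF : forall i, smooth (F i)).

Let sumF s x i : is_derive x (ebasis i) (fun x => \sum_(j <- r) Dw s (F j) x)
  (\sum_(j <- r) Dw (i :: s) (F j) x).
Proof. by apply: is_derive_sumf => j; apply: smoothP. Qed.

Lemma smooth_sum : smooth (fun x => \sum_(j <- r) F j x).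
Proof. exact: (smooth_family sumF). Qed.

Lemma Dw_sum s : Dw s (fun x => \sum_(j <- r) F j x) = (fun x => \sum_(j <- r) Dw s (F j) x).
Proof. exact: (Dw_family sumF). Qed.

End ClosureSum.

Lemma smoothB f g : smooth f -> smooth g -> smooth (fun x => f x - g x).
Proof.
move=> sf sg; have -> : (fun x => f x - g x) = (fun x => f x + (-1) * g x).
  by apply/funext => x; rewrite mulN1r.
exact/smoothD/smoothZ.
Qed.

Lemma DwB f g s : smooth f -> smooth g ->
  Dw s (fun x => f x - g x) = (fun x => Dw s f x - Dw s g x).
Proof.
move=> sf sg; have -> : (fun x => f x - g x) = (fun x => f x + (-1) * g x).
  by apply/funext => x; rewrite mulN1r.
rewrite (DwD sf (smoothZ sg (-1))).
by apply/funext => x; rewrite DwZ // mulN1r.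
Qed.

Lemma smooth_Dw f s : smooth f -> smooth (Dw s f).
Proof. by case=> sf; split=> t x i; rewrite -Dw_cat; apply: sf. Qed.

Lemma is_derive_affine (a b t : R) : is_derive t 1 (fun s : R => a + s * b) b.
Proof.
have : is_derive t (1 : R) (fun s : R => cst a s + b * id s) (0 + b * 1).
  by apply: is_derive_addf; apply: is_derive_scalef.
rewrite add0r mulr1.
by under eq_fun do rewrite /= (mulrC b).
Qed.

Lemma is_derive_coord x i j : is_derive x (ebasis i) (fun y : 'rV[R]_n => y ord0 j) (i == j)%:R.
Proof.
apply: line_is_derive.
under eq_fun do rewrite mxE [X in _ + X]mxE ebasisE (eq_sym j).
exact: is_derive_affine.
Qed.

Lemma is_derive_expn (f : 'rV[R]_n -> R) x (v : 'rV[R]_n) df k : is_derive x v f df ->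
  is_derive x v (fun y => f y ^+ k) (k%:R * f x ^+ k.-1 * df).
Proof.
move=> Hf; elim: k => [|k IH].
  by rewrite !mul0r; apply: is_derive_cst.
under eq_fun do rewrite exprS.
apply: is_derive_eq (is_derive_mulf Hf IH) _.
case: k {IH} => [|k] /=; first by rewrite expr0; ring.
rewrite [in RHS]mulrS exprS; ring.
Qed.

(** Divided powers, so that differentiation only lowers exponents. *)
Definition Mon e x : R := \prod_(i < n) (x ord0 i ^+ e i / (e i)`!%:R).

Definition edec e (i : 'I_n) : 'I_n -> nat := fun j => (e j - (j == i))%N.

Lemma is_derive_Mon e x i :
  is_derive x (ebasis i) (Mon e) ((0 < e i)%N%:R * Mon (edec e i) x).
Proof.
pose c y := \prod_(j < n | j != i) (y ord0 j ^+ e j / (e j)`!%:R) : R.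
apply: line_is_derive.
have -> : (fun s : R => Mon e (x + s *: ebasis i)) =
    (fun s : R => c x / (e i)`!%:R * (fun y => y ord0 i ^+ e i) (x + s *: ebasis i)).
  apply/funext => s; rewrite /Mon (bigD1 i) //= mulrC -mulrA (mulrC _^-1) mulrC mulrC; congr (_ * _).
  apply: eq_bigr => j ji; rewrite mxE [X in _ + X]mxE ebasisE (negPf ji).
  by rewrite mulr0 addr0.
apply: is_derive_eq.
  apply: is_derive_scalef; apply: (@is_derive_line _ _ (fun y => y ord0 i ^+ e i)).
  by apply: is_derive_expn; apply: is_derive_coord.
rewrite eqxx mulr1 scale0r addr0 /Mon [in RHS](bigD1 i) //=.
rewrite /edec eqxx.
under [in RHS]eq_bigr => j ji do rewrite (negPf ji) subn0.
rewrite -/(c x); case: (e i) => [|k]; first by rewrite !mul0r mulr0.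
rewrite subn1 /= factS natrM invfM.
have : k.+1%:R != 0 :> R by rewrite pnatr_eq0.
have : k`!%:R != 0 :> R by rewrite pnatr_eq0 -lt0n fact_gt0.
by move: (k.+1%:R : R) (k`!%:R : R) => p q h1 h2; field; rewrite h1 h2.
Qed.

Lemma Mon0 e : Mon e 0 = [forall i, e i == 0%N]%:R.
Proof.
rewrite /Mon; case: forallP => [H|H].
  by rewrite big1 // => i _; rewrite (eqP (H i)) expr0 fact0 divr1.
have [i ei] : exists i, e i != 0%N.
  by apply/existsP; rewrite -negb_forall; apply/negP => /forallP.
by rewrite (bigD1 i) //= mxE expr0n (negPf ei) !mul0r.
Qed.

Definition ebelow (a e : 'I_n -> nat) := [forall i, a i <= e i]%N.

Lemma is_derive_MonF e s x i :
  let F s x := (ebelow (fun i => count_mem i s) e)%:R *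
     Mon (fun i => e i - count_mem i s)%N x in
  is_derive x (ebasis i) (F s) (F (i :: s) x).
Proof.
move=> F; rewrite /F; apply: is_derive_eq.
  by apply: is_derive_scalef; apply: is_derive_Mon.
rewrite mulrA; congr (_ * _).
  rewrite -natrM mulnb; congr (_%:R); congr nat_of_bool.
  apply/andP/forallP => [[/forallP H ei] j|H].
    rewrite /=; have := H j; have [<-|_] := eqVneq i j; last by rewrite add0n.
    by move: ei; rewrite subn_gt0 add1n.
  split; last by have := H i; rewrite /= eqxx subn_gt0 add1n.
  by apply/forallP => j; apply: leq_trans (H j); rewrite /= leq_addl.
by congr (Mon _ x); apply/funext => j; rewrite /edec /= subnAC -subnDA eq_sym.
Qed.

Lemma Mon_F0 e : (fun x => (ebelow (fun i => count_mem i [::]) e)%:R *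
     Mon (fun i => e i - count_mem i [::])%N x) = Mon e.
Proof.
apply/funext => x; have -> : ebelow (fun i => count_mem i [::]) e by apply/forallP.
by rewrite mul1r; congr Mon; apply/funext => i; rewrite subn0.
Qed.

Lemma smooth_Mon e : smooth (Mon e).
Proof. by rewrite -Mon_F0; exact: smooth_family (is_derive_MonF e). Qed.

Lemma Dw_Mon e s x : Dw s (Mon e) x =
  (ebelow (fun i => count_mem i s) e)%:R * Mon (fun i => e i - count_mem i s)%N x.
Proof. by rewrite -{1}Mon_F0 (Dw_family (is_derive_MonF e)). Qed.

Lemma Dw_Mon_big e s : (\sum_i e i < size s)%N -> Dw s (Mon e) = fun=> 0.
Proof.
move=> H; apply/funext => x; rewrite Dw_Mon.
suff /negPf -> : ~~ ebelow (fun i => count_mem i s) e by rewrite mul0r.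
apply: contraL H => /forallP H; rewrite -leqNgt -sum_count.
by apply: leq_sum.
Qed.

Lemma Dw_Mon_eq e s x : (\sum_i e i = size s)%N ->
  Dw s (Mon e) x = [forall i, e i == count_mem i s]%:R.
Proof.
move=> H; rewrite Dw_Mon; case: forallP => [E|E].
  have -> : ebelow (fun i => count_mem i s) e.
    by apply/forallP => i; rewrite (eqP (E i)).
  by rewrite mul1r /Mon big1 // => i _; rewrite (eqP (E i)) subnn expr0 fact0 divr1.
suff /negPf -> : ~~ ebelow (fun i => count_mem i s) e by rewrite mul0r.
apply/negP => /forallP B; apply: E => i; apply/eqP/eqP.
have : (\sum_i (e i - count_mem i s) = 0)%N.
  rewrite sumnB ?H ?sum_count ?subnn // => j _; exact: B.
by move/eqP; rewrite sum_nat_eq0 => /forallP/(_ i) /= E0; rewrite eqn_leq B andbT -subn_eq0.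
Qed.

Lemma Dw_Mon0 e s : Dw s (Mon e) 0 = [forall i, e i == count_mem i s]%:R.
Proof.
rewrite Dw_Mon Mon0 -natrM mulnb; congr (_%:R); congr nat_of_bool.
apply/andP/forallP => [[/forallP A /forallP B] i|H].
  by rewrite eqn_leq A andbT -subn_eq0.
by split; apply/forallP => i; rewrite (eqP (H i)) ?subnn.
Qed.

(** The polynomial of degree less than [k] whose derivatives at the origin are
the numbers [c j b]. *)
Definition jet_poly k (c : forall j, multiindex n j -> R) x : R :=
  \sum_(j < k) \sum_(b : multiindex n j) c j b * Mon (fun i => val b i) x.

Lemma sum_multiindex j (b : multiindex n j) : (\sum_i val b i = j)%N.
Proof. exact/eqP/(valP b). Qed.

Lemma smooth_jet_poly k c : smooth (jet_poly k c).
Proof.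
apply: smooth_sum => j; apply: smooth_sum => b.
exact/smoothZ/smooth_Mon.
Qed.

Lemma Dw_jet_poly k c s : Dw s (jet_poly k c) =
  fun x => \sum_(j < k) \sum_(b : multiindex n j) c j b * Dw s (Mon (fun i => val b i)) x.
Proof.
have sM j (b : multiindex n j) : smooth (fun x => c j b * Mon (fun i => val b i) x).
  exact/smoothZ/smooth_Mon.
rewrite Dw_sum => [|j]; last exact: smooth_sum.
apply/funext => x; apply: eq_bigr => j _; rewrite Dw_sum //.
by apply: eq_bigr => b _; rewrite DwZ //; apply: smooth_Mon.
Qed.

Lemma multiindex_size s j (b : multiindex n j) :
  (forall i, val b i = count_mem i s :> nat) -> j = size s.
Proof.
by move=> H; rewrite -(sum_multiindex b) -sum_count; apply: eq_bigr.
Qed.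

Lemma Dw_jet_poly_big k c s : (k <= size s)%N -> Dw s (jet_poly k c) = fun=> 0.
Proof.
move=> ks; rewrite Dw_jet_poly; apply/funext => x.
rewrite big1 // => j _; rewrite big1 // => b _; rewrite Dw_Mon_big ?mulr0 //.
by rewrite sum_multiindex (leq_trans (ltn_ord j)).
Qed.

Lemma Dw_jet_poly0 k c s : (size s < k)%N ->
  Dw s (jet_poly k c) 0 = c (size s) (multiindex_of s).
Proof.
move=> sk; rewrite Dw_jet_poly.
have Z j (b : multiindex n j) : ~ (forall i, val b i = count_mem i s :> nat) ->
    c j b * Dw s (Mon (fun i => val b i)) 0 = 0.
  move=> H; rewrite Dw_Mon0; case: forallP => [E|_]; last by rewrite mulr0.
  by case: H => i; apply/eqP.
rewrite (bigD1 (Ordinal sk)) //= [X in _ + X]big1 ?addr0; last first.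
  move=> j /eqP jk; rewrite big1 // => b _; apply: Z => /multiindex_size E.
  by apply: jk; apply/val_inj.
rewrite (bigD1 (multiindex_of s)) //= big1 ?addr0; last first.
  move=> b /eqP bs; apply: Z => H; apply: bs; apply/val_inj/ffunP => i.
  by apply/val_inj; exact: etrans (H i) (esym (multiindex_ofE s i)).
rewrite Dw_Mon0; case: forallP => [_|[]]; first by rewrite mulr1.
by move=> i; apply/eqP; exact: multiindex_ofE.
Qed.

(** The derivatives of order [k - 1] of a polynomial of degree less than [k] are
constant, hence equal to their values at the origin. *)
Lemma Dw_jet_poly_top k c s x : (size s).+1 = k ->
  Dw s (jet_poly k c) x = c (size s) (multiindex_of s).
Proof.
move=> sk; rewrite -(@Dw_jet_poly0 k) -?sk // !Dw_jet_poly.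
apply: eq_bigr => j _; apply: eq_bigr => b _; congr (_ * _).
have [js|js] := ltnP j (size s).
  by rewrite Dw_Mon_big // sum_multiindex.
have E : nat_of_ord j = size s by apply/eqP; rewrite eqn_leq js -ltnS ltn_ord.
by rewrite !Dw_Mon_eq // sum_multiindex.
Qed.

Definition partials_commute f :=
  forall i j r, partial i (partial j (Dw r f)) = partial j (partial i (Dw r f)).

Definition taylor k f := jet_poly k (fun j b => Dw (word_of b) f 0).

Lemma Dw_taylor0 k f s : partials_commute f -> (size s < k)%N ->
  Dw s (taylor k f) 0 = Dw s f 0.
Proof.
by move=> C sk; rewrite Dw_jet_poly0 // (Dw_perm C (perm_word_of s)).
Qed.

Lemma Dw_taylor_top k f s x : partials_commute f -> (size s).+1 = k ->
  Dw s (taylor k f) x = Dw s f 0.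
Proof.
by move=> C sk; rewrite Dw_jet_poly_top // (Dw_perm C (perm_word_of s)).
Qed.

End Smooth.

(** * A mollified fundamental solution *)

Section Profile.
Context {R : realType}.
Implicit Types (f g : R -> R) (t q c b : R).

(** Powers alone have no closed class of primitives, because of the exponent [-1];
with logarithms and nonnegative integer powers they have. *)
Inductive pow_log : (R -> R) -> Prop :=
| pl_pow q : pow_log (fun t => t `^ q)
| pl_log k : pow_log (fun t => t `^ k%:R * ln t)
| pl_add f g : pow_log f -> pow_log g -> pow_log (fun t => f t + g t)
| pl_scale c f : pow_log f -> pow_log (fun t => c * f t).

Lemma pow_log_primitive f : pow_log f ->
  exists2 g, pow_log g & forall t, 0 < t -> is_derive t 1 g (f t).
Proof.
elim=> {f} [q|k|f1 f2 _ [g1 pg1 d1] _ [g2 pg2 d2]|c f _ [g pg d]].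
- have [q1|q1] := eqVneq q (-1).
    exists (fun t => t `^ 0%:R * ln t); first exact: pl_log.
    move=> t t0; rewrite q1 powR_inv1 ?ltW //.
    have -> : (fun t : R => t `^ 0%:R * ln t) = @ln R.
      by apply/funext => s; rewrite powRr0 mul1r.
    exact: is_derive1_ln.
  exists (fun t => (q + 1)^-1 * t `^ (q + 1)); first exact/pl_scale/pl_pow.
  move=> t t0; apply: is_derive_eq.
    by apply: is_derive_scalef; apply: is_derive1_powR.
  by rewrite addrK mulrA mulVf ?mul1r // addr_eq0.
- pose a : R := k.+1%:R.
  have a0 : a != 0 by rewrite pnatr_eq0.
  exists (fun t => a^-1 * (t `^ a * ln t + - a^-1 * t `^ a)).
    by apply/pl_scale/pl_add; [apply: pl_log|apply/pl_scale/pl_pow].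
  move=> t t0; apply: is_derive_eq.
    apply: is_derive_scalef; apply: is_derive_addf.
      by apply: is_derive_mulf; [apply: is_derive1_powR|apply: is_derive1_ln].
    by apply: is_derive_scalef; apply: is_derive1_powR.
  have -> : a - 1 = k%:R by rewrite /a -natr1 addrK.
  have -> : t `^ a = t `^ k%:R * t.
    by rewrite /a -natr1 powRD ?powRr1 ?ltW // gt_eqF ?implybT.
  have t1 : t != 0 by rewrite gt_eqF.
  by clearbody a; field; rewrite t1 a0.
- exists (fun t => g1 t + g2 t); first exact: pl_add.
  by move=> t t0; apply: is_derive_addf; [apply: d1|apply: d2].
- exists (fun t => c * g t); first exact: pl_scale.
  by move=> t t0; apply: is_derive_scalef; apply: d.
Qed.

Definition rising b (i : nat) : R := \prod_(0 <= k < i) (b + k%:R).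

(** Starting from [t^(-b)], differentiate forever and integrate [m] times.  The
primitives may contain a logarithm, whence the indirect construction. *)
Lemma profile_exists b m : exists H : nat -> R -> R,
  (forall j t, 0 < t -> is_derive t 1 (H j) (H j.+1 t)) /\
  (forall i t, 0 < t -> H (m + i)%N t = (-1) ^+ i * rising b i * t `^ (- b - i%:R)).
Proof.
suff [H [_ d e]] : exists H : nat -> R -> R, [/\ pow_log (H 0%N),
  forall j t, 0 < t -> is_derive t 1 (H j) (H j.+1 t) &
  forall i t, 0 < t -> H (m + i)%N t = (-1) ^+ i * rising b i * t `^ (- b - i%:R)].
  by exists H.
elim: m => [|m [H [p d e]]].
  exists (fun i t => (-1) ^+ i * rising b i * t `^ (- b - i%:R)); split=> //.
    exact/pl_scale/pl_pow.
  move=> j t t0; apply: is_derive_eq.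
    by apply: is_derive_scalef; apply: is_derive1_powR.
  rewrite {2}/rising big_nat_recr //= -/(rising b j) exprS -natr1.
  have -> : - b - (j%:R + 1) = - b - j%:R - 1 by ring.
  ring.
have [g pg dg] := pow_log_primitive p.
exists (fun j => if j is k.+1 then H k else g); split=> //.
by case=> [|j] t t0; [apply: dg|apply: d].
Qed.

End Profile.

Section Kernel.
Context {R : realType} {n : nat}.
Implicit Types (x : 'rV[R]_n) (e : R) (s : seq 'I_n).

Definition sqn x : R := \sum_(i < n) x ord0 i ^+ 2.
(** The square of the distance to the origin, mollified at the scale [e]. *)
Definition wt e x : R := e ^+ 2 + sqn x.

Lemma sqn_ge0 x : 0 <= sqn x.
Proof. by apply: sumr_ge0 => i _; apply: sqr_ge0. Qed.

Lemma wt_gt0 e x : 0 < e -> 0 < wt e x.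
Proof. by move=> e0; apply: ltr_pwDl; rewrite ?exprn_gt0 ?sqn_ge0. Qed.

Lemma coord_le_wt e x i : x ord0 i ^+ 2 <= wt e x.
Proof.
rewrite /wt /sqn (bigD1 i) //= addrCA lerDl addr_ge0 ?sqr_ge0 //.
by apply: sumr_ge0 => j _; apply: sqr_ge0.
Qed.

Lemma eps_le_wt e x : e ^+ 2 <= wt e x.
Proof. by rewrite lerDl sqn_ge0. Qed.

Lemma is_derive_sqn x i : is_derive x (ebasis i) sqn (2 * x ord0 i).
Proof.
apply: is_derive_eq.
  apply: is_derive_sumf => j; apply: is_derive_expn.
  exact: is_derive_coord.
rewrite (bigD1 i) //= eqxx mulr1 expr1 big1 ?addr0 // => j ji.
by rewrite eq_sym (negPf ji) mulr0.
Qed.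

Lemma is_derive_wt e x i : is_derive x (ebasis i) (wt e) (2 * x ord0 i).
Proof.
apply: is_derive_eq; first by apply: is_derive_addf; apply: is_derive_sqn.
by rewrite add0r.
Qed.

Variables (H : nat -> R -> R).
Hypothesis dH : forall j (t : R), 0 < t -> is_derive t 1 (H j) (H j.+1 t).

(** Syntax for the derivatives of [H 0 (wt e x)].  As the syntax does not mention
the scale [e], constants extracted from it are uniform in [e]. *)
Inductive term :=
| TG of nat
| TX of 'I_n & term
| TA of term & term
| TC of R & term.

Fixpoint eval e (t : term) x : R :=
  match t with
  | TG j => H j (wt e x)
  | TX i t => x ord0 i * eval e t x
  | TA t u => eval e t x + eval e u x
  | TC c t => c * eval e t x
  end.

Fixpoint dT (i : 'I_n) t :=
  match t with
  | TG j => TC 2 (TX i (TG j.+1))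
  | TX k t => TA (TC (i == k)%:R t) (TX k (dT i t))
  | TA t u => TA (dT i t) (dT i u)
  | TC c t => TC c (dT i t)
  end.

(** The number of derivatives a term stands for: differentiating [H j] costs two
and is paid back by the factor [x_i]. *)
Fixpoint order_of t (k : nat) : Prop :=
  match t with
  | TG j => k = (2 * j)%N
  | TX _ t => order_of t k.+1
  | TA t u => order_of t k /\ order_of u k
  | TC c t => c = 0 \/ order_of t k
  end.

Lemma order_dT i t k : order_of t k -> order_of (dT i t) k.+1.
Proof.
elim: t k => [j|l t IH|t IHt u IHu|c t IH] k /=.
- by move=> ->; right; lia.
- by move=> ot; split; [right|apply: IH].
- by case=> /IHt ? /IHu ?.
- by case=> [->|/IH]; [left|right].
Qed.

Section Fixed.
Variables (e : R) (e0 : 0 < e).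

Lemma is_derive_eval t x i : is_derive x (ebasis i) (eval e t) (eval e (dT i t) x).
Proof.
elim: t => [j|k t IH|t IHt u IHu|c t IH] /=.
- apply: is_derive_eq.
    by apply: is_derive_chain; [apply/dH/wt_gt0|apply: is_derive_wt].
  ring.
- apply: is_derive_eq.
    exact: is_derive_mulf (is_derive_coord _ _ _) IH.
  by rewrite addrC.
- exact: is_derive_addf.
- exact: is_derive_scalef.
Qed.

Lemma is_derive_evals t s x i :
  is_derive x (ebasis i) (eval e (foldr dT t s)) (eval e (foldr dT t (i :: s)) x).
Proof. exact: is_derive_eval. Qed.

Lemma smooth_eval t : smooth (eval e t).
Proof. exact: (smooth_family (is_derive_evals t)). Qed.

Lemma Dw_eval t s : Dw s (eval e t) = eval e (foldr dT t s).
Proof. exact: (Dw_family (is_derive_evals t)). Qed.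

Lemma eval_dTC i j t x : eval e (dT i (dT j t)) x = eval e (dT j (dT i t)) x.
Proof.
elim: t => [k|k t IH|t IHt u IHu|c t IH] /=; last 3 first.
- by rewrite IH; ring.
- by rewrite IHt IHu.
- by rewrite IH.
by rewrite (eq_sym i j); ring.
Qed.

Lemma commute_eval t : partials_commute (eval e t).
Proof.
move=> i j s; rewrite -[LHS]/(Dw [:: i, j & s] (eval e t)).
rewrite -[RHS]/(Dw [:: j, i & s] (eval e t)) !Dw_eval.
by apply/funext => x; apply: eval_dTC.
Qed.

Lemma laplacian_smooth (f : 'rV[R]_n -> R) :
  laplacian f = fun x => \sum_(i < n) Dw [:: i; i] f x.
Proof. by []. Qed.

Definition TL t := foldr (fun i u => TA (dT i (dT i t)) u) (TC 0 (TG 0)) (enum 'I_n).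

Definition TS t := foldr (fun i u => TA (TX i (TX i t)) u) (TC 0 (TG 0)) (enum 'I_n).

Lemma order_TL t k : order_of t k -> order_of (TL t) k.+2.
Proof.
move=> ot; rewrite /TL; elim: (enum 'I_n) => [|i r IH] /=; first by left.
by split=> //; do 2![apply: order_dT].
Qed.

Lemma eval_TL t : eval e (TL t) = laplacian (eval e t).
Proof.
apply/funext => x; rewrite laplacian_smooth -big_enum /TL.
elim: (enum 'I_n) => [|i r IH] /=; first by rewrite big_nil mul0r.
rewrite big_cons IH; congr (_ + _).
by rewrite -[RHS]/(Dw [:: i; i] (eval e t) x) Dw_eval.
Qed.

Lemma eval_TS t x : eval e (TS t) x = sqn x * eval e t x.
Proof.
rewrite /sqn -big_enum /TS; elim: (enum 'I_n) => [|i r IH] /=.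
  by rewrite big_nil !mul0r.
by rewrite big_cons IH; ring.
Qed.

Definition rad i l x := sqn x ^+ i * H l (wt e x).

Lemma radE i l : rad i l = eval e (iter i TS (TG l)).
Proof.
apply/funext => x; rewrite /rad; elim: i => [|i IH] /=; first by rewrite mul1r.
by rewrite eval_TS -IH exprS mulrA.
Qed.

Lemma smooth_rad i l : smooth (rad i l).
Proof. by rewrite radE; apply: smooth_eval. Qed.

Lemma is_derive_rad i l x a : is_derive x (ebasis a) (rad i l)
  (2 * x ord0 a * (i%:R * rad i.-1 l x + rad i l.+1 x)).
Proof.
apply: is_derive_eq.
  apply: is_derive_mulf; first by apply: is_derive_expn; apply: is_derive_sqn.
  by apply: is_derive_chain; [apply/dH/wt_gt0|apply: is_derive_wt].
by rewrite /rad; ring.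
Qed.

Lemma laplacian_rad i l x : laplacian (rad i l) x =
  (2 * n%:R + 4 * (i%:R - 1)) * i%:R * rad i.-1 l x + (2 * n%:R + 8 * i%:R) * rad i l.+1 x
  + 4 * rad i.+1 l.+2 x.
Proof.
rewrite /laplacian.
have E a : partial a (rad i l) = fun x => 2 * x ord0 a * (i%:R * rad i.-1 l x + rad i l.+1 x).
  by apply: is_derive_partial => y; apply: is_derive_rad.
have E2 a : partial a (partial a (rad i l)) x =
    2 * (i%:R * rad i.-1 l x + rad i l.+1 x) +
    4 * x ord0 a ^+ 2 * (i%:R * (i.-1%:R * rad i.-2 l x + 2 * rad i.-1 l.+1 x) + rad i l.+2 x).
  rewrite E; apply: (@derive_val _ _ _ _ _ _ _ _); apply: is_derive_eq.
    apply: is_derive_mulf; first by apply: is_derive_scalef; apply: is_derive_coord.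
    apply: is_derive_addf; first by apply: is_derive_scalef; apply: is_derive_rad.
    exact: is_derive_rad.
  rewrite eqxx -[nat_of_bool true]/1%N. ring.
under eq_bigr do rewrite E2.
rewrite big_split /= sumr_const card_ord -mulr_suml -mulr_sumr -/(sqn x).
rewrite -mulr_natr /rad.
case: i {E E2} => [|[|i]] /=; rewrite ?exprS ?expr0 -?natr1; ring.
Qed.

Lemma laplacian_sum k (a : R) (c : 'I_k -> R) (F : 'I_k -> 'rV[R]_n -> R) x :
  (forall i, smooth (F i)) ->
  laplacian (fun x => a * \sum_(i < k) c i * F i x) x = a * \sum_(i < k) c i * laplacian (F i) x.
Proof.
move=> sF; have sc i : smooth (fun x => c i * F i x) by exact: smoothZ.
have ss : smooth (fun x => \sum_(i < k) c i * F i x) by exact: smooth_sum.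
have E t : Dw t (fun x => a * \sum_(i < k) c i * F i x) = fun x => a * \sum_(i < k) c i * Dw t (F i) x.
  rewrite (DwZ ss); apply/funext => y; rewrite (Dw_sum _ sc); congr (_ * _).
  by apply: eq_bigr => i _; rewrite DwZ.
rewrite laplacian_smooth; under eq_bigr => j _ do rewrite E.
rewrite -mulr_sumr exchange_big; congr (_ * _); apply: eq_bigr => i _.
by rewrite laplacian_smooth mulr_sumr.
Qed.

Variable b : R.
Hypothesis nb : n%:R = 2 * b.

Definition lap_coef (k i : nat) : R := 'C(k, i)%:R * \prod_(i <= t < k) (b + t%:R).

(** The recurrence that one more Laplacian imposes on the coefficients of the radial
terms; it mixes the rule of Pascal with the shift of the rising factorial. *)
Lemma lap_coefS k i : lap_coef k.+1 i =
  lap_coef k i.+1 * (i.+1%:R * (b + i%:R)) + (b + 2 * i%:R) * lap_coef k i +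
  (if i is i'.+1 then lap_coef k i' else 0).
Proof.
rewrite /lap_coef.
have [ik|ki|ik] := ltngtP i k.+1; last 2 first.
- case: i ki => // i ki; rewrite !bin_small; [ring|lia..].
- subst i; rewrite /= (@bin_small k k.+2) // (@bin_small k k.+1) // !binn !big_geq //; [ring|lia].
set p := \prod_(i <= t < k) (b + t%:R).
have -> : \prod_(i <= t < k.+1) (b + t%:R) = p * (b + k%:R).
  by rewrite big_nat_recr.
have -> : 'C(k, i.+1)%:R * (\prod_(i.+1 <= t < k) (b + t%:R)) * (i.+1%:R * (b + i%:R)) =
    (k%:R - i%:R) * 'C(k, i)%:R * p.
  have -> : (k%:R - i%:R) * 'C(k, i)%:R = 'C(k, i.+1)%:R * i.+1%:R :> R.
    have ik' : (i <= k)%N by [].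
    by rewrite -(natrB _ ik') -!natrM -mul_bin_left mulnC.
  move: ik; rewrite ltnS leq_eqVlt => /orP[/eqP ik|ik].
    by rewrite ik (@bin_small k) //; ring.
  by rewrite /p [in RHS]big_ltn //; ring.
case: i ik @p => [|i] ik p; first by rewrite !bin0; ring.
have -> : \prod_(i <= t < k) (b + t%:R) = (b + i%:R) * p.
  by rewrite big_ltn.
have E : i.+1%:R * 'C(k, i.+1)%:R = (k%:R - i%:R) * 'C(k, i)%:R :> R.
  have ik' : (i <= k)%N by apply: ltnW.
  by rewrite -(natrB _ ik') -!natrM -mul_bin_left.
rewrite binS natrD.
have iE : i.+1%:R = i%:R + 1 :> R by rewrite natr1.
rewrite iE in E *.
move: ('C(k, i.+1)%:R : R) ('C(k, i)%:R : R) E => A B E.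
have -> : (A + B) * (p * (b + k%:R)) =
   A * (p * (b + k%:R)) + B * (p * (b + i%:R)) + (k%:R - i%:R) * B * p by ring.
rewrite -E; ring.
Qed.

Lemma iter_laplacian_rad k x : iter k (@laplacian R n) (rad 0 0) x =
  4 ^+ k * \sum_(i < k.+1) lap_coef k i * rad i (k + i)%N x.
Proof.
elim: k x => [|k IH] x.
  by rewrite big_ord1 /= /lap_coef bin0 big_geq //; ring.
rewrite iterS (funext IH).
rewrite (@laplacian_sum _ _ _ (fun i : 'I_k.+1 => rad i (k + i)%N)); last first.
  by move=> i; apply: smooth_rad.
pose Q i := rad i (k.+1 + i)%N x.
have L i : laplacian (rad i (k + i)%N) x = 4 * (
    (if i is i'.+1 then i%:R * (b + i'%:R) * Q i' else 0) + (b + 2 * i%:R) * Q i + Q i.+1).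
  rewrite laplacian_rad nb /Q; case: i => [|i] /=.
    by rewrite !addn0 !addn1; ring.
  rewrite !addSn !addnS -natr1; ring.
rewrite exprSr -mulrA; congr (_ * _).
under eq_bigr => i _ do rewrite L mulrCA.
rewrite -mulr_sumr; congr (_ * _).
have c0 i : (k < i)%N -> lap_coef k i = 0 by move=> ki; rewrite /lap_coef bin_small ?mul0r.
under [RHS]eq_bigr => i _ do rewrite lap_coefS 2!(mulrDl _ _ (rad _ _ _)).
under [LHS]eq_bigr => i _ do rewrite 2!mulrDr.
rewrite !big_split /=; congr (_ + _ + _).
- rewrite big_ord_recl mulr0 add0r [RHS]big_ord_recr [X in _ = X + _]big_ord_recr /=.
  rewrite !c0 // !mul0r !addr0; apply: eq_bigr => i _.
  by rewrite /bump /= add1n !mulrA.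
- rewrite [RHS]big_ord_recr /= c0 // mulr0 mul0r addr0.
  by apply: eq_bigr => i _; rewrite /Q; ring.
- by rewrite [RHS]big_ord_recl /= mul0r add0r.
Qed.

End Fixed.

Variables (m : nat) (b : R).
Hypothesis nb : n%:R = 2 * b.
Hypothesis Htop : forall i t, 0 < t -> H (m + i)%N t = (-1) ^+ i * rising b i * t `^ (- b - i%:R).

Definition bubble e x : R :=
  4 ^+ m * rising b m * e ^+ (2 * m) * wt e x `^ (- b - m%:R).

(** After [m] Laplacians all radial terms are powers of [w] times powers of [|x|^2], and the
binomial theorem sums them, up to one power of [w], to [(w - |x|^2)^m = e^(2m)]. *)
Lemma iter_laplacian_kernel e x : 0 < e ->
  iter m (@laplacian R n) (eval e (TG 0)) x = bubble e x.
Proof.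
move=> e0; have -> : eval e (TG 0) = rad e 0 0.
  by apply/funext => y; rewrite /rad mul1r.
rewrite (iter_laplacian_rad e0 nb) /bubble -!mulrA; congr (_ * _).
have w0 := wt_gt0 x e0; set w := wt e x in w0 *.
have E (i : 'I_m.+1) : lap_coef b m i * rad e i (m + i)%N x =
    rising b m * w `^ (- b - m%:R) * (w ^+ (m - i) * (- sqn x) ^+ i *+ 'C(m, i)).
  have im : (i <= m)%N by rewrite -ltnS.
  rewrite /rad Htop // /lap_coef.
  have -> : rising b m = rising b i * \prod_(i <= t < m) (b + t%:R).
    by rewrite /rising [LHS](@big_cat_nat _ _ _ i).
  have -> : w `^ (- b - i%:R) = w `^ (- b - m%:R) * w ^+ (m - i).
    rewrite -powR_mulrn ?ltW // -powRD; last by rewrite (gt_eqF w0) implybT.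
    by congr (_ `^ _); rewrite natrB //; ring.
  rewrite -mulr_natl (exprNn (sqn x)) -/w; ring.
rewrite (eq_bigr _ (fun i _ => E i)) -mulr_sumr -exprDn.
have -> : w + - sqn x = e ^+ 2 by rewrite /w /wt; ring.
by rewrite -exprM; ring.
Qed.

(** By homogeneity.  The condition on [k] excludes the low-order primitives, which may
contain logarithms. *)
Lemma eval_bound t k : order_of t k -> (m <= uphalf k)%N ->
  exists2 C, 0 <= C & forall e x, 0 < e ->
    `|eval e t x| <= C * wt e x `^ (m%:R - b - k%:R / 2).
Proof.
elim: t k => [j|l t IH|t IHt u IHu|c t IH] k /=.
- move=> -> mj; have mj' : (m <= j)%N by lia.
  exists `|(-1) ^+ (j - m) * rising b (j - m)| => // e x e0.
  have w0 := wt_gt0 x e0.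
  rewrite -{1}(subnKC mj') Htop // normrM (ger0_norm (powR_ge0 _ _)).
  apply: eqr_le; congr (_ * _ `^ _).
  by rewrite natrB // natrM; field.
- move=> /IH H1 mk; case: H1 => [|C C0 HC]; first by lia.
  exists C => // e x e0; have w0 := wt_gt0 x e0.
  rewrite normrM.
  have -> : m%:R - b - k%:R / 2 = 2^-1 + (m%:R - b - k.+1%:R / 2) :> R.
    by rewrite -natr1; field.
  rewrite powRD; last by rewrite (gt_eqF w0) implybT.
  rewrite mulrCA; apply: ler_pM => //; last exact: HC.
  rewrite (powR12_sqrt (ltW w0)) -(sqrtr_sqr (x ord0 l)).
  by apply: ler_wsqrtr; apply: coord_le_wt.
- case=> /IHt {}IHt /IHu {}IHu mk.
  have [C1 C10 H1] := IHt mk; have [C2 C20 H2] := IHu mk.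
  exists (C1 + C2); first exact: addr_ge0.
  move=> e x e0; rewrite mulrDl; apply: le_trans (ler_normD _ _) _.
  by apply: lerD; [apply: H1|apply: H2].
- case=> [->|/IH {}IH] mk.
    by exists 0 => // e x e0; rewrite mul0r normr0 mul0r.
  have [C C0 HC] := IH mk.
  exists (`|c| * C); first exact: mulr_ge0.
  by move=> e x e0; rewrite normrM -mulrA ler_wpM2l //; apply: HC.
Qed.

Lemma order_dTs t s k : order_of t k -> order_of (foldr dT t s) (size s + k).
Proof. by move=> H0; elim: s => //= i s IH; apply: order_dT. Qed.

Lemma order_iter_TL t k j : order_of t k -> order_of (iter j TL t) (2 * j + k).
Proof.
move=> H0; elim: j => //= j IH; rewrite mulnS addSn addSn.
exact: order_TL.
Qed.

Lemma eval_iter_TL e t j : 0 < e -> eval e (iter j TL t) = iter j (@laplacian R n) (eval e t).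
Proof.
move=> e0; elim: j => [|j IH]; first by [].
by rewrite !iterS (eval_TL e0) IH.
Qed.

End Kernel.

(** * Sums over a lattice *)

Section LatticeLine.
Context {R : realType}.
Implicit Types (e h s t tau : R).

Lemma is_derive_line_weight e s p : 0 < e ->
  is_derive s 1 (fun s : R => (e ^+ 2 + s ^+ 2) `^ p) (p * (e ^+ 2 + s ^+ 2) `^ (p - 1) * (2 * s)).
Proof.
move=> e0; have w0 : 0 < e ^+ 2 + s ^+ 2.
  by rewrite ltr_pwDl ?exprn_gt0 // sqr_ge0.
have H1 : is_derive s (1 : R) (fun s : R => e ^+ 2 + s ^+ 2) (2 * s).
  have H2 := @is_deriveX R R^o id 2 s 1 1 (is_derive_id s 1).
  apply: is_derive_eq (is_derive_addf (is_derive_cst (e ^+ 2) s 1) H2) _.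
  by rewrite add0r /= expr1 [_ *: _]mulr1 mulr_natl.
have H3 := @is_derive1_powR R p _ w0.
exact: (@is_derive1_comp R (fun u => u `^ p) (fun s => e ^+ 2 + s ^+ 2) s _ _ H3 H1).
Qed.

(** The sum is compared with increments of [s (e^2 + s^2)^(-tau/2)], whose
derivative dominates [(1 - tau) (e^2 + s^2)^(-tau/2)]. *)
Lemma line_sum_bound tau : 0 < tau < 1 -> exists2 C : R, 0 <= C &
  forall (G : nat) e t, (0 < G)%N -> 0 < e <= 1 -> G%:R^-1 <= e -> `|t| <= 2 ->
  \sum_(k < G.*2.+1) G%:R^-1 * (e ^+ 2 + (t - (k%:R / G%:R - 1)) ^+ 2) `^ (- (tau / 2)) <= C.
Proof.
move=> /andP[tau0 tau1].
pose c : R := 4 `^ (- (tau / 2)).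
have c0 : 0 < c by apply: powR_gt0.
pose d := c * (1 - tau).
have d0 : 0 < d by rewrite mulr_gt0 // subr_gt0.
(* [34] is twice the bound [17 = 1 + 4^2] for the telescoped function on [|s| <= 4] *)
exists (d^-1 * 34); first by rewrite mulr_ge0 // invr_ge0 ltW.
move=> G e t G0 /andP[e0 e1] he t2.
set h : R := G%:R^-1 in he *.
have h0 : 0 < h by rewrite invr_gt0 ltr0n.
have Gh : G%:R * h = 1 by rewrite mulfV // pnatr_eq0 -lt0n.
pose W s := e ^+ 2 + s ^+ 2.
have W0 s : 0 < W s by rewrite ltr_pwDl ?exprn_gt0 // sqr_ge0.
pose B s := s * W s `^ (- (tau / 2)).
pose p (k : nat) := k%:R * h - 1 - t.
have step k : h * W (p k) `^ (- (tau / 2)) <= d^-1 * (B (p k.+1) - B (p k)).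
  have pS : p k.+1 - p k = h by rewrite /p -natr1; ring.
  have [xi /andP[x1 x2] E] : exists2 xi, p k <= xi <= p k.+1 & B (p k.+1) - B (p k) =
     (xi * (- (tau / 2) * W xi `^ (- (tau / 2) - 1) * (2 * xi)) + 1 * W xi `^ (- (tau / 2)))
       * (p k.+1 - p k).
    apply: mvt1; first by rewrite -subr_ge0 pS ltW.
    move=> s _; apply: (@is_derive_mulf R R^o (fun s => s)).
    exact: is_derive_line_weight.
  rewrite E pS [X in d^-1 * X]mulrC mulrCA ler_pM2l // ler_pdivlMl //.
  have -> : W xi `^ (- (tau / 2) - 1) = W xi `^ (- (tau / 2)) / W xi.
    by rewrite powRD ?(gt_eqF (W0 xi)) ?implybT // powR_inv1 // ltW.
  have H1 : (1 - tau) * W xi `^ (- (tau / 2)) <=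
     xi * (- (tau / 2) * (W xi `^ (- (tau / 2)) / W xi) * (2 * xi)) + 1 * W xi `^ (- (tau / 2)).
    have -> : xi * (- (tau / 2) * (W xi `^ (- (tau / 2)) / W xi) * (2 * xi)) + 1 * W xi `^ (- (tau / 2))
       = (1 - tau * (xi ^+ 2 / W xi)) * W xi `^ (- (tau / 2)).
      by field; rewrite gt_eqF.
    rewrite ler_wpM2r ?powR_ge0 // lerD2l lerN2; apply: ler_piMr; first exact: ltW.
    by rewrite ler_pdivrMr // mul1r lerDr ltW // exprn_gt0.
  apply: le_trans H1; rewrite /d mulrAC [leRHS]mulrC ler_wpM2r ?subr_ge0 ?(ltW tau1) //.
  have W4 : W xi <= 4 * W (p k).
    have : `|xi - p k| <= h by rewrite ger0_norm ?subr_ge0 // -pS lerD2r.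
    rewrite ler_norml => /andP[y1 y2]; rewrite /W.
    have : (xi - p k) ^+ 2 <= e ^+ 2 by rewrite lerXn2r ?nnegrE ?subr_ge0 ?(ltW e0) //; lra.
    nra.
  rewrite /c -powRM ?(ltW (W0 _)) // !powRN lef_pV2 ?posrE ?powR_gt0 ?mulr_gt0 //.
  by apply: ge0_ler_powR; rewrite ?nnegrE ?mulr_ge0 ?divr_ge0 ?(ltW (W0 _)) ?(ltW tau0).
apply: (@le_trans _ _ (\sum_(k < G.*2.+1) d^-1 * (B (p k.+1) - B (p k)))).
  apply: ler_sum => k _; apply: le_trans (step k).
  have -> : t - (k%:R / G%:R - 1) = - p k by rewrite /p -/h; ring.
  by rewrite sqrrN.
rewrite -mulr_sumr ler_wpM2l ?invr_ge0 ?(ltW d0) //.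
rewrite -(big_mkord predT (fun k => B (p k.+1) - B (p k))) telescope_sumr //.
have Bb s : `|s| <= 4 -> `|B s| <= 17.
  move=> s4; rewrite normrM (ger0_norm (powR_ge0 _ _)).
  have sW : `|s| <= W s `^ 2^-1.
    rewrite (powR12_sqrt (ltW (W0 s))) -(sqrtr_sqr s) ler_wsqrtr //.
    by rewrite lerDr ltW // exprn_gt0.
  apply: (@le_trans _ _ (W s `^ 2^-1 * W s `^ (- (tau / 2)))).
    by rewrite ler_wpM2r ?powR_ge0.
  rewrite -powRD ?(gt_eqF (W0 s)) ?implybT //.
  have W17 : W s <= 17.
    have : e ^+ 2 <= 1 by rewrite expr_le1 // ltW.
    move: s4; rewrite /W ler_norml => /andP[]; nra.
  apply: (@le_trans _ _ (17 `^ (2^-1 - tau / 2))).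
    by apply: ge0_ler_powR; rewrite ?nnegrE ?(ltW (W0 _)) //; lra.
  rewrite -{2}(@powRr1 _ 17) //; apply: ler_powR; [lra|lra].
have p0 : `|p 0%N| <= 4 by move: t2; rewrite /p !ler_norml; lra.
have pn : `|p G.*2.+1| <= 4.
  have -> : p G.*2.+1 = 1 + h - t.
    rewrite /p -natr1 -muln2 natrM.
    have -> : (G%:R * 2%:R + 1) * h = 2 * (G%:R * h) + h by ring.
    by rewrite Gh; ring.
  by move: t2; rewrite !ler_norml; lra.
move: (Bb _ p0) (Bb _ pn); rewrite !ler_norml; lra.
Qed.

End LatticeLine.

Section Weights.
Context {R : realType} {n : nat}.
Implicit Types (x y z : 'rV[R]_n) (e : R).

Lemma sqn_triangle x z : sqn x <= 2 * sqn z + 2 * sqn (z - x).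
Proof.
rewrite /sqn !mulr_sumr -big_split /=; apply: ler_sum => i _.
have -> : (z - x) ord0 i = z ord0 i - x ord0 i by rewrite !mxE.
have := sqr_ge0 (2 * z ord0 i - x ord0 i); lra.
Qed.

Lemma coord_le_dist x y i : `|y ord0 i - x ord0 i| <= `|x - y|.
Proof.
rewrite distrC; have -> : x ord0 i - y ord0 i = (x - y) ord0 i by rewrite !mxE.
exact: coord_le_norm.
Qed.

Lemma sum_coord_le_dist x y : \sum_(i < n) `|y ord0 i - x ord0 i| <= n%:R * `|x - y|.
Proof.
apply: (@le_trans _ _ (\sum_(i < n) `|x - y|)); last by rewrite sumr_const card_ord mulr_natl.
by apply: ler_sum => i _; apply: coord_le_dist.
Qed.

Lemma sqnN x : sqn (- x) = sqn x.
Proof. by apply: eq_bigr => i _; rewrite mxE sqrrN. Qed.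

Lemma wt_comparable e x z : sqn (z - x) <= wt e x / 4 -> wt e x <= 4 * wt e z.
Proof.
move=> H; have := sqn_triangle x z; have := sqn_ge0 z.
have := sqr_ge0 e; move: H; rewrite /wt; lra.
Qed.

Lemma sqn_le_norm x : sqn x <= n%:R * `|x| ^+ 2.
Proof.
apply: (@le_trans _ _ (\sum_(i < n) `|x| ^+ 2)); last first.
  by rewrite sumr_const card_ord mulr_natl.
apply: ler_sum => i _; rewrite -real_normK ?num_real // lerXn2r ?nnegrE //.
exact: coord_le_norm.
Qed.

Lemma norm_le_wt e x : `|x| ^+ 2 <= wt e x.
Proof.
rewrite -(sqr_sqrtr (_ : 0 <= wt e x)); last by rewrite addr_ge0 ?sqr_ge0 ?sqn_ge0.
rewrite lerXn2r ?nnegrE ?sqrtr_ge0 //; apply: norm_le_coord; first exact: sqrtr_ge0.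
by move=> i; rewrite -(sqrtr_sqr (x ord0 i)) ler_wsqrtr // coord_le_wt.
Qed.

Lemma norm_le_wt_powR e x : 0 < e -> `|x| <= wt e x `^ 2^-1.
Proof.
move=> e0; have w0 := wt_gt0 x e0.
rewrite (powR12_sqrt (ltW w0)) -(normr_id x) -(sqrtr_sqr `|x|) ler_wsqrtr //.
exact: norm_le_wt.
Qed.

(** The cube [|x| <= 1] with mesh [1 / G]. *)
Definition node (G : nat) : finType := {ffun 'I_n -> 'I_(G.*2.+1)}.

Definition pt G (nu : node G) : 'rV[R]_n := \row_i ((nu i)%:R / G%:R - 1).

(** As each coordinate satisfies [e^2 + x_i^2 <= w], the sum over the lattice is
at most a product of [n] sums over a line. *)
Lemma lattice_sum_bound (delta : R) : 0 < delta < 1 -> (0 < n)%N ->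
  exists2 C : R, 0 < C & forall G e x, (0 < G)%N -> 0 < e <= 1 -> G%:R^-1 <= e -> `|x| <= 2 ->
    G%:R^-1 ^+ n * \sum_(nu : node G) wt e (x - pt nu) `^ (- ((n%:R - delta) / 2)) <= C.
Proof.
move=> /andP[d0 d1] n0; pose tau := (n%:R - delta) / n%:R.
have n1 : 1 <= n%:R :> R by rewrite ler1n.
have tau01 : 0 < tau < 1.
  by rewrite /tau divr_gt0 ?subr_gt0 ?ltr_pdivrMr ?ltr0n ?(lt_le_trans d1) //=; lra.
have [C C0 HC] := line_sum_bound tau01.
exists ((C + 1) ^+ n); first by rewrite exprn_gt0 // ltr_wpDl.
move=> G e x G0 e01 he x2.
have e0 : 0 < e by case/andP: e01.
apply: (@le_trans _ _ (C ^+ n)); last first.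
  by rewrite lerXn2r ?nnegrE ?addr_ge0 // lerDl.
pose a (i : 'I_n) (k : 'I_(G.*2.+1)) : R :=
  G%:R^-1 * (e ^+ 2 + (x ord0 i - (k%:R / G%:R - 1)) ^+ 2) `^ (- (tau / 2)).
apply: (@le_trans _ _ (\prod_(i < n) \sum_(k < G.*2.+1) a i k)); last first.
  rewrite -[in leRHS](card_ord n) -prodr_const; apply: ler_prod => i _.
  rewrite sumr_ge0 => [|k _]; last by rewrite mulr_ge0 ?powR_ge0.
  by apply: HC => //; apply: le_trans x2; apply: coord_le_norm.
rewrite bigA_distr_bigA /= mulr_sumr; apply: ler_sum => nu _.
rewrite /a big_split /= prodr_const card_ord ler_wpM2l ?exprn_ge0 //.
have w0 := wt_gt0 (x - pt nu) e0; set w := wt e _ in w0 *.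
have -> : w `^ (- ((n%:R - delta) / 2)) = \prod_(i < n) w `^ (- (tau / 2)).
  rewrite prodr_const card_ord -powR_mulrn ?powR_ge0 // -powRrM; congr (_ `^ _).
  by rewrite /tau; field; rewrite pnatr_eq0 -lt0n.
apply: ler_prod => i _; rewrite powR_ge0 /= !powRN lef_pV2 ?posrE ?powR_gt0 //; last first.
  by rewrite ltr_pwDl ?exprn_gt0 ?sqr_ge0.
have tau2 : 0 <= tau / 2 by case/andP: tau01 => t0 _; lra.
apply: ge0_ler_powR; rewrite ?nnegrE ?(ltW w0) ?addr_ge0 ?sqr_ge0 //.
rewrite /w /wt lerD2l /sqn (bigD1 i) //= !mxE lerDl sumr_ge0 // => j _.
exact: sqr_ge0.
Qed.

End Weights.

(** * Uniform bounds for the kernel *)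

Section FiniteChoice.
Context {R : realType}.

Lemma uniform_constant (T : finType) (P : T -> R -> Prop) :
  (forall t C C', C <= C' -> P t C -> P t C') ->
  (forall t, exists2 C, 0 <= C & P t C) -> exists2 C, 0 < C & forall t, P t C.
Proof.
move=> mono ex.
have ex2 t : exists C, 0 <= C /\ P t C by have [C] := ex t; exists C.
have [f Hf] := choice ex2.
exists (1 + \sum_t f t).
  by rewrite ltr_pwDl // sumr_ge0 // => t _; case: (Hf t).
move=> t; apply: mono (Hf t).2; rewrite (bigD1 t) //= addrCA lerDl addr_ge0 //.
by rewrite sumr_ge0 // => u _; case: (Hf u).
Qed.

Lemma uniform_constant_words n k (P : seq 'I_n -> R -> Prop) :
  (forall s C C', C <= C' -> P s C -> P s C') ->
  (forall s, size s = k -> exists2 C, 0 <= C & P s C) ->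
  exists2 C, 0 < C & forall s, size s = k -> P s C.
Proof.
move=> mono ex.
have [C C0 HC] : exists2 C, 0 < C & forall t : k.-tuple 'I_n, P t C.
  apply: uniform_constant => [t|t]; first exact: mono.
  by apply: ex; rewrite size_tuple.
by exists C => // s /eqP sk; apply: (HC (Tuple sk)).
Qed.

End FiniteChoice.

Section KernelBounds.
Context {R : realType} {n : nat}.
Implicit Types (x z : 'rV[R]_n) (e : R).

(** A function whose size is [w^(-q)] and whose gradient has size [w^(-q-1/2)] is
Hoelder continuous at the cost of [w^(-alpha/2)]: the gradient bound is used when
the two points are close compared with their distance to the singularity, the size
bound otherwise. *)
Lemma weight_holder (f : 'rV[R]_n -> R) (df : 'I_n -> 'rV[R]_n -> R) (e q C alpha : R) :
  0 < e -> 0 <= C -> 0 <= q -> 0 < alpha < 1 ->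
  (forall i x, is_derive x (ebasis i) f (df i x)) ->
  (forall x, `|f x| <= C * wt e x `^ (- q)) ->
  (forall i x, `|df i x| <= C * wt e x `^ (- (q + 2^-1))) ->
  forall z z', `|f z - f z'| <=
    C * (n%:R * 4 `^ (q + 2^-1) + (4 * n%:R) `^ (alpha / 2)) * `|z - z'| `^ alpha *
    (wt e z `^ (- (q + alpha / 2)) + wt e z' `^ (- (q + alpha / 2))).
Proof.
move=> e0 C0 q0 /andP[a0 a1] H B dB z z'.
set M := n%:R * _ + _; set p := q + alpha / 2.
have M0 : 0 <= M by rewrite addr_ge0 ?mulr_ge0 ?powR_ge0.
have W x := powR_ge0 (wt e x) (- p).
have near y y' : n%:R * `|y - y'| ^+ 2 <= wt e y / 4 ->
    `|f y - f y'| <= C * M * `|y - y'| `^ alpha * wt e y `^ (- p).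
  move=> Hd; have w0 := wt_gt0 y e0.
  rewrite distrC.
  apply: (@le_trans _ _ (C * 4 `^ (q + 2^-1) * wt e y `^ (- (q + 2^-1)) *
      \sum_(i < n) `|y' ord0 i - y ord0 i|)).
    apply: (mvt_box (fun x i _ => H i x)) => x i hx.
    apply: le_trans (dB i x) _; rewrite -mulrA ler_wpM2l //.
    have x0 := wt_gt0 x e0.
    have c4 : wt e y <= 4 * wt e x.
      apply: wt_comparable; apply: le_trans Hd.
      apply: (@le_trans _ _ (\sum_(i < n) `|y - y'| ^+ 2)); last first.
        by rewrite sumr_const card_ord mulr_natl.
      apply: ler_sum => j _; rewrite -real_normK ?num_real // lerXn2r ?nnegrE //.
      rewrite !mxE; apply: le_trans (hull_sub j hx) _.
      exact: coord_le_dist.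
    have -> : 4 `^ (q + 2^-1) * wt e y `^ (- (q + 2^-1)) = (wt e y / 4) `^ (- (q + 2^-1)).
      have i4 : 0 <= 4^-1 :> R by rewrite invr_ge0.
      rewrite powRM ?(ltW w0) // mulrC -[4^-1](@powR_inv1 _ 4) // -powRrM.
      by congr (_ * _ `^ _); rewrite mulN1r opprK.
    rewrite !powRN lef_pV2 ?posrE ?powR_gt0 ?divr_gt0 //.
    apply: ge0_ler_powR; rewrite ?nnegrE ?divr_ge0 ?(ltW w0) ?(ltW x0) ?addr_ge0 //.
    by rewrite ler_pdivrMr // mulrC.
  have S := sum_coord_le_dist y y'.
  apply: le_trans (ler_wpM2l _ S) _; first by rewrite !mulr_ge0 ?powR_ge0.
  have [->|dn0] := eqVneq (y - y') 0.
    by rewrite normr0 !mulr0 !mulr_ge0 ?powR_ge0.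
  have d0 : 0 < `|y - y'| by rewrite normr_gt0.
  have n1 : 1 <= n%:R :> R.
    case: (n) y y' dn0 {H B dB Hd S d0 M M0 W w0 z z' f df} => [|k] y y' dn0; last by rewrite ler1n.
    by case/eqP: dn0; apply/rowP => -[].
  set d := `|y - y'| in d0 Hd *.
  have dw : d <= wt e y `^ 2^-1.
    have : d ^+ 2 <= wt e y by have := sqr_ge0 d; nra.
    rewrite (powR12_sqrt (ltW w0)) => Hd2.
    by rewrite -(ger0_norm (ltW d0)) -sqrtr_sqr ler_wsqrtr.
  have -> : wt e y `^ (- (q + 2^-1)) = wt e y `^ (- p) * wt e y `^ ((alpha - 1) / 2).
    by rewrite -powRD ?(gt_eqF w0) ?implybT //; congr (_ `^ _); rewrite /p; field.
  have E : wt e y `^ ((alpha - 1) / 2) * d <= d `^ alpha.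
    have -> : d `^ alpha = d `^ (alpha - 1) * d.
      by rewrite -{3}(powRr1 (ltW d0)) -powRD ?subrK // (gt_eqF d0) implybT.
    rewrite ler_pM2r //.
    have -> : (alpha - 1) / 2 = 2^-1 * (- (1 - alpha)) by field.
    have -> : alpha - 1 = - (1 - alpha) by ring.
    rewrite powRrM !powRN lef_pV2 ?posrE ?powR_gt0 //.
    by apply: ge0_ler_powR; rewrite ?nnegrE ?(ltW d0) ?powR_ge0 ?subr_ge0 ?(ltW a1).
  have -> : C * 4 `^ (q + 2^-1) * (wt e y `^ (- p) * wt e y `^ ((alpha - 1) / 2)) * (n%:R * d)
    = C * wt e y `^ (- p) * (n%:R * 4 `^ (q + 2^-1)) * (wt e y `^ ((alpha - 1) / 2) * d) by ring.
  have -> : C * M * d `^ alpha * wt e y `^ (- p) = C * wt e y `^ (- p) * M * d `^ alpha by ring.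
  apply: ler_pM => //; rewrite ?mulr_ge0 ?powR_ge0 ?(ltW d0) //.
  by rewrite ler_wpM2l ?mulr_ge0 ?powR_ge0 // lerDl powR_ge0.
have [h1|h1] := leP (n%:R * `|z - z'| ^+ 2) (wt e z / 4).
  apply: le_trans (near _ _ h1) _; rewrite ler_wpM2l ?mulr_ge0 ?powR_ge0 //.
  by rewrite lerDl.
have [h2|h2] := leP (n%:R * `|z - z'| ^+ 2) (wt e z' / 4).
  rewrite distrC [`|z - z'|]distrC; rewrite [`|z - z'|]distrC in h2.
  apply: le_trans (near _ _ h2) _; rewrite ler_wpM2l ?mulr_ge0 ?powR_ge0 //.
  by rewrite lerDr.
have far y : wt e y / 4 < n%:R * `|z - z'| ^+ 2 ->
    `|f y| <= C * M * `|z - z'| `^ alpha * wt e y `^ (- p).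
  move=> Hd; have w0 := wt_gt0 y e0; apply: le_trans (B y) _.
  rewrite -!mulrA ler_wpM2l //.
  have -> : wt e y `^ (- q) = wt e y `^ (- p) * wt e y `^ (alpha / 2).
    by rewrite -powRD ?(gt_eqF w0) ?implybT //; congr (_ `^ _); rewrite /p; ring.
  rewrite mulrA [leRHS]mulrC ler_wpM2l ?powR_ge0 //.
  apply: (@le_trans _ _ ((4 * n%:R * `|z - z'| ^+ 2) `^ (alpha / 2))).
    apply: ge0_ler_powR; rewrite ?nnegrE ?divr_ge0 ?(ltW w0) ?(ltW a0) ?mulr_ge0 ?sqr_ge0 //.
    by rewrite ltW // -mulrA mulrC -ltr_pdivrMr.
  rewrite powRM ?sqr_ge0 ?mulr_ge0 //.
  have -> : (`|z - z'| ^+ 2) `^ (alpha / 2) = `|z - z'| `^ alpha.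
    by rewrite -powR_mulrn // -powRrM; congr (_ `^ _); field.
  by rewrite ler_wpM2r ?powR_ge0 // lerDr mulr_ge0 ?powR_ge0.
apply: le_trans (ler_normB _ _) _; rewrite mulrDr; apply: lerD; exact: far.
Qed.

End KernelBounds.

(** What the construction needs from a mollified fundamental solution of the
[m]-th power of the Laplacian, with constants independent of the scale [e]. *)
Record good_kernel {R : realType} {n : nat} (m : nat) (alpha : R)
    (V : R -> 'rV[R]_n -> R) (C cphi : R) : Prop := GoodKernel {
  gk_smooth : forall e, 0 < e -> smooth (V e);
  gk_commute : forall e, 0 < e -> partials_commute (V e);
  gk_size : forall e s x j, 0 < e -> (size s).+1 = (2 * m + j)%N -> (j <= 2)%N ->
    `|Dw s (V e) x| <= C * wt e x `^ (- ((n%:R + j%:R - 1) / 2));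
  gk_holder : forall e s z z', 0 < e -> (size s).+1 = (2 * m)%N ->
    `|Dw s (V e) z - Dw s (V e) z'| <= C * `|z - z'| `^ alpha *
    (wt e z `^ (- ((n%:R - (1 - alpha)) / 2)) + wt e z' `^ (- ((n%:R - (1 - alpha)) / 2)));
  gk_lap : forall e x, 0 < e -> iter m (@laplacian R n) (V e) x =
    cphi * e ^+ (2 * m) * wt e x `^ (- (n%:R / 2 + m%:R));
  gk_lap_second : forall e x i, 0 < e ->
    `|Dw [:: i; i] (iter m (@laplacian R n) (V e)) x| <= C * wt e x `^ (- ((n%:R + 2) / 2))
}.

(** The kernel is [H (e^2 + |x|^2)] with [H] the [m]-th primitive of [t^(- n/2)]. *)
Lemma good_kernel_exists {R : realType} n m (alpha : R) : (0 < n)%N -> (0 < m)%N ->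
  0 < alpha < 1 ->
  exists V C cphi, [/\ 0 < C, 0 < cphi & good_kernel (n := n) m alpha V C cphi].
Proof.
move=> n0 m0 al01; pose b : R := n%:R / 2.
have b0 : 0 < b by rewrite divr_gt0 ?ltr0n.
have nb : n%:R = 2 * b by rewrite /b; field.
have [H [dH Htop]] := profile_exists b m.
have EB s k (t : @term R n) : order_of t k -> (m <= uphalf (size s + k))%N -> exists2 C : R, 0 <= C &
    forall e x, 0 < e -> `|Dw s (eval H e t) x| <= C * wt e x `^ (- ((n%:R + (size s + k)%:R - (2 * m)%:R) / 2)).
  move=> ot mk; have [C C0 HC] := eval_bound Htop (order_dTs s ot) mk.
  exists C => // e x e0; rewrite (Dw_eval dH e0).
  apply: le_trans (HC e x e0) _; apply: eqr_le.
  by congr (_ * _ `^ _); rewrite /b natrM; field.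
pose V e := eval H e (TG 0 : @term R n).
have V0 : order_of (TG 0 : @term R n) 0 by [].
have size_j j : exists2 C, 0 < C & forall s, (size s).+1 = (2 * m + j)%N -> forall e x, 0 < e ->
    `|Dw s (V e) x| <= C * wt e x `^ (- ((n%:R + j%:R - 1) / 2)).
  have [||C C0 HC] := @uniform_constant_words R n (2 * m + j).-1 (fun s C => forall e x, 0 < e ->
    `|Dw s (V e) x| <= C * wt e x `^ (- ((n%:R + j%:R - 1) / 2))).
  - by move=> s C C' CC' + e x e0 => /(_ e x e0) /le_trans; apply; rewrite ler_wpM2r ?powR_ge0.
  - move=> s ss; have mk : (m <= uphalf (size s + 0))%N by lia.
    have [C C0 HC] := EB s 0%N _ V0 mk; exists C => // e x e0.
    apply: le_trans (HC e x e0) _; apply: eqr_le.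
    congr (_ * _ `^ _); congr (- (_ / _)).
    have -> : j%:R = (size s + 0)%:R + 1 - (2 * m)%:R :> R.
      rewrite ss addn0 natr1 prednK; last by lia.
      by rewrite natrD; ring.
    ring.
  by exists C => // s ss; apply: HC; rewrite -ss.
have [C0 C00 H0] := size_j 0%N; have [C1 C10 H1] := size_j 1%N; have [C2 C20 H2] := size_j 2%N.
have lapE e : 0 < e -> iter m (@laplacian R n) (V e) = eval H e (iter m (@TL R n) (TG 0)).
  by move=> e0; rewrite eval_iter_TL.
have [C3 C30 H3] : exists2 C, 0 < C & forall i e x, 0 < e ->
    `|Dw [:: i; i] (iter m (@laplacian R n) (V e)) x| <= C * wt e x `^ (- ((n%:R + 2) / 2)).
  apply: (uniform_constant (P := fun i C => forall e x, 0 < e ->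
    `|Dw [:: i; i] (iter m (@laplacian R n) (V e)) x| <= C * wt e x `^ (- ((n%:R + 2) / 2)))).
    by move=> i C C' CC' + e x e0 => /(_ e x e0) /le_trans; apply; rewrite ler_wpM2r ?powR_ge0.
  move=> i; have ot := order_iter_TL m V0.
  have mk : (m <= uphalf (size [:: i; i] + (2 * m + 0)))%N by rewrite /=; lia.
  have [C CC0 HC] := EB _ _ _ ot mk; exists C => // e x e0; rewrite lapE //.
  apply: le_trans (HC e x e0) _; apply: eqr_le.
  have -> : (size [:: i; i] + (2 * m + 0))%:R = 2 + (2 * m)%:R :> R by rewrite addn0 natrD.
  by congr (_ * _ `^ _); ring.
pose q : R := (n%:R - 1) / 2.
have q0 : 0 <= q by rewrite divr_ge0 // subr_ge0 ler1n.
pose M : R := n%:R * 4 `^ (q + 2^-1) + (4 * n%:R) `^ (alpha / 2).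
have M0 : 0 <= M by rewrite addr_ge0 ?mulr_ge0 ?powR_ge0.
pose CC := C0 + C1 + C2 + C3 + (C0 + C1) * M.
exists V, CC, (4 ^+ m * rising b m); split.
- by rewrite /CC; have := mulr_ge0 (addr_ge0 (ltW C00) (ltW C10)) M0; lra.
- rewrite mulr_gt0 ?exprn_gt0 // /rising big_mkord prodr_gt0 // => i _.
  by rewrite ltr_pwDl.
have CM := mulr_ge0 (addr_ge0 (ltW C00) (ltW C10)) M0.
split.
- by move=> e e0; apply: smooth_eval.
- by move=> e e0; apply: commute_eval.
- move=> e s x j e0 ss; case: j ss => [|[|[|//]]] ss _.
  + apply: le_trans (H0 _ ss _ _ e0) _; rewrite ler_wpM2r ?powR_ge0 // /CC; lra.
  + apply: le_trans (H1 _ ss _ _ e0) _; rewrite ler_wpM2r ?powR_ge0 // /CC; lra.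
  + apply: le_trans (H2 _ ss _ _ e0) _; rewrite ler_wpM2r ?powR_ge0 // /CC; lra.
- move=> e s z z' e0 ss.
  have B0 x : `|Dw s (V e) x| <= (C0 + C1) * wt e x `^ (- q).
    have -> : - q = - ((n%:R + 0%:R - 1) / 2) by rewrite addr0.
    apply: le_trans (H0 s _ e x e0) _; first by rewrite addn0.
    by rewrite ler_wpM2r ?powR_ge0 // lerDl ltW.
  have B1 i x : `|Dw (i :: s) (V e) x| <= (C0 + C1) * wt e x `^ (- (q + 2^-1)).
    have -> : - (q + 2^-1) = - ((n%:R + 1%:R - 1) / 2) by rewrite /q; field.
    apply: le_trans (H1 (i :: s) _ e x e0) _; first by rewrite /= ss addn1.
    by rewrite ler_wpM2r ?powR_ge0 // lerDr ltW.
  have sV : smooth (V e) by exact: smooth_eval.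
  have D i x : is_derive x (ebasis i) (Dw s (V e)) (Dw (i :: s) (V e) x) by exact: smoothP.
  apply: le_trans (weight_holder e0 (addr_ge0 (ltW C00) (ltW C10)) q0 al01 D B0 B1 z z') _.
  have -> : q + alpha / 2 = (n%:R - (1 - alpha)) / 2 by rewrite /q; field.
  rewrite ler_wpM2r ?addr_ge0 ?powR_ge0 // ler_wpM2r ?powR_ge0 // /CC -/M; lra.
- move=> e x e0; rewrite (iter_laplacian_kernel dH nb Htop) // /bubble.
  by congr (_ * _ `^ _); rewrite /b; ring.
- move=> e x i e0; apply: le_trans (H3 i e x e0) _.
  by rewrite ler_wpM2r ?powR_ge0 // /CC; lra.
Qed.

(** * Discrete convolutions *)

Section Convolution.
Context {R : realType} {n : nat}.
Implicit Types (k F : 'rV[R]_n -> R) (x y : 'rV[R]_n) (s : seq 'I_n).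

Definition conv (G : nat) k F x : R :=
  G%:R^-1 ^+ n * \sum_(nu : node G) F (pt nu) * k (x - pt nu).

Section Fixed.
Variable G : nat.

Let smooth_piece k F (nu : @node n G) : smooth k -> smooth (fun x => F (pt nu) * k (x - pt nu)).
Proof. by move=> sk; apply/smoothZ/smooth_shift. Qed.

Lemma smooth_conv k F : smooth k -> smooth (conv G k F).
Proof.
by move=> sk; apply/smoothZ/smooth_sum => nu; apply: smooth_piece.
Qed.

Lemma Dw_conv k F s : smooth k -> Dw s (conv G k F) = conv G (Dw s k) F.
Proof.
move=> sk; have sp (nu : @node n G) : smooth (fun x => F (pt nu) * k (x - pt nu)).
  exact: smooth_piece.
rewrite /conv DwZ; last by apply: smooth_sum => nu; apply: smooth_piece.
apply/funext => x; rewrite (Dw_sum _ sp); congr (_ * _).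
apply: eq_bigr => nu _; rewrite DwZ; last exact: smooth_shift.
by rewrite Dw_shift.
Qed.

Lemma commute_conv k F : smooth k -> partials_commute k -> partials_commute (conv G k F).
Proof.
move=> sk ck i j s.
rewrite -[LHS]/(Dw [:: i, j & s] (conv G k F)) -[RHS]/(Dw [:: j, i & s] (conv G k F)).
rewrite (Dw_conv F [:: i, j & s] sk) (Dw_conv F [:: j, i & s] sk).
exact: (congr1 (fun k => conv G k F) (ck i j s)).
Qed.

Lemma convB k F F' x : conv G k F x - conv G k F' x = conv G k (fun y => F y - F' y) x.
Proof.
rewrite /conv -mulrBr -sumrB; congr (_ * _); apply: eq_bigr => nu _; ring.
Qed.

Lemma convBx k F x x' : conv G k F x - conv G k F x' =
  G%:R^-1 ^+ n * \sum_(nu : node G) F (pt nu) * (k (x - pt nu) - k (x' - pt nu)).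
Proof.
rewrite /conv -mulrBr -sumrB; congr (_ * _); apply: eq_bigr => nu _; ring.
Qed.

Lemma convZ k F c x : conv G k (fun y => c * F y) x = c * conv G k F x.
Proof.
rewrite /conv mulrCA; congr (_ * _); rewrite mulr_sumr.
by apply: eq_bigr => nu _; rewrite mulrA.
Qed.

Lemma lattice_bound (B A C e : R) (t : node G -> R) (x : 'rV[R]_n) :
  0 <= A ->
  G%:R^-1 ^+ n * \sum_(nu : node G) wt e (x - pt nu) `^ B <= C ->
  (forall nu, `|t nu| <= A * wt e (x - pt nu) `^ B) ->
  `|G%:R^-1 ^+ n * \sum_nu t nu| <= A * C.
Proof.
move=> A0 HC Ht; rewrite normrM ger0_norm ?exprn_ge0 ?invr_ge0 //.
apply: le_trans (ler_wpM2l A0 HC); rewrite mulrCA ler_wpM2l ?exprn_ge0 ?invr_ge0 //.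
by rewrite mulr_sumr; apply: le_trans (ler_norm_sum _ _ _) _; apply: ler_sum.
Qed.

Definition shift_node (i : 'I_n) (nu : @node n G) : @node n G :=
  [ffun j => if j == i then ordS (nu j) else nu j].

Lemma shift_node_inj i : injective (shift_node i).
Proof.
move=> nu mu /ffunP E; apply/ffunP => j; have := E j; rewrite !ffunE.
by case: ifP => // _; apply: ordS_inj.
Qed.

(** Translation by one lattice step, read on the cyclic lattice: what wraps around
meets only the zeros of [F] near the boundary. *)
Lemma conv_step k F x i : (0 < G)%N ->
  (forall y, 1 - G%:R^-1 <= `|y| -> F y = 0) ->
  conv G k F (x + G%:R^-1 *: ebasis i) = conv G k (fun y => F (y + G%:R^-1 *: ebasis i)) x.
Proof.
move=> G0 F0; rewrite /conv; congr (_ * _).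
have Gn : G%:R != 0 :> R by rewrite pnatr_eq0 -lt0n.
have h0 : 0 < G%:R^-1 :> R by rewrite invr_gt0 ltr0n.
rewrite (reindex_inj (@shift_node_inj i)) /=; apply: eq_bigr => nu _.
have [lt|ge] := ltnP (nu i) (G.*2).
  have E : pt (shift_node i nu) = pt nu + G%:R^-1 *: ebasis i :> 'rV[R]_n.
    apply/rowP => j; rewrite !mxE ffunE; have [->|ji] := eqVneq j i; last first.
      by rewrite eqxx /= mulr0 addr0.
    by rewrite eqxx /= modn_small ?ltnS // -natr1 mulrDl mul1r mulr1; ring.
  by rewrite E opprD addrACA subrr addr0.
have nui : nu i = G.*2 :> nat by apply/eqP; rewrite eqn_leq ge -ltnS ltn_ord.
rewrite !F0 ?mul0r //.
  apply: le_trans (coord_le_norm _ i); rewrite !mxE !eqxx /= mulr1 nui -muln2 natrM.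
  rewrite mulrAC divff // mul1r; rewrite ger0_norm; lra.
apply: le_trans (coord_le_norm _ i); rewrite !mxE ffunE eqxx /= nui modnn mul0r.
by rewrite sub0r normrN normr1; lra.
Qed.

Lemma conv_step_diff k F x i : (0 < G)%N ->
  (forall y, 1 - G%:R^-1 <= `|y| -> F y = 0) ->
  conv G k F (x + G%:R^-1 *: ebasis i) - conv G k F x =
  conv G k (fun y => F (y + G%:R^-1 *: ebasis i) - F y) x.
Proof. by move=> G0 F0; rewrite conv_step // convB. Qed.

End Fixed.

Lemma difference_quotient (f g g2 : 'rV[R]_n -> R) x i (h B : R) : 0 < h ->
  (forall y, is_derive y (ebasis i) f (g y)) ->
  (forall y, is_derive y (ebasis i) g (g2 y)) ->
  (forall t, 0 <= t <= h -> `|g2 (x + t *: ebasis i)| <= B) ->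
  `|g x - h^-1 * (f (x + h *: ebasis i) - f x)| <= h * B.
Proof.
move=> h0 df dg HB.
have [t [t1 t2] E] := mvt_line (a := h) (x := x) (v := ebasis i) (fun t _ _ => df (x + t *: ebasis i)).
have t0 : 0 <= t by move: t2; rewrite pmulr_lge0.
have th : t <= h by move: t1; rewrite !ger0_norm // ltW.
rewrite E mulrA mulVf ?gt_eqF // mul1r.
have [r [r1 r2] E2] := mvt_line (a := t) (x := x) (v := ebasis i) (fun t _ _ => dg (x + t *: ebasis i)).
rewrite distrC E2 normrM (ger0_norm t0); apply: ler_pM => //; apply: HB.
have [t00|tn0] := eqVneq t 0.
  by move: r1; rewrite t00 normr0 normr_le0 => /eqP ->; rewrite lexx ltW.
have r0 : 0 <= r by move: r2; rewrite pmulr_lge0 // lt_def tn0.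
by rewrite r0 (le_trans _ th) //; move: r1; rewrite !ger0_norm.
Qed.

Section LaplacianConv.

Lemma smooth_laplacian k : smooth k -> smooth (laplacian k).
Proof.
by move=> sk; apply: smooth_sum => i; apply: (smooth_Dw [:: i; i]).
Qed.

Lemma smooth_iter_laplacian j k : smooth k -> smooth (iter j (@laplacian R n) k).
Proof.
by move=> sk; elim: j => [|j IH]; [exact: sk|rewrite iterS; exact: smooth_laplacian].
Qed.

Lemma laplacian_conv G k F : smooth k -> laplacian (conv G k F) = conv G (laplacian k) F.
Proof.
move=> sk; apply/funext => x; rewrite [LHS]/laplacian.
under eq_bigr => i _ do rewrite -[partial i _]/(Dw [:: i; i] (conv G k F)) (Dw_conv G F _ sk) /conv.
rewrite -mulr_sumr exchange_big; congr (_ * _); apply: eq_bigr => nu _.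
by rewrite -mulr_sumr.
Qed.

Lemma iter_laplacian_conv G k F j : smooth k ->
  iter j (@laplacian R n) (conv G k F) = conv G (iter j (@laplacian R n) k) F.
Proof.
move=> sk; elim: j => [|j IH]; first by [].
by rewrite !iterS IH (laplacian_conv G F (smooth_iter_laplacian j sk)).
Qed.

End LaplacianConv.

End Convolution.

Section Cutoff.
Context {R : realType} {n : nat}.
Implicit Types (x y : 'rV[R]_n) (rho : R).

Definition cutoff rho y : R := Num.max 0 (Num.min 1 (2 - `|y| / rho)).

Lemma cutoff01 rho y : 0 <= cutoff rho y <= 1.
Proof. by rewrite /cutoff le_max lexx /= ge_max ler01 ge_min lexx. Qed.

Lemma cutoff1 rho y : 0 < rho -> `|y| <= rho -> cutoff rho y = 1.
Proof.
move=> r0 yr; rewrite /cutoff (min_idPl _) ?(max_idPr _) //.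
have : `|y| / rho <= 1 by rewrite ler_pdivrMr // mul1r.
lra.
Qed.

Lemma cutoff0 rho y : 0 < rho -> 2 * rho <= `|y| -> cutoff rho y = 0.
Proof.
move=> r0 yr; rewrite /cutoff; apply/max_idPl; rewrite ge_min; apply/orP; right.
have : 2 <= `|y| / rho by rewrite ler_pdivlMr.
lra.
Qed.

Lemma cutoff_lip rho x y : 0 < rho -> `|cutoff rho x - cutoff rho y| <= `|x - y| / rho.
Proof.
move=> r0.
have lip p q : `|Num.max 0 (Num.min 1 p) - Num.max 0 (Num.min 1 q)| <= `|p - q| :> R.
  rewrite ler_norml; have := ler_norm (p - q); have := ler_norm (q - p); rewrite (distrC q p).
  case: (leP 1 p) => h1; case: (leP 1 q) => h2; rewrite ?(max_idPr ler01).
  - lra.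
  - by case: (leP 0 q); lra.
  - by case: (leP 0 p); lra.
  - by case: (leP 0 p); case: (leP 0 q); lra.
apply: le_trans (lip _ _) _.
have -> : 2 - `|x| / rho - (2 - `|y| / rho) = (`|y| - `|x|) / rho by ring.
rewrite normrM (@gtr0_norm _ rho^-1) ?invr_gt0 // ler_wpM2r ?invr_ge0 ?(ltW r0) //.
by rewrite distrC; apply: ler_dist_dist.
Qed.

End Cutoff.

(** * Discrete Schauder estimates *)

(** Quantified hypotheses do not help the solver but slow it down. *)
Ltac quick_lra := repeat match goal with H : forall _, _ |- _ => clear H end; lra.

Section WeightExponents.
Context {R : realType} {n : nat}.
Implicit Types (x : 'rV[R]_n) (e a d B : R).

(** Since the weight is at least [e^2], a lower exponent costs powers of the scale. *)
Lemma wt_loss e x a d : 0 < e -> 0 <= d ->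
  wt e x `^ (- (a + d)) <= e `^ (- (2 * d)) * wt e x `^ (- a).
Proof.
move=> e0 d0; have w0 := wt_gt0 x e0.
rewrite opprD powRD ?(gt_eqF w0) ?implybT // mulrC ler_wpM2r ?powR_ge0 //.
have -> : e `^ (- (2 * d)) = (e ^+ 2) `^ (- d).
  by rewrite -powR_mulrn ?(ltW e0) // -powRrM mulrN.
rewrite !powRN lef_pV2 ?posrE ?powR_gt0 ?exprn_gt0 //.
by apply: ge0_ler_powR; rewrite ?nnegrE ?sqr_ge0 ?(ltW w0) // eps_le_wt.
Qed.

Lemma wt_gain e x a d B : 0 < e -> 0 <= d -> wt e x <= B ->
  wt e x `^ (- a) <= B `^ d * wt e x `^ (- (a + d)).
Proof.
move=> e0 d0 wB; have w0 := wt_gt0 x e0.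
have -> : wt e x `^ (- a) = wt e x `^ d * wt e x `^ (- (a + d)).
  by rewrite -powRD ?(gt_eqF w0) ?implybT //; congr (_ `^ _); ring.
rewrite ler_wpM2r ?powR_ge0 //.
by apply: ge0_ler_powR; rewrite ?nnegrE ?(ltW w0) ?(le_trans (ltW w0) wB).
Qed.

End WeightExponents.

Section Scales.
Context {R : realType}.
Implicit Types (p : nat).

Definition eps p : R := p%:R^-1.
(** The mesh [eps^3] beats all the negative powers of [eps] in the error terms. *)
Definition grid p : nat := (p ^ 3)%N.

Lemma eps_gt0 p : (4 <= p)%N -> 0 < eps p.
Proof. by move=> p4; rewrite invr_gt0 ltr0n; lia. Qed.

Lemma eps_le p : (4 <= p)%N -> eps p <= 4^-1.
Proof. by move=> p4; rewrite lef_pV2 ?posrE ?ltr0n ?ler_nat //; lia. Qed.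

Lemma grid_gt0 p : (4 <= p)%N -> (0 < grid p)%N.
Proof. by move=> p4; rewrite expn_gt0; lia. Qed.

Lemma grid_inv p : (grid p)%:R^-1 = eps p ^+ 3 :> R.
Proof. by rewrite /grid natrX exprVn. Qed.

Lemma step_gt0 p : (4 <= p)%N -> 0 < (grid p)%:R^-1 :> R.
Proof. by move=> p4; rewrite invr_gt0 ltr0n grid_gt0. Qed.

Lemma step_le_eps p : (4 <= p)%N -> (grid p)%:R^-1 <= eps p.
Proof.
move=> p4; rewrite grid_inv; have e0 := eps_gt0 p4; have e1 := eps_le p4.
by rewrite exprS -[leRHS]mulr1 ler_pM2l // expr_le1 ?(ltW e0) //; lra.
Qed.

Lemma step_le p : (4 <= p)%N -> (grid p)%:R^-1 <= 64^-1 :> R.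
Proof.
move=> p4; rewrite grid_inv; have e0 := eps_gt0 p4; have e1 := eps_le p4.
have -> : 64^-1 = (4^-1) ^+ 3 :> R by rewrite exprVn; congr (_^-1); ring.
by rewrite lerXn2r ?nnegrE ?(ltW e0) // invr_ge0.
Qed.

Lemma step_powR p d : (4 <= p)%N ->
  (grid p)%:R^-1 * eps p `^ (- d) = eps p `^ (3 - d).
Proof.
move=> p4; have e0 := eps_gt0 p4.
by rewrite grid_inv -powR_mulrn ?(ltW e0) // -powRD ?(gt_eqF e0) ?implybT.
Qed.

Lemma eps01 p : (4 <= p)%N -> 0 < eps p <= 1.
Proof. by move=> p4; rewrite eps_gt0 //=; have := eps_le p4; lra. Qed.

End Scales.

Section Potential.
Context {R : realType} {n m : nat} {alpha : R}.
Variables (V : R -> 'rV[R]_n -> R) (C cphi : R).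
Hypotheses (n0 : (0 < n)%N) (m0 : (0 < m)%N) (al01 : 0 < alpha < 1).
Hypotheses (C0 : 0 < C) (cphi0 : 0 < cphi) (gk : good_kernel m alpha V C cphi).
Implicit Types (x y z : 'rV[R]_n) (F : 'rV[R]_n -> R) (p : nat) (A L B rho : R).

Local Notation eps := (@eps R).

Definition phi e : 'rV[R]_n -> R := iter m (@laplacian R n) (V e).

Lemma phi_ge0 e x : 0 < e -> 0 <= phi e x.
Proof.
move=> e0; rewrite /phi (gk_lap gk) // !mulr_ge0 ?powR_ge0 ?exprn_ge0 ?(ltW e0) //.
exact: ltW.
Qed.

Lemma smooth_phi e : 0 < e -> smooth (phi e).
Proof. by move=> e0; apply/smooth_iter_laplacian/(gk_smooth gk). Qed.

(** With this exponent the weight is summable and still half a power of the distance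
is to spare. *)
Definition half_exp : R := (n%:R - 2^-1) / 2.

(** The bubble is concentrated at the scale [e], so a factor [|x|] gains a power of [e];
half a power is kept, and the rest pays for a weight that is summable uniformly. *)
Lemma phi_weight e x : 0 < e ->
  phi e x * `|x| <= cphi * e `^ 2^-1 * wt e x `^ (- half_exp).
Proof.
move=> e0; have w0 := wt_gt0 x e0.
rewrite /phi (gk_lap gk) //.
have M1 : 1 <= m%:R :> R by rewrite ler1n.
apply: (@le_trans _ _ (cphi * e ^+ (2 * m) * wt e x `^ (- (n%:R / 2 + m%:R)) * wt e x `^ 2^-1)).
  rewrite ler_wpM2l ?norm_le_wt_powR // !mulr_ge0 ?powR_ge0 ?exprn_ge0 ?(ltW e0) //.
  exact: ltW.
rewrite -[leLHS]mulrA -powRD ?(gt_eqF w0) ?implybT //.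
have -> : - (n%:R / 2 + m%:R) + 2^-1 = - (half_exp + (m%:R - 4^-1)) by rewrite /half_exp; field.
apply: le_trans (ler_wpM2l _ (wt_loss _ _ e0 _)) _; try lra.
  by rewrite mulr_ge0 ?exprn_ge0 ?(ltW e0) ?(ltW cphi0).
rewrite -powR_mulrn ?(ltW e0) // mulrA; rewrite -[X in X * _]mulrA -powRD ?(gt_eqF e0) ?implybT //.
apply: eqr_le; congr (_ * _ `^ _ * _).
by rewrite natrM; field.
Qed.

Lemma half_sum : exists2 Ch : R, 0 < Ch & forall p x, (4 <= p)%N -> `|x| <= 2 ->
  (grid p)%:R^-1 ^+ n * \sum_(nu : node (grid p)) wt (eps p) (x - pt nu) `^ (- half_exp) <= Ch.
Proof.
have h : 0 < (2^-1 : R) < 1 by rewrite invr_gt0 invf_lt1 ?ltr0n //=; lra.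
have [Ch Ch0 H] := lattice_sum_bound h n0; exists Ch => // p x p4 x2.
by apply: H => //; [apply: grid_gt0|apply: eps01|apply: step_le_eps].
Qed.

Lemma holder_sum : exists2 Ca : R, 0 < Ca & forall p x, (4 <= p)%N -> `|x| <= 2 ->
  (grid p)%:R^-1 ^+ n * \sum_(nu : node (grid p))
     wt (eps p) (x - pt nu) `^ (- ((n%:R - (1 - alpha)) / 2)) <= Ca.
Proof.
have h : 0 < 1 - alpha < 1 by case/andP: al01 => a0 a1; apply/andP; split; lra.
have [Ca Ca0 H] := lattice_sum_bound h n0; exists Ca => // p x p4 x2.
by apply: H => //; [apply: grid_gt0|apply: eps01|apply: step_le_eps].
Qed.

(** Against the bubble, a density that vanishes linearly at [x] is negligible. *)
Lemma concentration : exists2 K : R, 0 < K & forall p x B (t : node (grid p) -> R),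
  (4 <= p)%N -> `|x| <= 2 -> 0 <= B ->
  (forall nu, `|t nu| <= B * (phi (eps p) (x - pt nu) * `|x - pt nu|)) ->
  `|(grid p)%:R^-1 ^+ n * \sum_nu t nu| <= K * B * eps p `^ 2^-1.
Proof.
have [Ch Ch0 HC] := half_sum; exists (cphi * Ch); first exact: mulr_gt0.
move=> p x B t p4 x2 B0 Ht; have e0 : 0 < eps p :> R := eps_gt0 p4.
have A0 : 0 <= B * (cphi * eps p `^ 2^-1) by rewrite !mulr_ge0 ?powR_ge0 ?(ltW cphi0).
have -> : cphi * Ch * B * eps p `^ 2^-1 = B * (cphi * eps p `^ 2^-1) * Ch by ring.
apply: (lattice_bound A0 (HC p x p4 x2)) => nu; apply: le_trans (Ht nu) _.
by rewrite -mulrA ler_wpM2l //; apply: phi_weight.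
Qed.

(** The total mass of the bubble.  The cutoff makes it insensitive to the boundary of
the lattice cube under translations by one step. *)
Definition mass p : R := conv (grid p) (phi (eps p)) (cutoff 4^-1) 0.

(** Only the [p^(2n)] nodes of a cube of side [eps p] are kept. *)
Lemma mass_lower : exists2 s0 : R, 0 < s0 & forall p, (4 <= p)%N -> s0 <= mass p.
Proof.
pose B : R := n%:R / 2 + m%:R.
exists (cphi * (1 + n%:R) `^ (- B)).
  by rewrite mulr_gt0 ?powR_gt0 // ltr_wpDr.
move=> p p4; have e0 : 0 < eps p :> R := eps_gt0 p4; have e1 : eps p <= 4^-1 :> R := eps_le p4.
have G0 := grid_gt0 p4.
have Gn : (grid p)%:R != 0 :> R by rewrite pnatr_eq0 -lt0n.
pose f (nu : @node n (grid p)) := cutoff 4^-1 (pt nu : 'rV[R]_n) * phi (eps p) (0 - pt nu).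
have f0 nu : 0 <= f nu by rewrite mulr_ge0 ?phi_ge0 //; case/andP: (cutoff01 4^-1 (pt nu : 'rV[R]_n)).
have lt_iota (j : 'I_(p ^ 2)) : (grid p + j < (grid p).*2.+1)%N.
  rewrite ltnS -addnn leq_add2l; apply: leq_trans (ltnW (ltn_ord j)) _.
  by rewrite leq_exp2l //; lia.
pose iota (mu : {ffun 'I_n -> 'I_(p ^ 2)}) : @node n (grid p) := [ffun i => Ordinal (lt_iota (mu i))].
have iota_inj : injective iota.
  move=> mu mu' /ffunP E; apply/ffunP => i; have := E i; rewrite !ffunE => /(congr1 val) /= /addnI.
  exact: val_inj.
have fiota mu : cphi * (1 + n%:R) `^ (- B) * eps p `^ (- n%:R) <= f (iota mu).
  have pi i : `|(pt (iota mu) : 'rV[R]_n) ord0 i| <= eps p.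
    rewrite !mxE ffunE /= natrD mulrDl divff // addrAC subrr add0r ger0_norm ?divr_ge0 //.
    rewrite ler_pdivrMr ?ltr0n // /grid /eps natrX exprS mulKf ?pnatr_eq0; last by lia.
    by rewrite -natrX ler_nat ltnW.
  have ptn : `|pt (iota mu) : 'rV[R]_n| <= eps p by apply: norm_le_coord; rewrite ?(ltW e0).
  rewrite /f cutoff1 ?invr_gt0 // ?mul1r; last exact: le_trans ptn e1.
  rewrite /phi (gk_lap gk) // -/B -mulrA -[leRHS]mulrA ler_pM2l //.
  have w0 := wt_gt0 (0 - pt (iota mu) : 'rV[R]_n) e0.
  have wle : wt (eps p) (0 - pt (iota mu) : 'rV[R]_n) <= (1 + n%:R) * eps p ^+ 2.
    rewrite /wt sub0r sqnN mulrDl mul1r lerD2l; apply: le_trans (sqn_le_norm _) _.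
    by rewrite ler_wpM2l // lerXn2r ?nnegrE ?(ltW e0).
  have B0 : 0 <= B by rewrite addr_ge0 ?divr_ge0.
  apply: (@le_trans _ _ (eps p ^+ (2 * m) * ((1 + n%:R) * eps p ^+ 2) `^ (- B))).
    rewrite powRM ?addr_ge0 ?sqr_ge0 // mulrCA ler_wpM2l ?powR_ge0 //.
    rewrite -!powR_mulrn ?(ltW e0) // -powRrM -powRD ?(gt_eqF e0) ?implybT //.
    apply: eqr_le; congr (_ `^ _).
    by rewrite natrM /B; field.
  rewrite ler_wpM2l ?exprn_ge0 ?(ltW e0) // !powRN lef_pV2 ?posrE ?powR_gt0 //; last first.
    by rewrite mulr_gt0 ?exprn_gt0 // ltr_wpDr.
  apply: ge0_ler_powR => //; rewrite nnegrE ?(ltW w0) //.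
  by rewrite mulr_ge0 ?sqr_ge0 ?addr_ge0.
rewrite /mass /conv.
apply: (@le_trans _ _ ((grid p)%:R^-1 ^+ n * \sum_(mu : {ffun 'I_n -> 'I_(p ^ 2)}) f (iota mu))).
  apply: (@le_trans _ _ ((grid p)%:R^-1 ^+ n * \sum_(mu : {ffun 'I_n -> 'I_(p ^ 2)})
     cphi * (1 + n%:R) `^ (- B) * eps p `^ (- n%:R))); last first.
    by rewrite ler_wpM2l ?exprn_ge0 ?invr_ge0 // ler_sum.
  rewrite sumr_const card_ffun !card_ord -(mulr_natr (cphi * _ * _)) grid_inv.
  rewrite (powRN (eps p)) (powR_mulrn n (ltW e0)) natrX.
  have -> : (p ^ 2)%:R = eps p ^- 2 :> R by rewrite natrX /eps exprVn invrK.
  have en : eps p ^+ n != 0 by rewrite expf_neq0 // gt_eqF.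
  have -> : eps p ^+ 3 ^+ n = eps p ^+ n ^+ 3 by rewrite -exprM mulnC exprM.
  have -> : eps p ^- 2 ^+ n = eps p ^+ n ^- 2 by rewrite exprVn -exprM mulnC exprM.
  apply: eqr_le.
  by field.
rewrite ler_wpM2l ?exprn_ge0 ?invr_ge0 //.
rewrite -(big_imset (h := iota) f) /=; last by move=> mu mu' _ _; apply: iota_inj.
rewrite big_mkcond /=; apply: ler_sum => nu _; case: ifP => // _; exact: f0.
Qed.

Lemma norm_step (h : R) i : 0 <= h -> `|h *: ebasis i : 'rV[R]_n| <= h.
Proof.
move=> h0; apply: norm_le_coord => // j; rewrite mxE ebasisE.
by case: (j == i); rewrite ?mulr1 ?mulr0 ?normr0 // ger0_norm.
Qed.

(** The mass seen from a point [x] does not depend on [x] in the limit: a step of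
the lattice changes only the terms where the cutoff varies, far from [x]. *)
Lemma mass_variation : exists2 K : R, 0 < K & forall p x, (4 <= p)%N -> `|x| <= 8^-1 ->
  `|conv (grid p) (phi (eps p)) (cutoff 4^-1) x - mass p| <= K * eps p `^ 2^-1.
Proof.
have [K1 K10 HK1] := concentration; have [Ch Ch0 HC] := half_sum.
exists ((K1 * 64 + C * Ch) * (n%:R * 8^-1)).
  by rewrite mulr_gt0 ?addr_gt0 ?mulr_gt0 ?invr_gt0 ?ltr0n.
move=> p x p4 x8; have e0 : 0 < eps p :> R := eps_gt0 p4; have e1 : eps p <= 4^-1 :> R := eps_le p4.
have h0 : 0 < (grid p)%:R^-1 :> R := step_gt0 p4; have h64 : (grid p)%:R^-1 <= 64^-1 :> R := step_le p4.
pose h : R := (grid p)%:R^-1; rewrite -/h in h0 h64.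
pose f := conv (grid p) (phi (eps p)) (cutoff (4^-1 : R)).
have sphi := smooth_phi e0.
have sf : smooth f by apply: smooth_conv.
have chi0 (y : 'rV[R]_n) : 1 - h <= `|y| -> cutoff 4^-1 y = 0.
  by move=> hy; apply: cutoff0; rewrite ?invr_gt0 //; lra.
have B1 i z : `|z| <= 8^-1 -> `|Dw [:: i] f z| <= (K1 * 64 + C * Ch) * eps p `^ 2^-1.
  move=> z8.
  have D1 y : is_derive y (ebasis i) f (Dw [:: i] f y) by exact: (smoothP [::] y i sf).
  have D2 y : is_derive y (ebasis i) (Dw [:: i] f) (Dw [:: i; i] f y) by exact: (smoothP [:: i] y i sf).
  have Q : forall t, 0 <= t <= h ->
      `|Dw [:: i; i] f (z + t *: ebasis i)| <= C * eps p `^ (- (2 * (5 / 4))) * Ch.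
    move=> t /andP[t0 th]; rewrite /f Dw_conv // /conv.
    have zt : `|z + t *: ebasis i| <= 2.
      by apply: le_trans (ler_normD _ _) _; have := norm_step i t0; lra.
    apply: (lattice_bound _ (HC p _ p4 zt)); first by rewrite mulr_ge0 ?powR_ge0 ?(ltW C0).
    move=> nu; rewrite normrM.
    have /andP[c0 c1] := cutoff01 4^-1 (pt nu : 'rV[R]_n).
    rewrite (ger0_norm c0) -[leRHS]mul1r; apply: ler_pM => //.
    apply: le_trans (gk_lap_second gk _ i e0) _; rewrite -mulrA ler_wpM2l ?(ltW C0) //.
    have -> : - ((n%:R + 2) / 2) = - (half_exp + 5 / 4) :> R by rewrite /half_exp; field.
    by apply: wt_loss => //; lra.
  have := difference_quotient h0 D1 D2 Q.
  have -> : h * (C * eps p `^ (- (2 * (5 / 4))) * Ch) = C * Ch * eps p `^ 2^-1.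
    have -> : eps p `^ 2^-1 = h * eps p `^ (- (2 * (5 / 4))).
      by rewrite /h step_powR //; congr (_ `^ _); field.
    ring.
  rewrite /f conv_step_diff ?grid_gt0 // -/f => HQ.
  have Hq : `|conv (grid p) (phi (eps p)) (fun y => cutoff 4^-1 (y + h *: ebasis i) - cutoff 4^-1 y) z|
     <= K1 * (64 * h) * eps p `^ 2^-1.
    apply: HK1 => //; first by lra.
      by rewrite mulr_ge0 // ltW.
    move=> nu; rewrite normrM mulrCA [leLHS]mulrC (ger0_norm (phi_ge0 _ e0)) ler_wpM2l ?phi_ge0 //.
    set y := pt nu.
    (* near the center the cutoff is constant; elsewhere [z] is far from [y] *)
    have [y1|y1] := leP `|y| (3 / 16).
      rewrite !cutoff1 ?subrr ?normr0 ?invr_gt0 //; last 2 first.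
      - by lra.
      - by apply: le_trans (ler_normD _ _) _; have := norm_step i (ltW h0); lra.
      by rewrite !mulr_ge0 // ltW.
    apply: le_trans (cutoff_lip _ _ _) _; first by rewrite invr_gt0.
    rewrite addrAC subrr add0r invrK.
    have zy : 16^-1 <= `|z - y|.
      have := ler_distD z y 0; rewrite !subr0 (distrC y z); lra.
    have := norm_step i (ltW h0); nra.
  have -> : Dw [:: i] f z = (Dw [:: i] f z - h^-1 * conv (grid p) (phi (eps p))
     (fun y => cutoff 4^-1 (y + h *: ebasis i) - cutoff 4^-1 y) z) + h^-1 * conv (grid p) (phi (eps p))
     (fun y => cutoff 4^-1 (y + h *: ebasis i) - cutoff 4^-1 y) z by ring.
  apply: le_trans (ler_normD _ _) _; rewrite mulrDl addrC; apply: lerD; last exact: HQ.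
  have hi : 0 < h^-1 by rewrite invr_gt0.
  rewrite normrM (gtr0_norm hi) (ler_pdivrMl _ _ h0).
  by apply: le_trans Hq _; apply: eqr_le; ring.
have M0 : 0 <= (K1 * 64 + C * Ch) * eps p `^ 2^-1.
  by rewrite mulr_ge0 ?powR_ge0 // addr_ge0 // mulr_ge0 // ltW.
apply: (@le_trans _ _ ((K1 * 64 + C * Ch) * eps p `^ 2^-1 * \sum_(i < n) `|x ord0 i - (0 : 'rV[R]_n) ord0 i|)).
  apply: (mvt_box (df := fun i => Dw [:: i] f)) => z i hz.
    exact: (smoothP [::] z i sf).
  by apply: B1; apply: (hull_norm hz); rewrite ?normr0 ?invr_ge0.
rewrite [leRHS]mulrAC ler_wpM2l //.
have := sum_coord_le_dist 0 x; rewrite sub0r normrN => /le_trans; apply.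
by rewrite ler_wpM2l.
Qed.

(** The kernel of order [2m - 1] is summable with half a power to spare, hence small on
small supports. *)
Lemma near_bound : exists2 K : R, 0 < K & forall p rho s x F A, (4 <= p)%N ->
  0 < rho <= 16^-1 -> eps p <= rho -> (size s).+1 = (2 * m)%N -> `|x| <= 2 * rho -> 0 <= A ->
  (forall y, 3 * rho <= `|y| -> F y = 0) -> (forall y, `|F y| <= A) ->
  `|conv (grid p) (Dw s (V (eps p))) F x| <= K * rho `^ 2^-1 * A.
Proof.
have [Ch Ch0 HC] := half_sum.
exists (C * (1 + 25 * n%:R) `^ 4^-1 * Ch).
  by rewrite !mulr_gt0 ?powR_gt0 // ltr_wpDr // mulr_ge0.
move=> p rho s x F A p4 /andP[r0 r1] er ss xr A0 FS FA; have e0 : 0 < eps p :> R := eps_gt0 p4.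
have x2 : `|x| <= 2 by lra.
pose D := A * (C * ((1 + 25 * n%:R) `^ 4^-1 * rho `^ 2^-1)).
have D0 : 0 <= D by rewrite !mulr_ge0 ?powR_ge0 ?(ltW C0).
have -> : C * (1 + 25 * n%:R) `^ 4^-1 * Ch * rho `^ 2^-1 * A = D * Ch by rewrite /D; ring.
apply: (lattice_bound D0 (HC p x p4 x2)) => nu.
rewrite normrM /D -mulrA; set y := pt nu.
have [y3|y3] := leP (3 * rho) `|y|.
  by rewrite FS // normr0 mul0r !mulr_ge0 ?powR_ge0 ?(ltW C0).
apply: ler_pM => //.
have ss0 : (size s).+1 = (2 * m + 0)%N by rewrite addn0.
apply: le_trans (gk_size gk _ e0 ss0 isT) _; rewrite -[leRHS]mulrA ler_wpM2l ?(ltW C0) //.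
have wB : wt (eps p) (x - y) <= (1 + 25 * n%:R) * rho ^+ 2.
  rewrite /wt mulrDl mul1r lerD // ?lerXn2r ?nnegrE ?(ltW e0) ?(ltW r0) //.
  apply: le_trans (sqn_le_norm _) _; rewrite mulrAC [leRHS]mulrC ler_wpM2l //.
  have -> : 25 * rho ^+ 2 = (5 * rho) ^+ 2 by ring.
  rewrite lerXn2r ?nnegrE ?mulr_ge0 ?(ltW r0) //.
  by apply: le_trans (ler_normB _ _) _; lra.
have -> : - ((n%:R + 0%:R - 1) / 2) = - (half_exp - 4^-1) :> R by rewrite /half_exp; field.
apply: le_trans (wt_gain (half_exp - 4^-1) e0 (_ : 0 <= 4^-1) wB) _; first by rewrite invr_ge0.
rewrite subrK ler_wpM2r ?powR_ge0 // powRM ?sqr_ge0 ?addr_ge0 ?mulr_ge0 //.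
rewrite -[rho ^+ 2]powR_mulrn ?(ltW r0) // -powRrM.
by have -> : 2%:R * 4^-1 = 2^-1 :> R by field.
Qed.

(** The kernels of order [2m] and [2m + 1] are not summable uniformly in the scale.  The
bounds blow up, but serve only where a mesh factor follows, or to start an iteration. *)
Lemma crude_bound : exists2 K : R, 0 < K & forall p s x F A j, (4 <= p)%N ->
  (size s).+1 = (2 * m + j)%N -> (0 < j <= 2)%N -> `|x| <= 2 -> 0 <= A ->
  (forall y, `|F y| <= A) ->
  `|conv (grid p) (Dw s (V (eps p))) F x| <= K * eps p `^ (- (j%:R - 2^-1)) * A.
Proof.
have [Ch Ch0 HC] := half_sum; exists (C * Ch); first exact: mulr_gt0.
move=> p s x F A j p4 ss /andP[j0 j2] x2 A0 FA; have e0 : 0 < eps p :> R := eps_gt0 p4.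
pose D := A * (C * eps p `^ (- (j%:R - 2^-1))).
have D0 : 0 <= D by rewrite !mulr_ge0 ?powR_ge0 ?(ltW C0).
have -> : C * Ch * eps p `^ (- (j%:R - 2^-1)) * A = D * Ch by rewrite /D; ring.
apply: (lattice_bound D0 (HC p x p4 x2)) => nu.
rewrite normrM /D -mulrA; apply: ler_pM => //.
apply: le_trans (gk_size gk _ e0 ss j2) _; rewrite -[leRHS]mulrA ler_wpM2l ?(ltW C0) //.
have -> : - ((n%:R + j%:R - 1) / 2) = - (half_exp + (j%:R - 2^-1) / 2) :> R.
  by rewrite /half_exp; field.
have j1 : 1 <= j%:R :> R by rewrite ler1n.
have d0 : 0 <= (j%:R - 2^-1) / 2 :> R by lra.
apply: le_trans (wt_loss _ half_exp e0 d0) _.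
by have -> : 2 * ((j%:R - 2^-1) / 2) = j%:R - 2^-1 :> R by field.
Qed.

(** A derivative of order [2m] is compared with a difference quotient of step equal to
the mesh, because such a translation of the potential is one of the density: one
derivative moves from the kernel to the density. *)
Lemma quotient_error : exists2 K : R, 0 < K & forall p s i x F A, (4 <= p)%N ->
  (size s).+1 = (2 * m)%N -> `|x| <= 1 -> 0 <= A -> (forall y, `|F y| <= A) ->
  (forall y, 2^-1 <= `|y| -> F y = 0) ->
  `|conv (grid p) (Dw (i :: s) (V (eps p))) F x - (grid p)%:R^-1^-1 *
    conv (grid p) (Dw s (V (eps p))) (fun y => F (y + (grid p)%:R^-1 *: ebasis i) - F y) x|
  <= K * eps p `^ 2^-1 * A.
Proof.
have [K K0 HK] := crude_bound; exists K => // p s i x F A p4 ss x1 A0 FA FS.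
have e0 : 0 < eps p :> R := eps_gt0 p4; have h0 : 0 < (grid p)%:R^-1 :> R := step_gt0 p4; have h64 : (grid p)%:R^-1 <= 64^-1 :> R := step_le p4.
have sV := gk_smooth gk e0.
have sf : smooth (conv (grid p) (V (eps p)) F) by exact: smooth_conv.
pose f := conv (grid p) (V (eps p)) F.
have D1 y : is_derive y (ebasis i) (Dw s f) (Dw (i :: s) f y) by exact: (smoothP s y i sf).
have D2 y : is_derive y (ebasis i) (Dw (i :: s) f) (Dw [:: i, i & s] f y).
  exact: (smoothP (i :: s) y i sf).
have FB y : 1 - (grid p)%:R^-1 <= `|y| -> F y = 0.
  by move=> hy; apply: FS; lra.
have Q t : 0 <= t <= (grid p)%:R^-1 ->
    `|Dw [:: i, i & s] f (x + t *: ebasis i)| <= K * eps p `^ (- (2%:R - 2^-1)) * A.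
  move=> /andP[t0 th]; rewrite /f (Dw_conv _ F [:: i, i & s] sV).
  apply: (HK p [:: i, i & s] (x + t *: ebasis i) F A 2%N) => //=; first by rewrite ss addn2.
  by apply: le_trans (ler_normD _ _) _; have := norm_step i t0; lra.
have := difference_quotient h0 D1 D2 Q.
rewrite /f (Dw_conv _ F (i :: s) sV) (Dw_conv _ F s sV) (conv_step_diff _ _ _ (grid_gt0 p4) FB).
move/le_trans; apply; rewrite mulrA ler_wpM2r // mulrCA ler_wpM2l ?(ltW K0) //.
rewrite step_powR //; apply: ger_powR; last by lra.
by rewrite e0 /=; have : eps p <= 4^-1 :> R := eps_le p4; lra.
Qed.

(** Divided by the mass of the bubble, so that the [m]-th Laplacian reproduces [F]. *)
Definition pot p F : 'rV[R]_n -> R :=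
  conv (grid p) (V (eps p)) (fun y => (mass p)^-1 * F y).

Lemma smooth_pot p F : (4 <= p)%N -> smooth (pot p F).
Proof. by move=> p4; apply/smooth_conv/(gk_smooth gk)/eps_gt0. Qed.

Lemma commute_pot p F : (4 <= p)%N -> partials_commute (pot p F).
Proof.
by move=> p4; have e0 : 0 < eps p :> R := eps_gt0 p4; apply: commute_conv; [apply: (gk_smooth gk)|apply: (gk_commute gk)].
Qed.

Lemma Dw_pot p F s x : (4 <= p)%N ->
  Dw s (pot p F) x = (mass p)^-1 * conv (grid p) (Dw s (V (eps p))) F x.
Proof.
move=> p4; have sV := gk_smooth gk (eps_gt0 p4 : 0 < eps p :> R).
by rewrite /pot (Dw_conv _ _ s sV) convZ.
Qed.

Lemma iter_laplacian_pot p F x : (4 <= p)%N ->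
  iter m (@laplacian R n) (pot p F) x = (mass p)^-1 * conv (grid p) (phi (eps p)) F x.
Proof.
move=> p4; have sV := gk_smooth gk (eps_gt0 p4 : 0 < eps p :> R).
by rewrite /pot (iter_laplacian_conv _ _ _ sV) convZ.
Qed.

(** With [A] a bound and [L] a Lipschitz constant for the density, and up to errors that
vanish with the scale: the derivatives of order [2m - 1] see only [A] and are small with
the support, those of order [2m] see [L], are small too and Hoelder continuous, and the
[m]-th Laplacian is the density.  The constant serves all scales. *)
Record pot_bounds (K : R) : Prop := PotBounds {
  pb_low : forall p rho s x F A, (4 <= p)%N ->
    0 < rho <= 16^-1 -> eps p <= rho -> (size s).+1 = (2 * m)%N -> `|x| <= 2 * rho -> 0 <= A ->
    (forall y, 2 * rho <= `|y| -> F y = 0) -> (forall y, `|F y| <= A) ->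
    `|Dw s (pot p F) x| <= K * rho `^ 2^-1 * A;
  pb_crude : forall p s x F A, (4 <= p)%N ->
    size s = (2 * m)%N -> `|x| <= 2 -> 0 <= A -> (forall y, `|F y| <= A) ->
    `|Dw s (pot p F) x| <= K * eps p `^ (- 2^-1) * A;
  pb_top : forall p rho s x F A L, (4 <= p)%N ->
    0 < rho <= 16^-1 -> eps p <= rho -> size s = (2 * m)%N -> `|x| <= 2 * rho -> 0 <= A -> 0 <= L ->
    (forall y, 2 * rho <= `|y| -> F y = 0) -> (forall y, `|F y| <= A) ->
    (forall y z, `|F y - F z| <= L * `|y - z|) ->
    `|Dw s (pot p F) x| <= K * (rho `^ 2^-1 * L + eps p `^ 2^-1 * A);
  pb_holder : forall p rho s x x' F A L, (4 <= p)%N ->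
    0 < rho <= 16^-1 -> eps p <= rho -> size s = (2 * m)%N -> `|x| <= 2 * rho -> `|x'| <= 2 * rho ->
    0 <= A -> 0 <= L ->
    (forall y, 2 * rho <= `|y| -> F y = 0) -> (forall y, `|F y| <= A) ->
    (forall y z, `|F y - F z| <= L * `|y - z|) ->
    `|Dw s (pot p F) x - Dw s (pot p F) x'| <= K * (L * `|x - x'| `^ alpha + eps p `^ 2^-1 * A);
  pb_lap : forall p rho x F A L, (4 <= p)%N ->
    0 < rho <= 16^-1 -> `|x| <= 2 * rho -> 0 <= A -> 0 <= L ->
    (forall y, 2 * rho <= `|y| -> F y = 0) -> (forall y, `|F y| <= A) ->
    (forall y z, `|F y - F z| <= L * `|y - z|) ->
    `|iter m (@laplacian R n) (pot p F) x - F x| <= K * (L + A) * eps p `^ 2^-1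
}.

Lemma pot_bounds_exist : exists2 K : R, 0 < K & pot_bounds K.
Proof.
have [s0 s00 Hs0] := mass_lower.
have [K1 K10 HK1] := near_bound; have [K2 K20 HK2] := crude_bound.
have [K3 K30 HK3] := quotient_error; have [Ca Ca0 HCa] := holder_sum.
have [K4 K40 HK4] := concentration; have [K5 K50 HK5] := mass_variation.
pose K0 := s0^-1 * (K1 + K2 + 2 * K3 + 2 * C * Ca + 8 * K4 + K5).
have s0i : 0 < s0^-1 by rewrite invr_gt0.
have CCa : 0 < C * Ca by rewrite mulr_gt0.
have massi p : (4 <= p)%N -> 0 < (mass p)^-1 <= s0^-1.
  move=> p4; have ms := lt_le_trans s00 (Hs0 p p4).
  by rewrite invr_gt0 ms lef_pV2 ?posrE //; apply: Hs0.
(* every bound below has the form: 1/mass times a bound for the convolution *)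
have scale p X B k : (4 <= p)%N -> `|X| <= k * B -> 0 <= k -> 0 <= B ->
    k <= K1 + K2 + 2 * K3 + 2 * C * Ca + 8 * K4 + K5 -> `|(mass p)^-1 * X| <= K0 * B.
  move=> p4 HX k0 B0 kK; have /andP[m1 m2] := massi p p4.
  rewrite normrM (gtr0_norm m1) /K0 -mulrA; apply: ler_pM => //; first exact: ltW.
  by apply: le_trans HX _; rewrite ler_wpM2r.
have supp p rho F : (4 <= p)%N -> 0 < rho <= 16^-1 -> eps p <= rho ->
    (forall y, 2 * rho <= `|y| -> F y = 0) -> forall i y, 3 * rho <= `|y| ->
    F (y + (grid p)%:R^-1 *: ebasis i) - F y = 0.
  move=> p4 /andP[r0 r1] er FS i y y3; have h0 : 0 < (grid p)%:R^-1 :> R := step_gt0 p4; have he : (grid p)%:R^-1 <= eps p :> R := step_le_eps p4.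
  rewrite !FS ?subrr //; first by quick_lra.
  have := norm_step i (ltW h0); have := ler_distD (y + (grid p)%:R^-1 *: ebasis i) y 0.
  by rewrite !subr0 opprD addNKr normrN => D1 D2; quick_lra.
have stepL p F L : (4 <= p)%N -> (forall y z, `|F y - F z| <= L * `|y - z|) -> 0 <= L ->
    forall i y, `|F (y + (grid p)%:R^-1 *: ebasis i) - F y| <= L * (grid p)%:R^-1.
  move=> p4 FL L0 i y; apply: le_trans (FL _ _) _; rewrite addrAC subrr add0r ler_wpM2l //.
  by apply: norm_step; apply/ltW/step_gt0.
have half rho F : 0 < rho <= 16^-1 -> (forall y, 2 * rho <= `|y| -> F y = 0) ->
    forall y, 2^-1 <= `|y| -> F y = 0.
  by move=> /andP[r0 r1] FS y hy; apply: FS; lra.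
have sum_ge : 0 <= K1 + K2 + 2 * K3 + 2 * C * Ca + 8 * K4 + K5 by lra.
exists K0; first by rewrite /K0 mulr_gt0 //; lra.
split.
- move=> p rho s x F A p4 r01 er ss xr A0 FS FA; rewrite Dw_pot // -mulrA.
  have r0 : 0 < rho by case/andP: r01.
  apply: (scale p _ _ K1) => //; [|exact: ltW|by rewrite mulr_ge0 ?powR_ge0|by quick_lra].
  rewrite mulrA; apply: (HK1 p rho) => // y y3; apply: FS; quick_lra.
- move=> p s x F A p4 ss x2 A0 FA; rewrite Dw_pot // -mulrA.
  apply: (scale p _ _ K2) => //; [|exact: ltW|by rewrite mulr_ge0 ?powR_ge0|by quick_lra].
  rewrite mulrA; have -> : - 2^-1 = - (1%:R - 2^-1) :> R by field.
  by apply: HK2 => //; rewrite ss addn1.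
- move=> p rho [|i s] x F A L p4 r01 er ss xr A0 L0 FS FA FL; first by case: (m) m0 ss.
  have /andP[r0 r1] := r01; have h0 : 0 < (grid p)%:R^-1 :> R := step_gt0 p4.
  have ss' : (size s).+1 = (2 * m)%N by [].
  have x1 : `|x| <= 1 by quick_lra.
  have E3 := HK3 p s i x F A p4 ss' x1 A0 FA (half rho F r01 FS).
  have E1 := HK1 p rho s x _ (L * (grid p)%:R^-1) p4 r01 er ss' xr (mulr_ge0 L0 (ltW h0))
    (supp p rho F p4 r01 er FS i) (stepL p F L p4 FL L0 i).
  rewrite Dw_pot //; apply: (scale p _ _ (K1 + K3)) => //; [|by quick_lra| |by quick_lra]; last first.
    by rewrite addr_ge0 // mulr_ge0 ?powR_ge0.
  move: E1 E3; set Y := conv _ _ _ x; set X := conv _ _ _ x; set h : R := _^-1 in h0 * => E1 E3.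
  have -> : X = (X - h^-1 * Y) + h^-1 * Y by ring.
  have E1' : `|h^-1 * Y| <= K1 * rho `^ 2^-1 * L.
    have hi : 0 < h^-1 by rewrite invr_gt0.
    rewrite normrM (gtr0_norm hi) (ler_pdivrMl _ _ h0); apply: le_trans E1 _.
    by apply: eqr_le; ring.
  apply: le_trans (ler_normD _ _) _.
  have P1 := powR_ge0 rho 2^-1; have P2 := powR_ge0 (eps p) 2^-1.
  have Q1 : 0 <= K1 * (eps p `^ 2^-1 * A) by rewrite !mulr_ge0 // ltW.
  have Q3 : 0 <= K3 * (rho `^ 2^-1 * L) by rewrite !mulr_ge0 // ltW.
  by quick_lra.
- move=> p rho [|i s] x x' F A L p4 r01 er ss xr xr' A0 L0 FS FA FL; first by case: (m) m0 ss.
  have /andP[r0 r1] := r01; have h0 : 0 < (grid p)%:R^-1 :> R := step_gt0 p4; have e0 : 0 < eps p :> R := eps_gt0 p4.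
  have ss' : (size s).+1 = (2 * m)%N by [].
  have x1 : `|x| <= 1 by quick_lra. have x1' : `|x'| <= 1 by quick_lra.
  have E3 := HK3 p s i x F A p4 ss' x1 A0 FA (half rho F r01 FS).
  have E3' := HK3 p s i x' F A p4 ss' x1' A0 FA (half rho F r01 FS).
  rewrite !Dw_pot // -mulrBr; apply: (scale p _ _ (2 * C * Ca + 2 * K3)) => //; [|by quick_lra| |by quick_lra]; last first.
    by rewrite addr_ge0 // mulr_ge0 ?powR_ge0.
  set dF := fun y => F (y + (grid p)%:R^-1 *: ebasis i) - F y in E3 E3'.
  have E4 : `|conv (grid p) (Dw s (V (eps p))) dF x - conv (grid p) (Dw s (V (eps p))) dF x'|
      <= L * (grid p)%:R^-1 * (C * `|x - x'| `^ alpha * (2 * Ca)).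
    rewrite convBx normrM ger0_norm ?exprn_ge0 ?invr_ge0 //.
    apply: (@le_trans _ _ (L * (grid p)%:R^-1 * (C * `|x - x'| `^ alpha) *
      ((grid p)%:R^-1 ^+ n * \sum_(nu : node (grid p)) wt (eps p) (x - pt nu) `^ (- ((n%:R - (1 - alpha)) / 2)) +
       (grid p)%:R^-1 ^+ n * \sum_(nu : node (grid p)) wt (eps p) (x' - pt nu) `^ (- ((n%:R - (1 - alpha)) / 2))))).
      rewrite -mulrDr -big_split /= mulrCA ler_wpM2l ?exprn_ge0 ?invr_ge0 // mulr_sumr.
      apply: le_trans (ler_norm_sum _ _ _) _; apply: ler_sum => nu _.
      rewrite normrM -[leRHS]mulrA; apply: ler_pM => //; first exact: (stepL p F L p4 FL L0 i (pt nu)).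
      have -> : `|x - x'| = `|(x - pt nu) - (x' - pt nu)| by rewrite opprB addrA subrK.
      exact: (gk_holder gk).
    rewrite [leRHS]mulrA ler_wpM2l ?mulr_ge0 ?powR_ge0 ?(ltW C0) ?(ltW h0) //.
    have x2 : `|x| <= 2 by quick_lra. have x2' : `|x'| <= 2 by quick_lra.
    have h1 := HCa p x p4 x2; have h2 := HCa p x' p4 x2'.
    by quick_lra.
  move: E3 E3' E4; set h : R := _^-1 in h0 * => E3 E3' E4.
  move: E3 E3' E4; set X := conv _ _ _ x; set Y := conv _ _ dF x; set X' := conv _ _ _ x'.
  set Y' := conv _ _ dF x' => E3 E3' E4.
  have -> : X - X' = (X - h^-1 * Y) - (X' - h^-1 * Y') + h^-1 * (Y - Y') by ring.
  have E4' : `|h^-1 * (Y - Y')| <= 2 * C * Ca * (L * `|x - x'| `^ alpha).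
    have hi : 0 < h^-1 by rewrite invr_gt0.
    rewrite normrM (gtr0_norm hi) (ler_pdivrMl _ _ h0); apply: le_trans E4 _.
    by apply: eqr_le; ring.
  apply: le_trans (ler_normD _ _) _; apply: le_trans (lerD (ler_normB _ _) (lexx _)) _.
  have P1 := powR_ge0 `|x - x'| alpha; have P2 := powR_ge0 (eps p) 2^-1.
  have Q1 : 0 <= 2 * C * Ca * (eps p `^ 2^-1 * A) by rewrite !mulr_ge0 // ltW.
  have Q3 : 0 <= K3 * (L * `|x - x'| `^ alpha) by rewrite !mulr_ge0 // ltW.
  by quick_lra.
- move=> p rho x F A L p4 r01 xr A0 L0 FS FA FL; have /andP[r0 r1] := r01.
  have e0 : 0 < eps p :> R := eps_gt0 p4; have ms := lt_le_trans s00 (Hs0 p p4).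
  have x8 : `|x| <= 8^-1 by quick_lra. have x2 : `|x| <= 2 by quick_lra.
  rewrite iter_laplacian_pot //.
  (* freeze the density at [x], and compare the mass seen from [x] with [mass p] *)
  have -> : (mass p)^-1 * conv (grid p) (phi (eps p)) F x - F x =
      (mass p)^-1 * (conv (grid p) (phi (eps p)) (fun y => F y - F x * cutoff 4^-1 y) x +
        F x * (conv (grid p) (phi (eps p)) (cutoff 4^-1) x - mass p)).
    rewrite -convB convZ; field; exact: lt0r_neq0.
  rewrite -mulrA; apply: (scale p _ _ (8 * K4 + K5)) => //; [|by quick_lra| |by quick_lra]; last first.
    by rewrite mulr_ge0 ?powR_ge0 ?addr_ge0.
  apply: le_trans (ler_normD _ _) _; rewrite mulrDl; apply: lerD; last first.
    rewrite normrM mulrCA; apply: ler_pM => //; last exact: HK5.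
    by apply: le_trans (FA x) _; lra.
  have -> : 8 * K4 * ((L + A) * eps p `^ 2^-1) = K4 * (8 * (L + A)) * eps p `^ 2^-1 by ring.
  apply: (HK4 p x) => //; first by rewrite mulr_ge0 ?addr_ge0.
  move=> nu; rewrite normrM mulrCA [leLHS]mulrC (ger0_norm (phi_ge0 _ e0)) ler_wpM2l ?phi_ge0 //.
  set y : 'rV[R]_n := pt nu.
  have [y1|y1] := leP `|y| 4^-1.
    rewrite cutoff1 ?invr_gt0 // mulr1 distrC; apply: le_trans (FL _ _) _.
    by rewrite ler_wpM2r //; quick_lra.
  rewrite FS; last by quick_lra.
  rewrite sub0r normrN normrM.
  have /andP[c0 c1] := cutoff01 4^-1 y.
  have xy : 8^-1 <= `|x - y|.
    by have := ler_distD x y 0; rewrite !subr0 (distrC y x) => xyD; quick_lra.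
  have Fc : `|F x| * `|cutoff 4^-1 y| <= A * 1 by apply: ler_pM => //; rewrite ger0_norm.
  apply: le_trans Fc _; rewrite mulr1.
  have : 0 <= (L + A) * (8 * `|x - y| - 1) by apply: mulr_ge0; [exact: addr_ge0|quick_lra].
  by move=> Q; quick_lra.
Qed.

End Potential.

Arguments phi {R n} m V e _.
Arguments mass {R n} m V p.
Arguments pot {R n} m V p F _.
Arguments pot_bounds {R n} m alpha V K.

(** * Truncation of the nonlinearity *)

Section LipschitzTruncation.
Context {R : realType} {D N : nat}.
Implicit Types (p q : 'rV[R]_D).

Definition clamp (p0 p : 'rV[R]_D) : 'rV[R]_D :=
  \row_e (p0 ord0 e + Num.max (-1) (Num.min 1 (p ord0 e - p0 ord0 e))).

Lemma clamp_near p0 p : `|clamp p0 p - p0| <= 1.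
Proof.
apply: norm_le_coord => // e; rewrite !mxE addrAC subrr add0r ler_norml.
by rewrite le_max lexx /= ge_max ge_min lexx andbT; lra.
Qed.

Lemma clamp_id p0 p : `|p - p0| <= 1 -> clamp p0 p = p.
Proof.
move=> H; apply/rowP => e; rewrite !mxE.
have := le_trans (coord_le_norm (p - p0) e) H; rewrite !mxE ler_norml => /andP[h1 h2].
by rewrite (min_idPr h2) (max_idPr h1); ring.
Qed.

Lemma clamp_lip p0 p q : `|clamp p0 p - clamp p0 q| <= `|p - q|.
Proof.
apply: norm_le_coord => // e.
apply: le_trans (coord_le_norm (p - q) e); rewrite !mxE.
move: (p ord0 e) (q ord0 e) (p0 ord0 e) => a b c.
have -> : c + Num.max (-1) (Num.min 1 (a - c)) - (c + Num.max (-1) (Num.min 1 (b - c))) =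
  Num.max (-1) (Num.min 1 (a - c)) - Num.max (-1) (Num.min 1 (b - c)) by ring.
have m1 : -1 <= 1 :> R by lra.
rewrite ler_norml; have := ler_norm (a - b); have := ler_norm (b - a); rewrite (distrC b a).
case: (leP 1 (a - c)) => h1; case: (leP 1 (b - c)) => h2; rewrite ?(max_idPr m1).
- lra.
- by case: (leP (-1) (b - c)); lra.
- by case: (leP (-1) (a - c)); lra.
- by case: (leP (-1) (a - c)); case: (leP (-1) (b - c)); lra.
Qed.

Lemma enorm_le_norm p : enorm p <= D%:R * `|p|.
Proof.
rewrite /enorm -(ger0_norm (_ : 0 <= D%:R * `|p|)) ?mulr_ge0 // -sqrtr_sqr ler_wsqrtr //.
apply: le_trans (sqn_le_norm p) _; rewrite exprMn ler_wpM2r ?sqr_ge0 //.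
rewrite -natrX ler_nat; case: (D) => // k; rewrite expnS expn1; lia.
Qed.

Lemma norm_le_enorm p : `|p| <= enorm p.
Proof.
apply: norm_le_coord; first exact: sqrtr_ge0.
move=> i; rewrite -(sqrtr_sqr (p ord0 i)) ler_wsqrtr // (bigD1 i) //= lerDl.
by apply: sumr_ge0 => j _; apply: sqr_ge0.
Qed.

(** A Hoelder continuous gradient is bounded on bounded sets; so the composition with
the projection to a cube is Lipschitz everywhere and of bounded oscillation. *)
Lemma lipschitz_truncation (alpha : R) (a : 'rV[R]_D -> 'rV[R]_N) (p0 : 'rV[R]_D) :
  0 < alpha -> C1_holder alpha a ->
  exists (L : R) (at_ : 'I_N -> 'rV[R]_D -> R), [/\ 0 < L,
    forall l p q, `|at_ l p - at_ l q| <= L * `|p - q|,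
    forall l p, `|at_ l p - at_ l p0| <= L &
    forall l p, `|p - p0| <= 1 -> at_ l p = a p ord0 l].
Proof.
move=> al0 ha; pose r : R := `|p0| + 1.
have r0 : 0 <= r by rewrite addr_ge0.
pose A : set 'rV[R]_D := [set p | `|p| <= r].
have bA : bounded_set A.
  by exists r; split; [exact: num_real|move=> t rt p /= /le_trans; apply; apply: ltW].
have bound (li : 'I_N * 'I_D) : exists2 M : R, 0 <= M &
    forall p, A p -> `|partial li.2 (component a li.1) p| <= M.
  have [_ /(_ A bA) [C HC]] := ha li.1 li.2.
  set g := partial _ _ in HC *.
  exists (`|g p0| + `|C| * (D%:R * (2 * r)) `^ alpha).
    by rewrite addr_ge0 // mulr_ge0 ?powR_ge0.
  move=> p Ap; have Ap0 : A p0 by rewrite /A /= /r lerDl.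
  have -> : g p = g p0 + (g p - g p0) by ring.
  apply: le_trans (ler_normD _ _) _; rewrite lerD2l.
  apply: le_trans (HC p p0 Ap Ap0) _.
  apply: (@le_trans _ _ (`|C| * enorm (p - p0) `^ alpha)).
    by rewrite ler_wpM2r ?powR_ge0 // ler_norm.
  rewrite ler_wpM2l //; apply: ge0_ler_powR; rewrite ?nnegrE ?sqrtr_ge0 ?(ltW al0) ?mulr_ge0 //.
  apply: le_trans (enorm_le_norm _) _; rewrite ler_wpM2l //.
  by apply: le_trans (ler_normB _ _) _; move: Ap Ap0; rewrite /A /=; lra.
have [M M0 HM] : exists2 M : R, 0 < M & forall li : 'I_N * 'I_D, forall p, A p ->
    `|partial li.2 (component a li.1) p| <= M.
  apply: (uniform_constant (P := fun li M => forall p, A p -> `|partial li.2 (component a li.1) p| <= M)).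
    by move=> li M M' MM' + p Ap => /(_ p Ap) /le_trans; apply.
  exact: bound.
have D0 : 0 < M * (D%:R + 1) by rewrite mulr_gt0 // ltr_wpDl.
have lipA l p q : A p -> A q -> `|a p ord0 l - a q ord0 l| <= M * (D%:R + 1) * `|p - q|.
  move=> Ap Aq; apply: (@le_trans _ _ (M * \sum_(i < D) `|p ord0 i - q ord0 i|)).
    apply: (@mvt_box _ _ (component a l) (fun i => partial i (component a l)) M q p) => z i hz.
      by apply: derivableP; case: (ha l i).
    by apply: (HM (l, i)); apply: (hull_norm hz).
  rewrite -mulrA ler_wpM2l ?(ltW M0) //; apply: le_trans (sum_coord_le_dist q p) _.
  by rewrite distrC ler_wpM2r // lerDl.
have cA p : A (clamp p0 p).
  rewrite /A /= /r; have := ler_normD (clamp p0 p - p0) p0; rewrite subrK.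
  by have := clamp_near p0 p; lra.
exists (M * (D%:R + 1)), (fun l p => a (clamp p0 p) ord0 l); split=> //.
- move=> l p q; apply: le_trans (lipA l _ _ (cA p) (cA q)) _.
  by rewrite ler_wpM2l ?(ltW D0) // clamp_lip.
- move=> l p; apply: le_trans (lipA l _ _ (cA p) (cA p0)) _.
  rewrite -[leRHS]mulr1 ler_wpM2l ?(ltW D0) //.
  have e0 : clamp p0 p0 = p0 by apply: clamp_id; rewrite subrr normr0.
  by rewrite e0; apply: clamp_near.
- by move=> l p pp0; rewrite clamp_id.
Qed.

End LipschitzTruncation.

Section JetPoint.
Context {R : realType} {n N : nat}.
Variable m : nat.
Implicit Types (u : 'rV[R]_n -> 'rV[R]_N) (x : 'rV[R]_n).

Definition jet_point u x : 'rV[R]_(n + jet_size n N (2 * m)) := row_mx x (jet (2 * m) u x).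

Lemma nabla_entry j (e : 'I_(nabla_size n N j)) u x :
  nabla j u x ord0 e = Dw (word_of (enum_val e).1) (component u (enum_val e).2) x.
Proof. by rewrite mxE multi_partialE. Qed.

(** Only two kinds of entries occur, which is all that estimates and limits of jets use. *)
Lemma jet_point_entry (e : 'I_(n + jet_size n N (2 * m))) :
  (exists i, forall u x, jet_point u x ord0 e = x ord0 i) \/
  (exists s l, (size s < 2 * m)%N /\ forall u x, jet_point u x ord0 e = Dw s (component u l) x).
Proof.
rewrite /jet_point; case: (split_ordP e) => [i ->|k ->].
  by left; exists i => u x; rewrite row_mxEl.
right; exists (word_of (enum_val (tagnat.sig2 k)).1), (enum_val (tagnat.sig2 k)).2.
split; first by rewrite size_word_of.
by move=> u x; rewrite row_mxEr /jet mxE nabla_entry.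
Qed.

Lemma jet_point_dist u u' x x' (B : R) : 0 <= B -> `|x - x'| <= B ->
  (forall s l, (size s < 2 * m)%N -> `|Dw s (component u l) x - Dw s (component u' l) x'| <= B) ->
  `|jet_point u x - jet_point u' x'| <= B.
Proof.
move=> B0 xB H; apply: norm_le_coord => // e.
have -> : (jet_point u x - jet_point u' x') ord0 e = jet_point u x ord0 e - jet_point u' x' ord0 e.
  by rewrite !mxE.
case: (jet_point_entry e) => [[i E]|[s [l [sm E]]]]; rewrite !E; last exact: H.
apply: le_trans xB; have := coord_le_norm (x - x') i; by rewrite !mxE.
Qed.

End JetPoint.

(** * Picard iteration *)

Lemma half_pow_small {R : realType} (A e : R) : 0 < e -> exists k, A * 2^-1 ^+ k <= e.
Proof.
move=> e0; have : (fun k => geometric A (2^-1 : R) k) @ \oo --> (0 : R).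
  by apply: cvg_geometric; rewrite ger0_norm ?invr_ge0 // invf_lt1 //; lra.
move=> /cvgrPdist_le /(_ e e0) [k _ Hk]; exists k; have := Hk k (leqnn k).
by rewrite /= sub0r normrN; apply: le_trans; apply: ler_norm.
Qed.

Section Picard.
Context {R : realType} {T : Type}.

(** Pointwise, the limit of the iterates is the common point of nested intervals around
them; so completeness of the reals suffices, for an arbitrary [T]. *)
Lemma picard (Phi : (T -> R) -> T -> R) (M : R) :
  0 <= M -> (forall X Y B, 0 <= B -> (forall t, `|X t - Y t| <= B) ->
     forall t, `|Phi X t - Phi Y t| <= B / 2) ->
  (forall t, `|Phi (fun=> 0) t| <= M) ->
  exists X : T -> R, forall t, X t = Phi X t.
Proof.
move=> M0 contr HM; pose X k := iter k Phi (fun=> 0).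
have half_ge0 k : 0 <= 2^-1 ^+ k :> R by rewrite exprn_ge0 // invr_ge0.
have step k t : `|X k.+1 t - X k t| <= M * 2^-1 ^+ k.
  elim: k t => [|k IH] t; first by rewrite /= subr0 expr0 mulr1.
  rewrite exprSr mulrA; apply: (contr (X k.+1) (X k)) => //.
  by rewrite mulr_ge0 // M0.
pose y t k := X k t - 2 * M * 2^-1 ^+ k; pose z t k := X k t + 2 * M * 2^-1 ^+ k.
have yS t k : y t k <= y t k.+1 /\ z t k.+1 <= z t k.
  have := step k t; rewrite /y /z exprSr ler_norml.
  by move: (X k t) (X k.+1 t) (2^-1 ^+ k) => a b q; split; lra.
have ymono t k j : (k <= j)%N -> y t k <= y t j /\ z t j <= z t k.
  move=> /subnK <-; elim: (j - k)%N => [|d [h1 h2]]; first by rewrite add0n.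
  by rewrite addSn; have [h3 h4] := yS t (d + k)%N; split; lra.
have yz t k j : y t k <= z t j.
  have [h1 _] := ymono t k (maxn k j) (leq_maxl _ _).
  have [_ h2] := ymono t j (maxn k j) (leq_maxr _ _).
  apply: le_trans h1 (le_trans _ h2); rewrite /y /z.
  by have := mulr_ge0 M0 (half_ge0 (maxn k j)); move: (2^-1 ^+ _) => q; lra.
pose L t := sup [set y t k | k in setT].
have near t k : `|X k t - L t| <= 2 * M * 2^-1 ^+ k.
  have h1 : y t k <= L t.
    apply: ub_le_sup; last by exists k.
    by exists (z t 0%N) => _ [j _ <-]; apply: yz.
  have h2 : L t <= z t k.
    apply: ge_sup; first by exists (y t 0%N), 0%N.
    by move=> _ [j _ <-]; apply: yz.
  by move: h1 h2; rewrite /y /z ler_norml; move: (2^-1 ^+ k) => q; lra.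
exists L => t; apply/eqP; rewrite -subr_eq0 -normr_le0.
apply/ler_addgt0Pr => e e0; rewrite add0r; have tM := M0.
have [k Hk] := half_pow_small (4 * M) e0.
apply: le_trans Hk.
have -> : L t - Phi L t = - (X k.+1 t - L t) + (Phi (X k) t - Phi L t) by rewrite /X /=; ring.
apply: le_trans (ler_normD _ _) _; rewrite normrN.
have MH := mulr_ge0 tM (half_ge0 k).
have B0 : 0 <= 2 * M * 2^-1 ^+ k by rewrite -mulrA; lra.
have := near t k.+1; have := contr (X k) L _ B0 (fun s => near s k) t.
rewrite exprSr; move: MH; move: (2^-1 ^+ k) => q; lra.
Qed.

End Picard.

(** * Words for the iterated Laplacian, and Taylor remainders *)

Section IteratedLaplacian.
Context {R : realType} {n : nat}.
Implicit Types (f g : 'rV[R]_n -> R) (x : 'rV[R]_n) (r s : seq 'I_n) (A : set 'rV[R]_n).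

(** The word expansion of [Dw r] of the [j]-th Laplacian.  It makes sense as soon as the
derivatives that occur do, and passes to pointwise limits term by term. *)
Fixpoint lapW j r f x : R :=
  if j is j'.+1 then \sum_(i < n) lapW j' (r ++ [:: i; i]) f x else Dw r f x.

Lemma is_derive_lapW f A k : (forall s x i, (size s < k)%N -> A x ->
    is_derive x (ebasis i) (Dw s f) (Dw (i :: s) f x)) ->
  forall j r x i, (size r + 2 * j < k)%N -> A x ->
    is_derive x (ebasis i) (lapW j r f) (lapW j (i :: r) f x).
Proof.
move=> H; elim=> [|j IH] r x i rk Ax /=; first by apply: H => //; lia.
apply: is_derive_sumf => a; apply: IH => //; rewrite size_cat /=; lia.
Qed.

Lemma iter_laplacianW f A k : open A -> (forall s x i, (size s < k)%N -> A x ->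
    is_derive x (ebasis i) (Dw s f) (Dw (i :: s) f x)) ->
  forall j r x, (size r + 2 * j <= k)%N -> A x ->
    Dw r (iter j (@laplacian R n) f) x = lapW j r f x.
Proof.
move=> oA H; elim=> [//|j IH]; elim=> [|i r IHr] x rk Ax.
  rewrite [LHS]/= /laplacian; apply: eq_bigr => i _.
  by rewrite -[LHS]/(Dw [:: i; i] (iter j (@laplacian R n) f) x) IH //=; move: rk => /=; lia.
rewrite -[LHS]/(partial i (Dw r (iter j.+1 (@laplacian R n) f)) x) /partial.
rewrite (@near_eq_derive _ _ _ _ (lapW j.+1 r f)).
  have [] // := is_derive_lapW H (j := j.+1) (r := r) (x := x) i _ Ax.
by near=> y; apply: IHr; [move: rk => /=; lia|near: y; apply: open_nbhs_nbhs].
Unshelve. all: by end_near. Qed.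

Lemma iter_laplacian_smooth f j x : smooth f -> iter j (@laplacian R n) f x = lapW j [::] f x.
Proof.
move=> sf; apply: (iter_laplacianW (A := setT) (k := (2 * j)%N) openT _ (r := [::])) => // s y i _ _.
exact: smoothP.
Qed.

Lemma lapWD f g j r x : smooth f -> smooth g ->
  lapW j r (fun x => f x + g x) x = lapW j r f x + lapW j r g x.
Proof.
move=> sf sg; elim: j r => [|j IH] r /=; first by rewrite (DwD sf sg).
by rewrite -big_split /=; apply: eq_bigr => i _.
Qed.

Lemma lapWB f g j r x : smooth f -> smooth g ->
  lapW j r (fun x => f x - g x) x = lapW j r f x - lapW j r g x.
Proof.
move=> sf sg; elim: j r => [|j IH] r /=; first by rewrite (DwB r sf sg).
by rewrite -sumrB; apply: eq_bigr => i _.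
Qed.

Lemma lapWZ c f j r x : smooth f -> lapW j r (fun x => c * f x) x = c * lapW j r f x.
Proof.
move=> sf; elim: j r => [|j IH] r /=; first by rewrite (DwZ sf).
by rewrite mulr_sumr; apply: eq_bigr => i _.
Qed.

Lemma lapW0 f j r x : (forall s, size s = (size r + 2 * j)%N -> Dw s f x = 0) -> lapW j r f x = 0.
Proof.
elim: j r => [|j IH] r H /=; first by apply: H; rewrite muln0 addn0.
by apply: big1 => i _; apply: IH => s ss; apply: H; rewrite ss size_cat /=; lia.
Qed.

End IteratedLaplacian.

Section TaylorRemainder.
Context {R : realType} {n : nat}.
Implicit Types (f g : 'rV[R]_n -> R) (x : 'rV[R]_n) (s : seq 'I_n).

Definition remainder k f x : R := f x - taylor k f x.

Lemma smooth_taylor k f : smooth (taylor k f).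
Proof. exact: smooth_jet_poly. Qed.

Lemma smooth_remainder k f : smooth f -> smooth (remainder k f).
Proof. by move=> sf; exact: (smoothB sf (smooth_taylor k f)). Qed.

Lemma Dw_remainder k f s x : smooth f ->
  Dw s (remainder k f) x = Dw s f x - Dw s (taylor k f) x.
Proof. by move=> sf; rewrite /remainder (DwB s sf (smooth_taylor k f)). Qed.

Lemma Dw_remainder_big k f s x : smooth f -> (k <= size s)%N ->
  Dw s (remainder k f) x = Dw s f x.
Proof. by move=> sf ks; rewrite Dw_remainder // /taylor Dw_jet_poly_big // subr0. Qed.

Lemma remainderB k f g x : smooth f -> smooth g ->
  remainder k f x - remainder k g x = remainder k (fun x => f x - g x) x.
Proof.
move=> sf sg; rewrite /remainder /taylor.
have -> : jet_poly k (fun j b => Dw (word_of b) (fun x => f x - g x) 0) x =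
    jet_poly k (fun j b => Dw (word_of b) f 0) x - jet_poly k (fun j b => Dw (word_of b) g 0) x.
  rewrite /jet_poly -sumrB; apply: eq_bigr => j _; rewrite -sumrB; apply: eq_bigr => b _.
  by rewrite (DwB _ sf sg); ring.
ring.
Qed.

(** All derivatives of the remainder vanish at the origin, so the bound on the
top ones propagates downwards. *)
Lemma remainder_bound k f r M : smooth f -> partials_commute f -> 0 <= r -> n%:R * r <= 1 -> 0 <= M ->
  (forall s x, (size s).+1 = k -> `|x| <= r -> `|Dw s f x| <= M) ->
  forall s x, (size s < k)%N -> `|x| <= r -> `|Dw s (remainder k f) x| <= 2 * M.
Proof.
move=> sf cf r0 nr M0 H; have sR := smooth_remainder k sf.
suff main d s x : (size s + d).+1 = k -> `|x| <= r -> `|Dw s (remainder k f) x| <= 2 * M.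
  by move=> s x sk; apply: (main (k - (size s).+1)%N); lia.
elim: d s x => [|d IH] s x sk xr.
  rewrite addn0 in sk; rewrite Dw_remainder // Dw_taylor_top //.
  apply: le_trans (ler_normB _ _) _.
  have n0 : `|0 : 'rV[R]_n| <= r by rewrite normr0.
  by have := H s x sk xr; have := H s 0 sk n0; lra.
have R0 : Dw s (remainder k f) 0 = 0.
  rewrite Dw_remainder // Dw_taylor0 ?subrr //; lia.
rewrite -[Dw s _ x]subr0 -R0.
apply: (@le_trans _ _ (2 * M * \sum_(i < n) `|x ord0 i - (0 : 'rV[R]_n) ord0 i|)).
  apply: (mvt_box (df := fun i => Dw (i :: s) (remainder k f))) => z i hz.
    exact: (smoothP s z i sR).
  by apply: IH; [rewrite /= -sk; lia|apply: (hull_norm hz); rewrite ?normr0].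
rewrite -[leRHS]mulr1 ler_wpM2l ?mulr_ge0 //.
apply: le_trans (sum_coord_le_dist 0 x) _; rewrite sub0r normrN.
by apply: le_trans nr; rewrite ler_wpM2l.
Qed.

End TaylorRemainder.

(** * The equation at a fixed scale *)

(** A smooth [u] that solves the system on the cube of radius [rho] up to errors of size
[B e], with the initial jet of [P].  The error [e] goes to 0 with the scale while [B] and
[rho] stay; so these bounds survive in the limit, where [ax_modulus] becomes Hoelder
continuity. *)
Record approx {R : realType} {n N m : nat} (alpha : R)
    (at_ : 'I_N -> 'rV[R]_(n + jet_size n N (2 * m)) -> R)
    (p0 : 'rV[R]_(n + jet_size n N (2 * m))) (P : 'I_N -> 'rV[R]_n -> R)
    (rho B e : R) (u : 'rV[R]_n -> 'rV[R]_N) : Prop := Approx {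
  ax_smooth : forall l, smooth (component u l);
  ax_jet0 : forall l s, (size s < 2 * m)%N -> Dw s (component u l) 0 = Dw s (P l) 0;
  ax_bound : forall l s x, (size s <= 2 * m)%N -> `|x| <= 2 * rho ->
    `|Dw s (component u l) x| <= B;
  ax_modulus : forall l s x y, (size s <= 2 * m)%N -> `|x| <= 2 * rho -> `|y| <= 2 * rho ->
    `|Dw s (component u l) x - Dw s (component u l) y| <= B * (`|x - y| `^ alpha + e);
  ax_near : forall x, `|x| <= 2 * rho -> `|jet_point m u x - p0| <= B * rho;
  ax_equation : forall l x, `|x| <= rho ->
    `|iter m (@laplacian R n) (component u l) x - at_ l (jet_point m u x)| <= B * e;
  ax_top : forall l s, size s = (2 * m)%N ->
    `|Dw s (component u l) 0 - Dw s (P l) 0| <= B * (rho `^ 2^-1 + e)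
}.

Section DiscreteProblem.
Context {R : realType} {n N m : nat} {alpha : R}.
Variables (V : R -> 'rV[R]_n -> R) (C cphi : R).
Hypotheses (n0 : (0 < n)%N) (m0 : (0 < m)%N) (al01 : 0 < alpha < 1).
Hypotheses (C0 : 0 < C) (cphi0 : 0 < cphi) (gk : good_kernel m alpha V C cphi).
Variables (K : R) (K0 : 0 < K) (pb : pot_bounds m alpha V K).
Variables (La : R) (at_ : 'I_N -> 'rV[R]_(n + jet_size n N (2 * m)) -> R).
Variable p0 : 'rV[R]_(n + jet_size n N (2 * m)).
Hypotheses (La0 : 0 < La) (at_lip : forall l q q', `|at_ l q - at_ l q'| <= La * `|q - q'|).
Hypothesis at_bounded : forall l q, `|at_ l q - at_ l p0| <= La.
Variables (p : nat) (rho : R).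
Hypotheses (p4 : (4 <= p)%N) (er : eps p <= rho :> R) (rho01 : 0 < rho <= 16^-1).
Hypothesis nrho : n%:R * (2 * rho) <= 1.
Hypothesis contr_small : La * (2 * (K * rho `^ 2^-1)) <= 2^-1.
Implicit Types (F : 'I_N -> 'rV[R]_n -> R) (P : 'I_N -> 'rV[R]_n -> R) (x y : 'rV[R]_n).

(** The data sit in [P].  Without its Taylor polynomial the potential vanishes to order
[2m] at the origin, and its [m]-th Laplacian is unchanged. *)
Definition trial P F x : 'rV[R]_N := \row_l (P l x + remainder (2 * m) (pot m V p (F l)) x).

Lemma component_trial P F l :
  component (trial P F) l = fun x => P l x + remainder (2 * m) (pot m V p (F l)) x.
Proof. by apply/funext => x; rewrite /component mxE. Qed.

Let smp G : smooth (pot m V p G).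
Proof. exact: (smooth_pot gk). Qed.

Let cmp G : partials_commute (pot m V p G).
Proof. exact: (commute_pot gk). Qed.

Lemma smooth_trial P F l : smooth (P l) -> smooth (component (trial P F) l).
Proof. by move=> sP; rewrite component_trial; exact: (smoothD sP (smooth_remainder _ (smp _))). Qed.

Lemma Dw_trial P F l s x : smooth (P l) -> Dw s (component (trial P F) l) x =
  Dw s (P l) x + Dw s (remainder (2 * m) (pot m V p (F l))) x.
Proof. by move=> sP; rewrite component_trial (DwD sP (smooth_remainder _ (smp _))). Qed.

Lemma trial_diff P P' F F' l s x : smooth (P l) -> smooth (P' l) ->
  Dw s (component (trial P F) l) x - Dw s (component (trial P' F') l) x =
  (Dw s (P l) x - Dw s (P' l) x) +
  Dw s (remainder (2 * m) (pot m V p (fun y => F l y - F' l y))) x.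
Proof.
move=> sP sP'; rewrite !Dw_trial //.
have -> : remainder (2 * m) (pot m V p (fun y => F l y - F' l y)) =
    fun x => remainder (2 * m) (pot m V p (F l)) x - remainder (2 * m) (pot m V p (F' l)) x.
  apply/funext => z; rewrite remainderB; [|exact: smp|exact: smp].
  congr (remainder _ _ z); apply/funext => y; rewrite /pot convB.
  by congr (conv _ _ _ y); apply/funext => t; ring.
rewrite (DwB s (smooth_remainder _ (smp _)) (smooth_remainder _ (smp _))); ring.
Qed.

(** Derivatives of order less than [2m] see only the size of the density, with a small
factor: this is what makes the discrete equation a contraction. *)
Lemma low_bound G A s x : 0 <= A -> (forall y, 2 * rho <= `|y| -> G y = 0) ->
  (forall y, `|G y| <= A) -> (size s < 2 * m)%N -> `|x| <= 2 * rho ->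
  `|Dw s (remainder (2 * m) (pot m V p G)) x| <= 2 * (K * rho `^ 2^-1 * A).
Proof.
move=> A0 GS GA sm xr; have /andP[r0 _] := rho01.
apply: (remainder_bound (r := 2 * rho)) => //.
- by rewrite mulr_ge0 // ltW.
- by rewrite !mulr_ge0 ?powR_ge0 // ltW.
- by move=> t y ts yr; apply: (pb_low pb (rho := rho)).
Qed.

(** The values of a density outside the cube do not matter for a solution, but must be
removed before the contraction estimate applies to an arbitrary iterate. *)
Definition restr F l y : R := if `|y| < 2 * rho then F l y else 0.

(** The value at [p0] is subtracted because the [m]-th Laplacian of [P] accounts for it;
the difference is small on small cubes. *)
Definition rhs P F l y : R :=
  cutoff rho y * (at_ l (jet_point m (trial P F) y) - at_ l p0).

Lemma rhs_support P F l y : 2 * rho <= `|y| -> rhs P F l y = 0.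
Proof. by move=> yr; rewrite /rhs cutoff0 ?mul0r //; case/andP: rho01. Qed.

Lemma rhs_bound P F l y : `|rhs P F l y| <= La.
Proof.
have /andP[c0 c1] := cutoff01 rho y.
by rewrite /rhs normrM (ger0_norm c0) -[leRHS]mul1r; apply: ler_pM.
Qed.

(** Two trial functions whose densities differ by at most [B] have jets that differ by at
most [B / (2 La)] plus what their polynomial parts contribute. *)
Lemma rhs_diff P P' F F' B E : (forall l, smooth (P l)) -> (forall l, smooth (P' l)) ->
  0 <= B -> 0 <= E ->
  (forall l s x, (size s < 2 * m)%N -> `|x| <= 2 * rho -> `|Dw s (P l) x - Dw s (P' l) x| <= E) ->
  (forall l y, 2 * rho <= `|y| -> F l y = 0) -> (forall l y, 2 * rho <= `|y| -> F' l y = 0) ->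
  (forall l y, `|F l y - F' l y| <= B) ->
  forall l y, `|rhs P F l y - rhs P' F' l y| <= La * E + B / 2.
Proof.
move=> sP sP' B0 E0 HE FS FS' FB l y.
have /andP[r0 r1] := rho01.
have R0 : 0 <= La * E + B / 2 by rewrite addr_ge0 ?mulr_ge0 ?(ltW La0) // divr_ge0.
have [yr|yr] := leP (2 * rho) `|y|; first by rewrite !rhs_support // subrr normr0.
rewrite /rhs -mulrBr normrM.
have /andP[c0 c1] := cutoff01 rho y.
rewrite (ger0_norm c0) -[leRHS]mul1r; apply: ler_pM => //.
have -> : at_ l (jet_point m (trial P F) y) - at_ l p0 -
   (at_ l (jet_point m (trial P' F') y) - at_ l p0) =
   at_ l (jet_point m (trial P F) y) - at_ l (jet_point m (trial P' F') y) by ring.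
apply: le_trans (at_lip _ _ _) _.
have M0 : 0 <= 2 * (K * rho `^ 2^-1 * B) by rewrite !mulr_ge0 ?powR_ge0 // ltW.
apply: (@le_trans _ _ (La * (E + 2 * (K * rho `^ 2^-1 * B)))).
  rewrite ler_wpM2l ?(ltW La0) //; apply: jet_point_dist; first exact: addr_ge0.
    by rewrite subrr normr0 addr_ge0.
  move=> s k sm; rewrite trial_diff //; apply: le_trans (ler_normD _ _) _; apply: lerD.
    by apply: HE => //; apply: ltW.
  apply: low_bound => // [z zr|]; last exact: ltW.
  by rewrite FS // FS' // subrr.
rewrite mulrDr lerD2l.
have -> : La * (2 * (K * rho `^ 2^-1 * B)) = La * (2 * (K * rho `^ 2^-1)) * B by ring.
by rewrite [leRHS]mulrC ler_wpM2r.
Qed.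

(** The equation [F = rhs P F] is one for densities rather than for solutions, and in the
sup norm, as [rhs] depends on derivatives of order less than [2m] only. *)
Lemma density_exists P : (forall l, smooth (P l)) ->
  exists F, forall l y, F l y = rhs P F l y.
Proof.
move=> sP; have /andP[r0 r1] := rho01.
pose uncurry (X : 'I_N * 'rV[R]_n -> R) : 'I_N -> 'rV[R]_n -> R := fun l y => X (l, y).
have [||X HX] := @picard R ('I_N * 'rV[R]_n)%type
  (fun X t => rhs P (restr (uncurry X)) t.1 t.2) La (ltW La0); last first.
  exists (uncurry X) => l y; rewrite {1}/uncurry HX /=.
  suff -> : restr (uncurry X) = uncurry X by [].
  apply/funext => k; apply/funext => z; rewrite /restr; case: ltP => // zr.
  by rewrite /uncurry HX /= rhs_support.
- by move=> t; apply: rhs_bound.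
move=> X Y B B0 HB [l y] /=.
have := @rhs_diff P P (restr (uncurry X)) (restr (uncurry Y)) B 0 sP sP B0 (lexx 0).
rewrite mulr0 add0r; apply.
- by move=> k s x _ _; rewrite subrr normr0.
- by move=> k z zr; rewrite /restr ltNge zr.
- by move=> k z zr; rewrite /restr ltNge zr.
- by move=> k z; rewrite /restr; case: ifP => _; [apply: HB|rewrite subrr normr0].
Qed.

(** Each use of [rhs_diff] halves what exceeds [2 La E] in a bound for the difference. *)
Lemma density_diff P P' F F' E : (forall l, smooth (P l)) -> (forall l, smooth (P' l)) -> 0 <= E ->
  (forall l s x, (size s < 2 * m)%N -> `|x| <= 2 * rho -> `|Dw s (P l) x - Dw s (P' l) x| <= E) ->
  (forall l y, F l y = rhs P F l y) -> (forall l y, F' l y = rhs P' F' l y) ->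
  forall l y, `|F l y - F' l y| <= 2 * La * E.
Proof.
move=> sP sP' E0 HE HF HF'.
have FS l y : 2 * rho <= `|y| -> F l y = 0 by move=> yr; rewrite HF rhs_support.
have FS' l y : 2 * rho <= `|y| -> F' l y = 0 by move=> yr; rewrite HF' rhs_support.
have LE : 0 <= 2 * La * E by rewrite !mulr_ge0 // ltW.
have main k l y : `|F l y - F' l y| <= 2 * La * E + 2 * La * 2^-1 ^+ k.
  elim: k l y => [|k IH] l y.
    apply: le_trans (ler_normB _ _) _; rewrite HF HF' expr0.
    by have := rhs_bound P F l y; have := rhs_bound P' F' l y; lra.
  have B0 : 0 <= 2 * La * E + 2 * La * 2^-1 ^+ k.
    by rewrite addr_ge0 // !mulr_ge0 ?exprn_ge0 ?invr_ge0 // ltW.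
  rewrite HF HF'; apply: le_trans (rhs_diff sP sP' B0 E0 HE FS FS' IH l y) _.
  by rewrite exprSr; move: (2^-1 ^+ k) => q; lra.
move=> l y; apply/ler_addgt0Pr => e e0.
have [k Hk] := half_pow_small (2 * La) e0.
by apply: le_trans (main k l y) _; rewrite lerD2l.
Qed.

Section Solution.
Variables (P : 'I_N -> 'rV[R]_n -> R) (F : 'I_N -> 'rV[R]_n -> R) (CP : R).
Hypothesis sP : forall l, smooth (P l).
Hypothesis HF : forall l y, F l y = rhs P F l y.
Hypothesis CP0 : 0 <= CP.
Hypothesis PB : forall l s x, (size s <= 2 * m)%N -> `|x| <= 1 -> `|Dw s (P l) x| <= CP.
Hypothesis P0 : jet_point m (fun x => \row_l P l x) 0 = p0.
Hypothesis theta_small : 3 * La * n%:R * (K * rho `^ 2^-1) <= 2^-1.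

Let u := trial P F.

Let FS l y : 2 * rho <= `|y| -> F l y = 0.
Proof. by move=> yr; rewrite HF rhs_support. Qed.

Let FB l y : `|F l y| <= La.
Proof. by rewrite HF rhs_bound. Qed.

Lemma trial_jet0 s l : (size s < 2 * m)%N -> Dw s (component u l) 0 = Dw s (P l) 0.
Proof.
move=> sm; rewrite Dw_trial // Dw_remainder; last exact: smp.
by rewrite Dw_taylor0 ?subrr ?addr0 //; apply: cmp.
Qed.

Lemma trial_point0 : jet_point m u 0 = p0.
Proof.
rewrite -P0; apply/eqP; rewrite -subr_eq0 -normr_le0.
apply: jet_point_dist => // [|s l sm]; first by rewrite subrr normr0.
have -> : component (fun x => \row_l P l x) l = P l by apply/funext => x; rewrite /component mxE.
by rewrite trial_jet0 // subrr normr0.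
Qed.

Lemma trial_top s l x : size s = (2 * m)%N ->
  Dw s (component u l) x = Dw s (P l) x + Dw s (pot m V p (F l)) x.
Proof. by move=> sm; rewrite Dw_trial // Dw_remainder_big ?sm //; apply: smp. Qed.

Section Bounded.
Variables (beta : R).
Hypothesis topB : forall l s x, size s = (2 * m)%N -> `|x| <= 2 * rho ->
  `|Dw s (pot m V p (F l)) x| <= beta.
Hypothesis beta0 : 0 <= beta.

Let B1 := CP + 1 + beta.

Lemma trial_bound l s x : (size s <= 2 * m)%N -> `|x| <= 2 * rho -> `|Dw s (component u l) x| <= B1.
Proof.
move=> sm xr; have /andP[r0 r1] := rho01; have x1 : `|x| <= 1 by lra.
have PBx := PB l sm x1.
have [sm'|sm'] := ltnP (size s) (2 * m).
  rewrite Dw_trial //; apply: le_trans (ler_normD _ _) _.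
  have low := low_bound (ltW La0) (FS l) (FB l) sm' xr.
  have : 2 * (K * rho `^ 2^-1 * La) <= 1.
    have -> : 2 * (K * rho `^ 2^-1 * La) = La * (2 * (K * rho `^ 2^-1)) by ring.
    by apply: le_trans contr_small _; lra.
  by have := beta0; move: low PBx; rewrite /B1; lra.
have ss : size s = (2 * m)%N by apply/eqP; rewrite eqn_leq sm sm'.
rewrite trial_top //; apply: le_trans (ler_normD _ _) _.
by have := topB l ss xr; rewrite /B1; lra.
Qed.

Lemma trial_dist l s x y : (size s < 2 * m)%N -> `|x| <= 2 * rho -> `|y| <= 2 * rho ->
  `|Dw s (component u l) x - Dw s (component u l) y| <= n%:R * B1 * `|x - y|.
Proof.
move=> sm xr yr; have su := smooth_trial F (sP l).
have B10 : 0 <= B1 by rewrite !addr_ge0.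
apply: (@le_trans _ _ (B1 * \sum_(i < n) `|x ord0 i - y ord0 i|)).
  apply: (mvt_box (df := fun i => Dw (i :: s) (component u l))) => z i hz.
    exact: (smoothP s z i su).
  by apply: trial_bound => //; apply: (hull_norm hz).
rewrite [n%:R * _]mulrC -mulrA ler_wpM2l //; apply: le_trans (sum_coord_le_dist y x) _.
by rewrite distrC.
Qed.

Lemma jet_lip x y : `|x| <= 2 * rho -> `|y| <= 2 * rho ->
  `|jet_point m u x - jet_point m u y| <= (1 + n%:R * B1) * `|x - y|.
Proof.
move=> xr yr; have B10 : 0 <= n%:R * B1 by rewrite mulr_ge0 // !addr_ge0.
apply: jet_point_dist; first by rewrite mulr_ge0 // addr_ge0.
  by rewrite mulrDl mul1r lerDl mulr_ge0.
move=> s l sm; apply: le_trans (trial_dist l sm xr yr) _.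
by rewrite ler_wpM2r // lerDr.
Qed.

Lemma jet_near x : `|x| <= 2 * rho -> `|jet_point m u x - p0| <= (1 + n%:R * B1) * (2 * rho).
Proof.
move=> xr; rewrite -trial_point0.
have B10 : 0 <= 1 + n%:R * B1 by rewrite addr_ge0 // mulr_ge0 // !addr_ge0.
have z0 : `|0 : 'rV[R]_n| <= 2 * rho by rewrite normr0; apply: le_trans xr.
by apply: le_trans (jet_lip xr z0) _; rewrite subr0 ler_wpM2l.
Qed.

(** The density is a cutoff, of Lipschitz constant [1 / rho], times a function that is at
most of order [rho] on the cube: the product rule gives a constant without [1 / rho]. *)
Lemma density_lip l y z : `|F l y - F l z| <= 3 * La * (1 + n%:R * B1) * `|y - z|.
Proof.
have /andP[r0 r1] := rho01.
have B10 : 0 <= 1 + n%:R * B1 by rewrite addr_ge0 // mulr_ge0 // !addr_ge0.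
have LB0 : 0 <= La * (1 + n%:R * B1) by rewrite mulr_ge0 // ltW.
have gnear w : `|w| <= 2 * rho -> `|at_ l (jet_point m u w) - at_ l p0| <= La * (1 + n%:R * B1) * (2 * rho).
  move=> wr; apply: le_trans (at_lip _ _ _) _; rewrite -mulrA ler_wpM2l ?(ltW La0) //.
  exact: jet_near.
have clip w w' : `|w| <= 2 * rho ->
    `|(cutoff rho w - cutoff rho w') * (at_ l (jet_point m u w) - at_ l p0)| <=
    2 * La * (1 + n%:R * B1) * `|w - w'|.
  move=> wr; rewrite normrM.
  apply: le_trans (ler_pM _ _ (cutoff_lip w w' r0) (gnear w wr)) _ => //.
  apply: eqr_le; field; exact: lt0r_neq0.
wlog yz : y z / `|y| <= `|z|.
  move=> H; have [h|h] := leP `|y| `|z|; first exact: H.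
  by rewrite distrC (distrC y); apply: H; apply: ltW.
have D0 : 0 <= La * (1 + n%:R * B1) * `|y - z| by rewrite mulr_ge0.
have [yr|yr] := leP `|y| (2 * rho); last first.
  rewrite !FS ?subrr ?normr0 ?mulr_ge0 //; try exact: ltW.
  by apply: ltW; apply: lt_le_trans yz.
have E : F l y - F l z =
   (cutoff rho y - cutoff rho z) * (at_ l (jet_point m u y) - at_ l p0) +
   cutoff rho z * (at_ l (jet_point m u y) - at_ l (jet_point m u z)).
  by rewrite !HF /rhs -/u; ring.
rewrite E; apply: le_trans (ler_normD _ _) _.
have := clip y z yr.
suff : `|cutoff rho z * (at_ l (jet_point m u y) - at_ l (jet_point m u z))| <=
    La * (1 + n%:R * B1) * `|y - z| by lra.
have [zr|zr] := leP `|z| (2 * rho); last first.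
  by rewrite cutoff0 ?mul0r ?normr0 // ltW.
have /andP[c0 c1] := cutoff01 rho z.
rewrite normrM (ger0_norm c0) -[leRHS]mul1r; apply: ler_pM => //.
apply: le_trans (at_lip _ _ _) _; rewrite -mulrA ler_wpM2l ?(ltW La0) //.
exact: jet_lip.
Qed.

End Bounded.

Definition lip_base : R := 3 * La * (1 + n%:R * (CP + 1 + K * La)).
Definition lip_const : R := 2 * lip_base + 1.

Lemma lip_base_ge0 : 0 <= lip_base.
Proof.
have KL : 0 <= K * La by rewrite mulr_ge0 // ltW.
by rewrite !mulr_ge0 ?(ltW La0) // addr_ge0 // mulr_ge0 // !addr_ge0.
Qed.

Lemma eps_half_le1 : eps p `^ 2^-1 <= 1 :> R.
Proof.
have e0 : 0 < eps p :> R := eps_gt0 p4.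
have e1 : eps p <= 4^-1 :> R := eps_le p4.
apply: (@le_trans _ _ (1 `^ 2^-1)); last by rewrite powR1.
by apply: ge0_ler_powR; rewrite ?nnegrE ?invr_ge0 ?(ltW e0) //; lra.
Qed.

(** A Lipschitz constant [L] of the density improves to [lip_base + L / 2], since the
derivatives of order [2m] of the potential are at most [K rho^(1/2) L] plus constants. *)
Lemma density_lip_improve L : 0 <= L ->
  (forall l y z, `|F l y - F l z| <= L * `|y - z|) ->
  forall l y z, `|F l y - F l z| <= (lip_base + L / 2) * `|y - z|.
Proof.
move=> L0 FL l y z.
have KL : 0 <= K * La by rewrite mulr_ge0 // ltW.
have b0 : 0 <= K * (rho `^ 2^-1 * L) + K * La.
  by rewrite addr_ge0 // !mulr_ge0 ?powR_ge0 // ltW.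
have top k s x : size s = (2 * m)%N -> `|x| <= 2 * rho ->
    `|Dw s (pot m V p (F k)) x| <= K * (rho `^ 2^-1 * L) + K * La.
  move=> ss xr.
  apply: le_trans (pb_top pb p4 rho01 er ss xr (ltW La0) L0 (FS k) (FB k) (FL k)) _.
  rewrite mulrDr lerD2l ler_wpM2l ?(ltW K0) // -[leRHS]mul1r ler_wpM2r ?(ltW La0) //.
  exact: eps_half_le1.
apply: le_trans (density_lip top b0 l y z) _; rewrite ler_wpM2r // /lip_base.
have -> : 3 * La * (1 + n%:R * (CP + 1 + (K * (rho `^ 2^-1 * L) + K * La))) =
  3 * La * (1 + n%:R * (CP + 1 + K * La)) + 3 * La * n%:R * (K * rho `^ 2^-1) * L by ring.
by rewrite lerD2l [leRHS]mulrC ler_wpM2r.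
Qed.

(** The crude bound starts the improvement with a constant that depends on the scale; the
iteration forgets it. *)
Lemma density_lipschitz l y z : `|F l y - F l z| <= lip_const * `|y - z|.
Proof.
have e0 : 0 < eps p :> R := eps_gt0 p4.
have /andP[r0 r1] := rho01.
have b0 : 0 <= K * eps p `^ (- 2^-1) * La by rewrite !mulr_ge0 ?powR_ge0 // ltW.
pose L0 := 3 * La * (1 + n%:R * (CP + 1 + K * eps p `^ (- 2^-1) * La)).
have L00 : 0 <= L0.
  by rewrite !mulr_ge0 ?(ltW La0) // addr_ge0 // mulr_ge0 // !addr_ge0.
have base k x w : `|F k x - F k w| <= L0 * `|x - w|.
  apply: density_lip => // k' s t ss tr; apply: (pb_crude pb) => //.
    by apply: le_trans tr _; lra.
  exact: ltW.
have lb := lip_base_ge0.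
have main j : forall k x w, `|F k x - F k w| <= (2 * lip_base + L0 * 2^-1 ^+ j) * `|x - w|.
  elim: j => [|j IH] k x w.
    apply: le_trans (base k x w) _; rewrite ler_wpM2r // expr0 mulr1; lra.
  have c0 : 0 <= 2 * lip_base + L0 * 2^-1 ^+ j.
    by apply: addr_ge0; apply: mulr_ge0 => //; rewrite exprn_ge0 ?invr_ge0.
  apply: le_trans (density_lip_improve c0 IH k x w) _; rewrite ler_wpM2r // exprSr.
  by move: (2^-1 ^+ j) => q; lra.
have [j Hj] := half_pow_small L0 (ltr01 : 0 < 1 :> R).
apply: le_trans (main j l y z) _; rewrite ler_wpM2r // /lip_const; lra.
Qed.

Hypothesis P_top : forall l s x, size s = (2 * m)%N -> Dw s (P l) x = Dw s (P l) 0.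
Hypothesis P_lap : forall l x, iter m (@laplacian R n) (P l) x = at_ l p0.

Definition approx_const : R :=
  2 * (1 + n%:R) * (1 + (CP + 1 + K * (lip_const + La))).

Lemma trial_approx : approx alpha at_ p0 P rho approx_const (eps p `^ 2^-1) u.
Proof.
have /andP[a0 a1] := al01; have /andP[r0 r1] := rho01.
have e0 : 0 < eps p :> R := eps_gt0 p4.
have sp l : smooth (pot m V p (F l)) by exact: smp.
have L0 : 0 <= lip_const by have := lip_base_ge0; rewrite /lip_const; lra.
have KL : 0 <= K * (lip_const + La).
  by apply: mulr_ge0; [exact: ltW|apply: addr_ge0 => //; exact: ltW].
have eh := eps_half_le1; have eh0 : 0 <= eps p `^ 2^-1 :> R by exact: powR_ge0.
have rh0 : 0 <= rho `^ 2^-1 by exact: powR_ge0.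
have rh1 : rho `^ 2^-1 <= 1.
  apply: (@le_trans _ _ (1 `^ 2^-1)); last by rewrite powR1.
  by apply: ge0_ler_powR; rewrite ?nnegrE ?invr_ge0 ?(ltW r0) //; lra.
set beta := K * (lip_const + La) in KL.
pose B1 := CP + 1 + beta.
have B1_ge1 : 1 <= B1 by rewrite /B1; have := CP0; lra.
have n_ge0 : 0 <= n%:R :> R by [].
have nB0 : 0 <= n%:R * B1 by rewrite mulr_ge0 //; lra.
have BE : approx_const = 2 * (1 + n%:R) * (1 + B1) by [].
have B_ge : 2 * (1 + n%:R * B1) + B1 + beta <= approx_const.
  rewrite BE /B1; have := CP0; nra.
have top_sharp l s x : size s = (2 * m)%N -> `|x| <= 2 * rho ->
    `|Dw s (pot m V p (F l)) x| <= K * (rho `^ 2^-1 * lip_const + eps p `^ 2^-1 * La).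
  move=> ss xr.
  exact: (pb_top pb p4 rho01 er ss xr (ltW La0) L0 (FS l) (FB l) (@density_lipschitz l)).
have top l s x : size s = (2 * m)%N -> `|x| <= 2 * rho -> `|Dw s (pot m V p (F l)) x| <= beta.
  move=> ss xr; apply: le_trans (top_sharp l s x ss xr) _; rewrite ler_wpM2l ?(ltW K0) //.
  by apply: lerD; rewrite -[leRHS]mul1r ler_wpM2r // ltW.
split.
- by move=> l; apply: smooth_trial.
- by move=> l s sm; apply: trial_jet0.
- move=> l s x sm xr; apply: le_trans (trial_bound top KL l sm xr) _.
  by rewrite -/B1; lra.
- move=> l s x y sm xr yr.
  have d1 : `|x - y| <= 1.
    by apply: le_trans (ler_normB _ _) _; lra.
  have dal : `|x - y| <= `|x - y| `^ alpha.
    have [->|dn0] := eqVneq `|x - y| 0; first by rewrite powR_ge0.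
    by apply: ger1_powR; rewrite ?(ltW a1) // d1 lt_def dn0 normr_ge0.
  have d0 := powR_ge0 `|x - y| alpha.
  have [sm'|sm'] := ltnP (size s) (2 * m).
    apply: le_trans (trial_dist top KL l sm' xr yr) _; rewrite -/B1.
    apply: (@le_trans _ _ (n%:R * B1 * (`|x - y| `^ alpha + eps p `^ 2^-1))).
      rewrite ler_wpM2l //; lra.
    rewrite ler_wpM2r ?addr_ge0 //; lra.
  have ss : size s = (2 * m)%N by apply/eqP; rewrite eqn_leq sm sm'.
  rewrite !trial_top // (P_top _ x ss) (P_top _ y ss) opprD addrACA subrr add0r.
  apply: le_trans (pb_holder pb p4 rho01 er ss xr yr (ltW La0) L0 (FS l) (FB l) (@density_lipschitz l)) _.
  apply: (@le_trans _ _ (beta * (`|x - y| `^ alpha + eps p `^ 2^-1))).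
    rewrite /beta -mulrA ler_wpM2l ?(ltW K0) // [leRHS]mulrDr [X in _ <= _ + X]mulrC.
    apply: lerD; first by rewrite ler_wpM2r // lerDl ltW.
    by rewrite ler_wpM2l // lerDr.
  rewrite ler_wpM2r ?addr_ge0 //; lra.
- move=> x xr; apply: le_trans (jet_near top KL xr) _; rewrite -/B1 mulrCA mulrA.
  rewrite ler_wpM2r ?(ltW r0) //; lra.
- move=> l x xr; have xr2 : `|x| <= 2 * rho by lra.
  have -> : iter m (@laplacian R n) (component u l) x =
      at_ l p0 + iter m (@laplacian R n) (pot m V p (F l)) x.
    rewrite -(P_lap l x) !iter_laplacian_smooth //; last by apply: smooth_trial.
    rewrite component_trial lapWD //; last exact: (smooth_remainder _ (sp l)).
    rewrite /remainder lapWB // ?(@lapW0 _ _ (taylor _ _)) ?subr0 //.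
      by move=> s ss; rewrite /taylor Dw_jet_poly_big // ss.
    exact: smooth_taylor.
  have -> : at_ l (jet_point m u x) = at_ l p0 + F l x.
    by rewrite HF /rhs cutoff1 // mul1r -/u addrC subrK.
  rewrite opprD addrACA subrr add0r.
  apply: le_trans (pb_lap pb p4 rho01 xr2 (ltW La0) L0 (FS l) (FB l) (@density_lipschitz l)) _.
  rewrite -/beta ler_wpM2r //; lra.
- move=> l s ss; rewrite trial_top // addrAC subrr add0r.
  have z0 : `|0 : 'rV[R]_n| <= 2 * rho by rewrite normr0; lra.
  apply: le_trans (top_sharp l s 0 ss z0) _.
  apply: (@le_trans _ _ (beta * (rho `^ 2^-1 + eps p `^ 2^-1))).
    rewrite /beta -mulrA ler_wpM2l ?(ltW K0) // [leRHS]mulrDr.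
    rewrite [_ * lip_const]mulrC [_ * La]mulrC.
    by apply: lerD; rewrite ler_wpM2r // ?lerDl ?lerDr // ltW.
  rewrite ler_wpM2r ?addr_ge0 //; lra.
Qed.

End Solution.

(** Two solutions differ like their polynomials up to a factor [rho^(1/2)], because the
potential part depends on the polynomial part with that factor. *)
Lemma trial_separation P P' F F' E : (forall l, smooth (P l)) -> (forall l, smooth (P' l)) -> 0 <= E ->
  (forall l s x, (size s < 2 * m)%N -> `|x| <= 2 * rho -> `|Dw s (P l) x - Dw s (P' l) x| <= E) ->
  (forall l y, F l y = rhs P F l y) -> (forall l y, F' l y = rhs P' F' l y) ->
  forall l s x, (size s < 2 * m)%N -> `|x| <= 2 * rho ->
  `|(Dw s (component (trial P F) l) x - Dw s (component (trial P' F') l) x) -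
    (Dw s (P l) x - Dw s (P' l) x)| <= 4 * K * La * rho `^ 2^-1 * E.
Proof.
move=> sP sP' E0 HE HF HF' l s x sm xr; rewrite trial_diff // addrAC subrr add0r.
have LE : 0 <= 2 * La * E by rewrite !mulr_ge0 // ltW.
have -> : 4 * K * La * rho `^ 2^-1 * E = 2 * (K * rho `^ 2^-1 * (2 * La * E)) by ring.
apply: low_bound => // y; last exact: (density_diff sP sP' E0 HE HF HF').
by move=> yr; rewrite HF HF' !rhs_support // subrr.
Qed.

End DiscreteProblem.

(** * The leading polynomials *)

Section PolynomialData.
Context {R : realType} {n : nat}.
Implicit Types (x : 'rV[R]_n) (s : seq 'I_n) (e : 'I_n -> nat).

Lemma Mon_factor_le (t r : R) k : `|t| <= r -> r <= 1 -> `|t ^+ k / k`!%:R| <= (if k == 0%N then 1 else r).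
Proof.
move=> tr r1; have f1 : (k`!%:R : R)^-1 <= 1.
  by rewrite invf_le1 ?ltr0n ?fact_gt0 // ler1n fact_gt0.
rewrite normrM (@ger0_norm _ (_^-1)) ?invr_ge0 // normrX.
have t1 := le_trans tr r1.
case: k f1 => [|k] f1 /=; first by rewrite expr0 mul1r.
rewrite -[leRHS]mulr1; apply: ler_pM => //; rewrite ?exprn_ge0 ?invr_ge0 //.
by rewrite exprS; apply: le_trans tr; rewrite -[leRHS]mulr1 ler_pM ?exprn_ge0 ?exprn_ile1.
Qed.

Lemma Mon_le1 e x : `|x| <= 1 -> `|Mon e x| <= 1.
Proof.
move=> x1; rewrite /Mon normr_prod; apply: prodr_ile1 => i _; rewrite normr_ge0 /=.
have := @Mon_factor_le (x ord0 i) 1 (e i) (le_trans (coord_le_norm x i) x1) (lexx 1).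
by rewrite if_same.
Qed.

Lemma Mon_le e x r : `|x| <= r -> r <= 1 -> (0 < \sum_i e i)%N -> `|Mon e x| <= r.
Proof.
move=> xr r1 e0.
have [i ei] : exists i, e i != 0%N.
  apply/existsP; rewrite -negb_forall; apply/negP => /forallP H.
  by move: e0; rewrite big1 // => i _; apply/eqP.
rewrite /Mon (bigD1 i) //= normrM -[leRHS]mulr1; apply: ler_pM => //.
  have := @Mon_factor_le (x ord0 i) r (e i) (le_trans (coord_le_norm x i) xr) r1.
  by rewrite (negPf ei).
rewrite normr_prod; apply: prodr_ile1 => j _; rewrite normr_ge0 /=.
have x1 := le_trans (le_trans (coord_le_norm x j) xr) r1.
by have := @Mon_factor_le (x ord0 j) 1 (e j) x1 (lexx 1); rewrite if_same.
Qed.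

Lemma Dw_Mon_le1 e s x : `|x| <= 1 -> `|Dw s (Mon e) x| <= 1.
Proof.
move=> x1; rewrite Dw_Mon normrM normr_nat.
by case: ebelow; rewrite ?mul1r ?mul0r ?Mon_le1.
Qed.

Lemma Dw_Mon_le e s x r : `|x| <= r -> 0 <= r <= 1 -> (size s < \sum_i e i)%N -> `|Dw s (Mon e) x| <= r.
Proof.
move=> xr /andP[r0 r1] se; rewrite Dw_Mon normrM normr_nat.
case: (boolP (ebelow _ _)) => /= [/forallP B|_]; last by rewrite mul0r.
rewrite mul1r; apply: Mon_le => //.
by rewrite sumnB // sum_count subn_gt0.
Qed.

Lemma Dw_jet_poly_bound k (c : forall j, multiindex n j -> R) s x : `|x| <= 1 ->
  `|Dw s (jet_poly k c) x| <= \sum_(j < k) \sum_(b : multiindex n j) `|c j b|.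
Proof.
move=> x1; rewrite Dw_jet_poly; apply: le_trans (ler_norm_sum _ _ _) _.
apply: ler_sum => j _; apply: le_trans (ler_norm_sum _ _ _) _; apply: ler_sum => b _.
by rewrite normrM -[leRHS]mulr1 ler_wpM2l // Dw_Mon_le1.
Qed.

Lemma word_of_multiindexK j (b : multiindex n j) : word_of (multiindex_of (word_of b)) = word_of b.
Proof.
rewrite /word_of; congr flatten; apply: eq_map => i.
by rewrite multiindex_ofE count_word_of.
Qed.

(** The exponents of [x_i^k / k!]. *)
Definition axis (i : 'I_n) k : 'I_n -> nat := fun j => if j == i then k else 0%N.

Lemma sum_axis i k : (\sum_j axis i k j = k)%N.
Proof.
by rewrite (bigD1 i) //= /axis eqxx big1 ?addn0 // => j /negPf ->.
Qed.

Lemma Mon_axis0 i x : Mon (axis i 0) x = 1.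
Proof. by rewrite /Mon big1 // => j _; rewrite /axis if_same expr0 fact0 divr1. Qed.

Lemma Mon_axis1 i x : Mon (axis i 1) x = x ord0 i.
Proof.
rewrite /Mon (bigD1 i) //= big1 ?mulr1; first by rewrite /axis eqxx expr1 divr1.
by move=> j /negPf ji; rewrite /axis ji expr0 fact0 divr1.
Qed.

Lemma count_nseq_axis i k j : count_mem j (nseq k i) = axis i k j.
Proof. by rewrite count_nseq /= /axis eq_sym; case: eqP; rewrite ?mul1n ?mul0n. Qed.

Lemma Dw_nseq_axis i k d x : Dw (nseq k i) (Mon (axis i (k + d))) x = Mon (axis i d) x.
Proof.
rewrite Dw_Mon; have -> : ebelow (fun j => count_mem j (nseq k i)) (axis i (k + d)).
  by apply/forallP => j; rewrite count_nseq_axis /axis; case: eqP => // _; rewrite leq_addr.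
rewrite mul1r; congr (Mon _ x); apply/funext => j; rewrite count_nseq_axis /axis.
by case: eqP => // _; rewrite addKn.
Qed.

Lemma Dw_nseq_axis_neq i i' k d x : i != i' -> (0 < k)%N -> Dw (nseq k i) (Mon (axis i' d)) x = 0.
Proof.
move=> ii' k0; rewrite Dw_Mon.
suff /negPf -> : ~~ ebelow (fun j => count_mem j (nseq k i)) (axis i' d) by rewrite mul0r.
apply/negP => /forallP /(_ i); rewrite count_nseq_axis /axis eqxx (negPf ii').
by case: k k0.
Qed.

Lemma laplacian_axis i k : laplacian (Mon (axis i k.+2)) = Mon (axis i k) :> ('rV[R]_n -> R).
Proof.
apply/funext => x; rewrite /laplacian (bigD1 i) //= big1 ?addr0 => [|j ji].
  by have := @Dw_nseq_axis i 2 k x.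
by have := @Dw_nseq_axis_neq j i 2 k.+2 x ji isT.
Qed.

Lemma iter_laplacian_axis i m x : iter m (@laplacian R n) (Mon (axis i (2 * m))) x = 1.
Proof.
suff -> : iter m (@laplacian R n) (Mon (axis i (2 * m))) = Mon (axis i 0) by rewrite Mon_axis0.
elim: m => [//|m IH]; rewrite iterSr mulnS.
by rewrite -[(2 + 2 * m)%N]/((2 * m).+2) laplacian_axis.
Qed.

Lemma smooth_axis i k : smooth (Mon (axis i k) : 'rV[R]_n -> R).
Proof. exact: smooth_Mon. Qed.

End PolynomialData.

Section Family.
Context {R : realType} {n N m : nat}.
Variables (f : 'I_N -> 'rV[R]_n -> R) (a0 : 'I_N -> R) (i1 i2 : 'I_n).
Hypotheses (i12 : i1 != i2) (m0 : (0 < m)%N).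
Implicit Types (lam mu : R) (x : 'rV[R]_n) (s : seq 'I_n).

(** The Taylor polynomials of the data, a monomial that gives the [m]-th Laplacian
its value at the origin, and [lam] times the polyharmonic polynomial
[(x_1^(2m) - x_2^(2m)) / (2m)!]. *)
Definition leading lam l x : R :=
  taylor (2 * m) (f l) x +
  ((a0 l + lam) * Mon (axis i1 (2 * m)) x - lam * Mon (axis i2 (2 * m)) x).

Let sM c i : smooth (fun x : 'rV[R]_n => c * Mon (axis i (2 * m)) x).
Proof. exact: (smoothZ (smooth_axis i (2 * m)) c). Qed.

Let sT l : smooth (taylor (2 * m) (f l)).
Proof. exact: smooth_taylor. Qed.

Lemma smooth_leading lam l : smooth (leading lam l).
Proof. exact: (smoothD (sT l) (smoothB (sM _ i1) (sM _ i2))). Qed.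

Lemma Dw_leading lam l s x : Dw s (leading lam l) x = Dw s (taylor (2 * m) (f l)) x +
  ((a0 l + lam) * Dw s (Mon (axis i1 (2 * m))) x - lam * Dw s (Mon (axis i2 (2 * m))) x).
Proof.
rewrite /leading (DwD (sT l) (smoothB (sM _ i1) (sM _ i2))) (DwB s (sM _ i1) (sM _ i2)).
by rewrite !(DwZ (smooth_axis _ _)).
Qed.

Lemma leading_jet0 lam l s : (size s < 2 * m)%N ->
  Dw s (leading lam l) 0 = Dw (word_of (multiindex_of s)) (f l) 0.
Proof.
move=> sm; rewrite Dw_leading /taylor Dw_jet_poly0 //.
have Z i : Dw s (Mon (axis i (2 * m))) 0 = 0 :> R.
  have z : `|0 : 'rV[R]_n| <= 0 by rewrite normr0.
  apply/eqP; rewrite -normr_le0; apply: (Dw_Mon_le z); rewrite ?lexx ?ler01 //.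
  by rewrite sum_axis.
by rewrite !Z !mulr0 subrr addr0.
Qed.

Lemma leading_top lam l s x : size s = (2 * m)%N ->
  Dw s (leading lam l) x = Dw s (leading lam l) 0.
Proof.
move=> ss; rewrite !Dw_leading /taylor !Dw_jet_poly_big ?ss //.
by rewrite !Dw_Mon_eq // ss sum_axis.
Qed.

(** This number would be 0 for a radial function; a large [lam] makes it large. *)
Lemma leading_diag lam l : Dw (nseq (2 * m) i1) (leading lam l) 0 -
  Dw (nseq (2 * m) i2) (leading lam l) 0 = a0 l + 2 * lam.
Proof.
have m2 : (0 < 2 * m)%N by lia.
rewrite !Dw_leading /taylor !Dw_jet_poly_big ?size_nseq //.
have E i : Dw (nseq (2 * m) i) (Mon (axis i (2 * m))) 0 = 1 :> R.
  by rewrite -{2}[(2 * m)%N]addn0 Dw_nseq_axis Mon_axis0.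
rewrite !E !Dw_nseq_axis_neq //; last by rewrite eq_sym.
by ring.
Qed.

Lemma leading_lap lam l x : iter m (@laplacian R n) (leading lam l) x = a0 l.
Proof.
have sD := smoothB (sM (a0 l + lam) i1) (sM lam i2).
rewrite (iter_laplacian_smooth _ _ (smooth_leading lam l)) /leading.
rewrite (lapWD _ _ _ (sT l) sD) (lapWB _ _ _ (sM (a0 l + lam) i1) (sM lam i2)).
rewrite lapW0 => [|s ss]; last by rewrite /taylor Dw_jet_poly_big // ss.
have E c i : lapW m [::] (fun x : 'rV[R]_n => c * Mon (axis i (2 * m)) x) x = c.
  rewrite (lapWZ _ _ _ _ (smooth_axis i _)).
  by rewrite -iter_laplacian_smooth ?iter_laplacian_axis ?mulr1 //; apply: smooth_axis.
by rewrite !E; ring.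
Qed.

Lemma leading_bound (L0 : R) : exists2 CP, 0 <= CP & forall lam l s x,
  `|lam| <= L0 -> `|x| <= 1 -> `|Dw s (leading lam l) x| <= CP.
Proof.
pose c l j (b : multiindex n j) := Dw (word_of b) (f l) 0.
pose B l := \sum_(j < (2 * m)%N) \sum_(b : multiindex n j) `|c l j b|.
have B0 l : 0 <= B l by apply: sumr_ge0 => j _; apply: sumr_ge0.
have S0 : 0 <= \sum_l (B l + `|a0 l|) by apply: sumr_ge0 => l _; rewrite addr_ge0.
exists (\sum_l (B l + `|a0 l|) + 2 * `|L0|); first by rewrite addr_ge0 // mulr_ge0.
move=> lam l s x lamL x1; rewrite Dw_leading.
have H1 := @Dw_jet_poly_bound R n (2 * m) (c l) s x x1.
have H2 : B l + `|a0 l| <= \sum_l (B l + `|a0 l|).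
  by rewrite (bigD1 l) //= lerDl sumr_ge0 // => k _; rewrite addr_ge0.
have lam' : `|lam| <= `|L0| by apply: le_trans lamL (ler_norm _).
have M1 i k : `|k * Dw s (Mon (axis i (2 * m))) x| <= `|k| :> R.
  by rewrite normrM -[leRHS]mulr1 ler_wpM2l // Dw_Mon_le1.
apply: le_trans (ler_normD _ _) _; apply: le_trans (lerD (lexx _) (ler_normB _ _)) _.
have := M1 i1 (a0 l + lam); have := M1 i2 lam; have := ler_normD (a0 l) lam.
by move: H1; rewrite -/(B l); lra.
Qed.

Lemma leading_dist lam mu l s x r : (size s < 2 * m)%N -> `|x| <= r -> 0 <= r <= 1 ->
  `|Dw s (leading lam l) x - Dw s (leading mu l) x| <= `|lam - mu| * (2 * r).
Proof.
move=> sm xr r01; rewrite !Dw_leading.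
have M1 i : `|Dw s (Mon (axis i (2 * m))) x| <= r :> R.
  by apply: Dw_Mon_le => //; rewrite sum_axis.
set T := Dw s (taylor _ _) x; set A := Dw s (Mon (axis i1 _)) x; set B := Dw s (Mon (axis i2 _)) x.
have -> : T + ((a0 l + lam) * A - lam * B) - (T + ((a0 l + mu) * A - mu * B)) = (lam - mu) * (A - B).
  by ring.
rewrite normrM ler_wpM2l //; apply: le_trans (ler_normB _ _) _.
by have := M1 i1; have := M1 i2; rewrite -/A -/B; lra.
Qed.

Lemma leading_probe lam mu l (t : R) :
  Dw (nseq (2 * m).-1 i1) (leading lam l) (t *: ebasis i1) -
  Dw (nseq (2 * m).-1 i1) (leading mu l) (t *: ebasis i1) = (lam - mu) * t.
Proof.
have m2 : (0 < (2 * m).-1)%N by lia.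
have Z : Dw (nseq (2 * m).-1 i1) (Mon (axis i2 (2 * m))) (t *: ebasis i1) = 0.
  exact: Dw_nseq_axis_neq.
rewrite !Dw_leading Z.
have -> : Dw (nseq (2 * m).-1 i1) (Mon (axis i1 (2 * m))) (t *: ebasis i1) = t.
  have := @Dw_nseq_axis R n i1 (2 * m).-1 1 (t *: ebasis i1).
  by rewrite addn1 prednK ?muln_gt0 // Mon_axis1 mxE ebasisE eqxx mulr1.
ring.
Qed.

End Family.

(** * Approximate solutions at all scales *)

Section ApproximateFamily.
Context {R : realType} {n N m : nat}.

Lemma leading_point (phi : 'rV[R]_n -> 'rV[R]_N) (a0 : 'I_N -> R) i1 i2 lam :
  jet_point m (fun x => \row_l leading (m := m) (component phi) a0 i1 i2 lam l x) 0 =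
  jet_point m phi 0.
Proof.
rewrite /jet_point; congr row_mx; rewrite /jet; apply/eq_mxrow => j; apply/rowP => k.
rewrite !nabla_entry.
have -> : component (fun x => \row_l leading (m := m) (component phi) a0 i1 i2 lam l x) (enum_val k).2
   = leading (m := m) (component phi) a0 i1 i2 lam (enum_val k).2.
  by apply/funext => x; rewrite /component mxE.
by rewrite leading_jet0 ?size_word_of // word_of_multiindexK.
Qed.

Lemma eps_half_small (k0 : nat) (eta : R) : (0 < k0)%N -> 0 < eta ->
  \forall k \near \oo, eps (k + k0) `^ 2^-1 <= eta.
Proof.
move=> k00 eta0; exists (Num.bound (eta ^- 2)) => // k /= hk.
have e2 : 0 < eta ^+ 2 by rewrite exprn_gt0.
have kk : 0 < (k + k0)%:R :> R by rewrite ltr0n; lia.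
rewrite powR12_sqrt ?invr_ge0 ?(ltW kk) // -(ger0_norm (ltW eta0)) -sqrtr_sqr ler_wsqrtr //.
rewrite /eps -[_ ^+ 2]invrK lef_pV2 ?posrE ?invr_gt0 //.
have := archi_boundP (_ : 0 <= eta ^- 2); rewrite invr_ge0 (ltW e2) => /(_ isT) H.
apply: le_trans (ltW H) _; rewrite ler_nat; exact: leq_trans hk (leq_addr _ _).
Qed.

(** The constants [K], [La] and the bound for the leading polynomials do not depend on the
cube, and [rho] small in terms of them makes every smallness condition hold.  The scale
and the free parameter come afterwards, so that one cube serves them all. *)
Lemma approximate_family (alpha : R) (a : 'rV[R]_(n + jet_size n N (2 * m)) -> 'rV[R]_N)
  (phi : 'rV[R]_n -> 'rV[R]_N) (i1 i2 : 'I_n) (L0 : R) :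
  let p0 := jet_point m phi 0 in
  let P := leading (m := m) (component phi) (fun l => a p0 ord0 l) i1 i2 in
  (0 < n)%N -> (0 < m)%N -> 0 < alpha < 1 -> C1_holder alpha a -> i1 != i2 ->
  exists (rho B La : R) (at_ : 'I_N -> 'rV[R]_(n + jet_size n N (2 * m)) -> R)
    (e : nat -> R) (u : nat -> R -> 'rV[R]_n -> 'rV[R]_N),
  [/\ [/\ 0 < rho, rho <= 16^-1, 0 <= B, B * rho <= 1 & B * rho `^ 2^-1 <= 16^-1],
      (forall eta, 0 < eta -> \forall k \near \oo, e k <= eta),
      (forall l q, `|q - p0| <= 1 -> at_ l q = a q ord0 l) /\
      (forall l q q', `|at_ l q - at_ l q'| <= La * `|q - q'|),
      (forall k lam, `|lam| <= L0 -> approx alpha at_ p0 (P lam) rho B (e k) (u k lam)) &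
      (forall k lam mu l, `|lam| <= L0 -> `|mu| <= L0 ->
        `|lam - mu| * (rho / 4) <=
        `|Dw (nseq (2 * m).-1 i1) (component (u k lam) l) ((rho / 2) *: ebasis i1) -
          Dw (nseq (2 * m).-1 i1) (component (u k mu) l) ((rho / 2) *: ebasis i1)|)].
Proof.
move=> p0 P n0 m0 al01 ha i12.
have al0 : 0 < alpha by case/andP: al01.
have [La [at_ [La0 at_lip at_bnd at_eq]]] := lipschitz_truncation p0 al0 ha.
have [V [C [cphi [C0 cphi0 gk]]]] := good_kernel_exists n0 m0 al01.
have [K K0 pb] := pot_bounds_exist n0 m0 al01 C0 cphi0 gk.
have [CP CP0 HCP] := leading_bound (m := m) (component phi) (fun l => a p0 ord0 l) i1 i2 L0.
pose B := approx_const (n := n) K La CP.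
have KLa : 0 < K * La by rewrite mulr_gt0.
have B0 : 0 <= B.
  have lb := lip_base_ge0 (n := n) K0 La0 CP0.
  have lc : 0 <= lip_const (n := n) K La CP by rewrite /lip_const; quick_lra.
  have KL : 0 <= K * (lip_const (n := n) K La CP + La).
    by apply: mulr_ge0; [exact: ltW|apply: addr_ge0 => //; exact: ltW].
  by apply: mulr_ge0; [rewrite mulr_ge0 ?addr_ge0|quick_lra].
pose Q : R := 16 + 2 * n%:R + 64 * (K * La) + 6 * (K * La) * n%:R + 16 * B.
(* [rho = Q^-2], so that [rho^(1/2) = Q^-1], and each summand of [Q] serves one smallness
condition below *)
have n1 : 1 <= n%:R :> R by rewrite ler1n.
have KLn : 0 <= K * La * n%:R by rewrite mulr_ge0 // ltW.
have Q0 : 0 < Q by rewrite /Q; quick_lra.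
pose t := Q^-1; have t0 : 0 < t by rewrite invr_gt0.
have tX X : X <= Q -> X * t <= 1.
  by move=> XQ; rewrite /t ler_pdivrMr // mul1r.
have t16 : 16 * t <= 1 by apply: tX; rewrite /Q; quick_lra.
pose rho := t ^+ 2.
have rho0 : 0 < rho by rewrite exprn_gt0.
have rt : rho <= t by rewrite /rho expr2; nra.
have rh : rho `^ 2^-1 = t by rewrite powR12_sqrt ?(ltW rho0) // sqrtr_sqr gtr0_norm.
have rho16 : 0 < rho <= 16^-1 by rewrite rho0 /=; quick_lra.
have nrho : n%:R * (2 * rho) <= 1.
  have : 2 * n%:R * t <= 1 by apply: tX; rewrite /Q; quick_lra.
  by apply: le_trans; rewrite mulrCA mulrA ler_wpM2l //; quick_lra.
have contr : La * (2 * (K * rho `^ 2^-1)) <= 2^-1.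
  by rewrite rh; have := tX (64 * (K * La)); rewrite /Q; nra.
have theta : 3 * La * n%:R * (K * rho `^ 2^-1) <= 2^-1.
  rewrite rh; have : 6 * (K * La) * n%:R * t <= 1 by apply: tX; rewrite /Q; quick_lra.
  have -> : 3 * La * n%:R * (K * t) = (6 * (K * La) * n%:R * t) / 2 by field.
  quick_lra.
have B16 : 16 * B * t <= 1 by apply: tX; rewrite /Q; quick_lra.
have BKt : 64 * (K * La) * t <= 1 by apply: tX; rewrite /Q; quick_lra.
pose k0 := (Num.bound rho^-1 + 4)%N.
have k04 k : (4 <= k + k0)%N by rewrite /k0 addnA leq_addl.
have er k : eps (k + k0) <= rho.
  rewrite /eps -[rho]invrK lef_pV2 ?posrE ?invr_gt0 ?ltr0n //; last exact: leq_trans (k04 k).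
  have := archi_boundP (_ : 0 <= rho^-1); rewrite invr_ge0 (ltW rho0) => /(_ isT) H.
  by apply: le_trans (ltW H) _; rewrite ler_nat /k0 addnCA leq_addr.
have sP lam l : smooth (P lam l) by exact: smooth_leading.
have exF (kl : nat * R) : exists F, forall l y, F l y = rhs V at_ p0 (kl.1 + k0)%N rho (P kl.2) F l y.
  exact: (density_exists gk K0 pb La0 at_lip at_bnd (k04 kl.1) (er kl.1) rho16 nrho contr (sP kl.2)).
have [F HF] := choice exF.
exists rho, B, La, at_, (fun k => eps (k + k0) `^ 2^-1),
  (fun k lam => trial (m := m) V (k + k0)%N (P lam) (F (k, lam))).
split.
- by split=> //; [case/andP: rho16|nra|rewrite rh; quick_lra].
- by move=> eta eta0; apply: eps_half_small => //; rewrite /k0 addn_gt0 orbT.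
- by [].
- move=> k lam lamL.
  apply: (trial_approx al01 gk K0 pb La0 at_lip at_bnd (k04 k) (er k) rho16 nrho contr (sP lam) (HF (k, lam)) CP0) => //.
  + by move=> l s x _ x1; apply: HCP.
  + exact: leading_point.
  + by move=> l s x ss; apply: leading_top.
  + move=> l x; rewrite leading_lap // at_eq // subrr normr0 //.
- move=> k lam mu l lamL muL.
  have xr : `|(rho / 2) *: ebasis i1 : 'rV[R]_n| <= 2 * rho.
    by apply: le_trans (norm_step _ _) _; quick_lra.
  have E0 : 0 <= `|lam - mu| * (2 * (2 * rho)) by rewrite !mulr_ge0 // ltW.
  have sm : (size (nseq (2 * m).-1 i1) < 2 * m)%N by rewrite size_nseq prednK // muln_gt0.
  have r2 : 0 <= 2 * rho <= 1 by apply/andP; split; quick_lra.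
  have := trial_separation gk K0 pb La0 at_lip at_bnd (k04 k) (er k) rho16 nrho contr
    (sP lam) (sP mu) E0 (fun l s x sm xr => leading_dist (component phi) (fun l => a p0 ord0 l) i1 i2 lam mu l sm xr r2)
    (HF (k, lam)) (HF (k, mu)) l sm xr.
  rewrite leading_probe // rh.
  set X := Dw _ _ _; set Y := Dw _ _ _ => H.
  have E1 : (lam - mu) * (rho / 2) = (X - Y) - (X - Y - (lam - mu) * (rho / 2)) by ring.
  have H2 : `|lam - mu| * (rho / 2) <= `|X - Y| + 4 * K * La * t * (`|lam - mu| * (2 * (2 * rho))).
    have -> : `|lam - mu| * (rho / 2) = `|(lam - mu) * (rho / 2)|.
      by rewrite normrM (ger0_norm (_ : 0 <= rho / 2)) //; quick_lra.
    by rewrite {1}E1; apply: le_trans (ler_normB _ _) _; rewrite lerD2l.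
  have H3 : 64 * (K * La) * t * (`|lam - mu| * rho) <= `|lam - mu| * rho.
    by rewrite -[leRHS]mul1r ler_wpM2r // mulr_ge0 // ltW.
  move: H2 H3; rewrite -/X -/Y; quick_lra.
Qed.

End ApproximateFamily.

(** * Ultralimits *)

Section DerivativeFromModulus.
Context {R : realType} {n : nat}.

Lemma powR_small (alpha B eta : R) : 0 < alpha -> 0 <= B -> 0 < eta ->
  exists2 d, 0 < d & forall t, 0 <= t <= d -> B * t `^ alpha <= eta.
Proof.
move=> al0 B0 eta0; pose c := eta / (B + 1).
have B1 : 0 < B + 1 by rewrite ltr_wpDl.
have c0 : 0 < c by rewrite divr_gt0.
exists (c `^ alpha^-1); first exact: powR_gt0.
move=> t /andP[t0 tc]; apply: (@le_trans _ _ (B * c)).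
  rewrite ler_wpM2l //.
  have := ge0_ler_powR (ltW al0) (_ : t \in Num.nneg) (_ : c `^ alpha^-1 \in Num.nneg) tc.
  rewrite !nnegrE powR_ge0 t0 => /(_ isT isT).
  by rewrite -powRrM mulVf ?gt_eqF // powRr1 ?(ltW c0).
by rewrite /c mulrA ler_pdivrMr // mulrC ler_wpM2l ?(ltW eta0) // lerDl.
Qed.

(** A first-order expansion with a remainder of order [1 + alpha] is all that a limit
of approximate solutions inherits; it determines the derivative. *)
Lemma is_derive_modulus (f : 'rV[R]_n -> R) x (v : 'rV[R]_n) (df B delta alpha : R) :
  0 < delta -> 0 < alpha -> 0 <= B ->
  (forall t, `|t| <= delta -> `|f (x + t *: v) - f x - t * df| <= B * (`|t| * `|t| `^ alpha)) ->
  is_derive x v f df.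
Proof.
move=> d0 al0 B0 H.
have F : (fun h : R => h^-1 *: ((f \o shift x) (h *: v) - f x)) @ 0^' --> df.
  apply/cvgrPdist_le => eta eta0.
  have [d d0' Hd] := powR_small al0 B0 eta0.
  near=> h.
  have h0 : h != 0 by near: h; apply: nbhs_dnbhs_neq.
  have hdel : `|h| <= delta by apply: ltW; near: h; exact: dnbhs0_lt.
  have hd : `|h| <= d by apply: ltW; near: h; exact: dnbhs0_lt.
  have E : df - h^-1 *: ((f \o shift x) (h *: v) - f x) =
      - (h^-1 * (f (x + h *: v) - f x - h * df)).
    rewrite /= (addrC (h *: v)) -[_ *: (_ - _)]/(h^-1 * (_ - _)); by field.
  rewrite E normrN normrM normfV ler_pdivrMl ?normr_gt0 //.
  apply: le_trans (H h hdel) _.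
  by rewrite mulrCA ler_wpM2l //; apply: Hd; rewrite normr_ge0.
split; first by apply/cvg_ex; exists df.
by apply: cvg_lim.
Unshelve. all: by end_near. Qed.

End DerivativeFromModulus.

Lemma open_norm_lt {R : realType} {n : nat} (r : R) : open [set y : 'rV[R]_n | `|y| < r].
Proof.
rewrite openE => y /= yr; have d0 : 0 < r - `|y| by rewrite subr_gt0.
near=> z; have zy : `|y - z| < r - `|y| by near: z; apply: (@cvgr_dist_lt _ _ _ (nbhs y)).
rewrite /= -[z](subKr y); apply: le_lt_trans (ler_normB _ _) _.
by rewrite -ltrBrDl.
Unshelve. all: by end_near. Qed.

Section UltraLimit.
Context {R : realType} {U : set_system nat} {UU : UltraFilter U}.
Implicit Types (z : nat -> R).

(** Every bounded sequence converges along the same ultrafilter, so that the limits of all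
derivatives at all points exist without extraction of subsequences. *)
Lemma ultra_cvg z M : (forall k, `|z k| <= M) -> z @ U --> lim (z @ U).
Proof.
move=> zM.
have [p [_ pc]] : `[(- M), M] `&` cluster (z @ U) !=set0.
  apply: segment_compact.
  by apply: (@filterE _ U _ (z @^-1` `[(- M), M])) => k /=; rewrite in_itv /= -ler_norml; exact: zM.
suff zp : z @ U --> p by apply/cvg_ex; exists p.
move=> B /= pB; have [//|nB] := @in_ultra_setVsetC _ U (z @^-1` B) _.
by have [t [? ?]] := pc (~` B) B nB pB.
Qed.

Variable e : nat -> R.
Hypothesis e_small : forall eta, 0 < eta -> \forall k \near U, e k <= eta.

Lemma limit_le z l c B : z @ U --> l -> 0 <= B -> (forall k, `|z k| <= c + B * e k) -> `|l| <= c.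
Proof.
move=> zl B0 H; apply/ler_addgt0Pr => eta eta0.
apply: (@cvgr_to_le _ U _ _ (fun k => `|z k|)).
  exact: cvg_norm zl.
have B1 : 0 < B + 1 by rewrite ltr_wpDl.
have ee : \forall k \near U, e k <= eta / (B + 1) by apply: e_small; rewrite divr_gt0.
near=> k; apply: le_trans (H k) _; rewrite lerD2l.
have ek : e k <= eta / (B + 1) by near: k.
apply: (@le_trans _ _ (B * (eta / (B + 1)))); first by rewrite ler_wpM2l.
by rewrite mulrA ler_pdivrMr // mulrC ler_wpM2l ?(ltW eta0) // lerDl.
Unshelve. all: by end_near. Qed.

Context {n N m : nat}.
Variables (alpha : R) (at_ : 'I_N -> 'rV[R]_(n + jet_size n N (2 * m)) -> R).
Variables (p0 : 'rV[R]_(n + jet_size n N (2 * m))) (P : 'I_N -> 'rV[R]_n -> R).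
Variables (rho B La : R) (u : nat -> 'rV[R]_n -> 'rV[R]_N).
Hypotheses (al0 : 0 < alpha) (rho0 : 0 < rho) (B0 : 0 <= B).
Hypothesis at_lip : forall l q q', `|at_ l q - at_ l q'| <= La * `|q - q'|.
Hypothesis u_approx : forall k, approx alpha at_ p0 P rho B (e k) (u k).

(** The candidate for [Dw s] of the limit. *)
Let G l s x : R := lim ((fun k => Dw s (component (u k) l) x) @ U).

Let G_cvg l s x : (size s <= 2 * m)%N -> `|x| <= 2 * rho ->
  (fun k => Dw s (component (u k) l) x) @ U --> G l s x.
Proof. by move=> sm xr; apply: (ultra_cvg (M := B)) => k; apply: (ax_bound (u_approx k)). Qed.

Let G_modulus l s x y : (size s <= 2 * m)%N -> `|x| <= 2 * rho -> `|y| <= 2 * rho ->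
  `|G l s x - G l s y| <= B * `|x - y| `^ alpha.
Proof.
move=> sm xr yr; apply: (limit_le (cvgB (G_cvg (l := l) sm xr) (G_cvg (l := l) sm yr)) B0) => k.
by rewrite -mulrDr; apply: (ax_modulus (u_approx k)).
Qed.

(** The mean value theorem at each scale gives a first-order expansion with a remainder
controlled by [ax_modulus]; its limit has no error [e] any more. *)
Let G_step l s x i : (size s < 2 * m)%N -> `|x| < 2 * rho ->
  is_derive x (ebasis i) (G l s) (G l (i :: s) x).
Proof.
move=> sm xr; apply: (is_derive_modulus (B := B) (delta := 2 * rho - `|x|) (alpha := alpha)) => //.
  by rewrite subr_gt0.
move=> t td.
have near_x t' : `|t'| <= `|t| -> `|x + t' *: ebasis i| <= 2 * rho.
  move=> tt; apply: le_trans (ler_normD _ _) _.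
  have h : `|t' *: ebasis i : 'rV[R]_n| <= `|t|.
    rewrite normrZ; apply: le_trans tt; rewrite -[leRHS]mulr1 ler_wpM2l //.
    have := @norm_step R n 1 i ler01; by rewrite scale1r.
  by have := le_trans h td; lra.
have xr' := ltW xr.
have c1 := G_cvg (l := l) (ltnW sm) (near_x t (lexx _)).
have c2 := G_cvg (l := l) (ltnW sm) xr'.
have c3 : (fun k => t * Dw (i :: s) (component (u k) l) x) @ U --> t * G l (i :: s) x.
  by apply: cvgMl_tmp; apply: G_cvg.
have B1 : 0 <= B * `|t| by rewrite mulr_ge0.
apply: (limit_le (cvgB (cvgB c1 c2) c3) B1) => k /=.
have [t' [t't _] E] := @mvt_line R n (Dw s (component (u k) l)) (Dw (i :: s) (component (u k) l))
  x (ebasis i) t (fun t' _ _ => smoothP s _ i (ax_smooth (u_approx k) l)).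
rewrite -[X in `|X|]/(Dw s (component (u k) l) (x + t *: ebasis i) - Dw s (component (u k) l) x -
  t * Dw (i :: s) (component (u k) l) x).
rewrite E -mulrBr normrM mulrA -mulrDr (mulrC B) -mulrA ler_wpM2l //.
have := ax_modulus (u_approx k) l (s := i :: s) sm (near_x t' t't) xr'.
move/le_trans; apply; rewrite ler_wpM2l // lerD2r.
apply: ge0_ler_powR; rewrite ?nnegrE ?(ltW al0) //.
rewrite addrAC subrr add0r normrZ; apply: le_trans t't; rewrite -[leRHS]mulr1 ler_wpM2l //.
by have := @norm_step R n 1 i ler01; rewrite scale1r.
Qed.

Definition ultralimit x : 'rV[R]_N := \row_l G l [::] x.

Local Notation w := ultralimit.

Let Dw_w l s x : (size s <= 2 * m)%N -> `|x| < 2 * rho -> Dw s (component w l) x = G l s x.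
Proof.
elim: s x => [|i s IH] x sm xr; first by rewrite -[LHS]/(ultralimit x ord0 l) mxE.
rewrite -[LHS]/('D_(ebasis i) (Dw s (component w l)) x).
rewrite (@near_eq_derive _ _ _ _ (G l s)).
  by have [_] := G_step l i sm xr.
near=> y; apply: IH; first exact: ltnW.
by near: y; apply: open_nbhs_nbhs; split; [exact: open_norm_lt|].
Unshelve. all: by end_near. Qed.

Lemma ultralimit_cvg l s x : (size s <= 2 * m)%N -> `|x| < 2 * rho ->
  (fun k => Dw s (component (u k) l) x) @ U --> Dw s (component w l) x.
Proof. by move=> sm xr; rewrite Dw_w //; apply: G_cvg => //; apply: ltW. Qed.

Lemma ultralimit_modulus l s x y : (size s <= 2 * m)%N -> `|x| < 2 * rho -> `|y| < 2 * rho ->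
  `|Dw s (component w l) x - Dw s (component w l) y| <= B * `|x - y| `^ alpha.
Proof. by move=> sm xr yr; rewrite !Dw_w //; apply: G_modulus => //; apply: ltW. Qed.

Lemma ultralimit_is_derive l s x i : (size s < 2 * m)%N -> `|x| < 2 * rho ->
  is_derive x (ebasis i) (Dw s (component w l)) (Dw (i :: s) (component w l) x).
Proof.
move=> sm xr; rewrite Dw_w //.
have E : \forall y \near x, Dw s (component w l) y = G l s y.
  near=> y; apply: Dw_w; first exact: ltnW.
  by near: y; apply: open_nbhs_nbhs; split; [exact: open_norm_lt|].
apply: near_eq_is_derive (G_step l i sm xr).
by apply: filterS E => y ->.
Unshelve. all: by end_near. Qed.

Let norm0 : `|0 : 'rV[R]_n| < 2 * rho.
Proof. by rewrite normr0 mulr_gt0. Qed.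

Lemma ultralimit_jet0 l s : (size s < 2 * m)%N -> Dw s (component w l) 0 = Dw s (P l) 0.
Proof.
move=> sm; apply: (cvg_unique _ (ultralimit_cvg (l := l) (ltnW sm) norm0)) => //.
have -> : (fun k => Dw s (component (u k) l) 0) = cst (Dw s (P l) 0).
  by apply/funext => k; apply: (ax_jet0 (u_approx k)).
exact: cvg_cst.
Qed.

Lemma ultralimit_top l s : size s = (2 * m)%N ->
  `|Dw s (component w l) 0 - Dw s (P l) 0| <= B * rho `^ 2^-1.
Proof.
move=> ss; have sm : (size s <= 2 * m)%N by rewrite ss.
apply: (limit_le (cvgB (ultralimit_cvg (l := l) sm norm0) (cvg_cst (Dw s (P l) 0))) B0) => k.
by rewrite -mulrDr; apply: (ax_top (u_approx k)).
Qed.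

Let jet_cvg x eta : `|x| < 2 * rho -> 0 < eta ->
  \forall k \near U, `|jet_point m (u k) x - jet_point m w x| <= eta.
Proof.
move=> xr eta0.
have H : \forall k \near U, forall j, `|jet_point m (u k) x ord0 j - jet_point m w x ord0 j| <= eta.
  apply: filter_forall => j; case: (@jet_point_entry R n N m j) => [[i E]|[s [l [sm E]]]].
    by apply: filterE => k; rewrite !E subrr normr0 ltW.
  have := ultralimit_cvg (l := l) (ltnW sm) xr; move/cvgrPdist_le => /(_ eta eta0).
  by apply: filterS => k; rewrite !E distrC.
apply: filterS H => k Hk; apply: norm_le_coord; first exact: ltW.
by move=> j; have := Hk j; rewrite !mxE.
Qed.

Lemma ultralimit_near x : `|x| < 2 * rho -> `|jet_point m w x - p0| <= B * rho.
Proof.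
move=> xr; apply/ler_addgt0Pr => eta eta0.
have [k Hk] := filter_ex (jet_cvg xr eta0).
have -> : jet_point m w x - p0 = (jet_point m (u k) x - p0) - (jet_point m (u k) x - jet_point m w x).
  by rewrite opprB [RHS]addrC subrKA.
apply: le_trans (ler_normB _ _) _; apply: lerD => //.
exact: (ax_near (u_approx k) (ltW xr)).
Qed.

Let lapW_cvg l j s x : (size s + 2 * j <= 2 * m)%N -> `|x| < 2 * rho ->
  (fun k => lapW j s (component (u k) l) x) @ U --> lapW j s (component w l) x.
Proof.
move=> + xr; elim: j s => [|j IH] s sm /=.
  by apply: ultralimit_cvg => //; move: sm; rewrite muln0 addn0.
apply: cvg_big => [|i _]; [exact: add_continuous|apply: IH]; move: sm; rewrite size_cat /=; lia.
Qed.

Lemma ultralimit_equation l x : `|x| <= rho ->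
  iter m (@laplacian R n) (component w l) x = at_ l (jet_point m w x).
Proof.
move=> xr; have xr2 : `|x| < 2 * rho by apply: le_lt_trans xr _; rewrite mulr_natl mulr2n ltrDl.
have oA := @open_norm_lt R n (2 * rho).
rewrite -[LHS]/(Dw [::] (iter m (@laplacian R n) (component w l)) x).
have HA s y i : (size s < 2 * m)%N -> `|y| < 2 * rho ->
    is_derive y (ebasis i) (Dw s (component w l)) (Dw (i :: s) (component w l) y).
  exact: ultralimit_is_derive.
rewrite (@iter_laplacianW R n (component w l) _ (2 * m)%N oA HA m [::] x (leqnn _) xr2).
have at_cvg : (fun k => at_ l (jet_point m (u k) x)) @ U --> at_ l (jet_point m w x).
  apply/cvgrPdist_le => eta eta0.
  have L1 : 0 < `|La| + 1 by rewrite ltr_wpDl.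
  have := jet_cvg xr2 (divr_gt0 eta0 L1); apply: filterS => k Hk.
  rewrite distrC; apply: le_trans (at_lip _ _ _) _.
  have La1 : La <= `|La| + 1 by apply: le_trans (ler_norm La) _; rewrite lerDl.
  apply: (@le_trans _ _ ((`|La| + 1) * `|jet_point m (u k) x - jet_point m w x|)).
    by rewrite ler_wpM2r.
  by rewrite mulrC -ler_pdivlMr.
apply/eqP; rewrite -subr_eq0 -normr_le0.
apply: (limit_le (cvgB (lapW_cvg (l := l) (s := [::]) (leqnn _) xr2) at_cvg) B0) => k.
rewrite add0r; have := ax_equation (u_approx k) l xr.
by rewrite (iter_laplacian_smooth _ _ (ax_smooth (u_approx k) l)).
Qed.

End UltraLimit.

(** * Solutions and their properties *)

Section LimitSolution.
Context {R : realType} {n N : nat}.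
Implicit Types (f g : 'rV[R]_n -> R) (s : seq 'I_n) (x : 'rV[R]_n) (A : set 'rV[R]_n).

Lemma Ck_on_words A k f :
  (forall s x, (size s <= k)%N -> A x -> {for x, continuous (Dw s f)}) ->
  (forall s x i, (size s < k)%N -> A x -> derivable (Dw s f) x (ebasis i)) ->
  forall j s, (size s + j <= k)%N -> Ck_on A j (Dw s f).
Proof.
move=> C D; elim=> [|j IH] s sk /=; (split; first by move=> x Ax; apply: C => //; lia) => //.
move=> i; split; first by move=> x Ax; apply: D => //; lia.
by apply: (IH (i :: s)); rewrite /= addSnnS.
Qed.

Lemma Dw_eq_on A f g : open A -> (forall x, A x -> f x = g x) ->
  forall s x, A x -> Dw s f x = Dw s g x.
Proof.
move=> oA fg; elim=> [|i s IH] x Ax; first exact: fg.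
rewrite -[LHS]/('D_(ebasis i) (Dw s f) x) -[RHS]/('D_(ebasis i) (Dw s g) x).
apply: near_eq_derive; near=> y; apply: IH; near: y.
by apply: open_nbhs_nbhs.
Unshelve. all: by end_near. Qed.

Lemma enorm_continuous : continuous (@enorm R n).
Proof.
move=> x; have c (i : 'I_n) : (fun y : 'rV[R]_n => y ord0 i ^+ 2) @ nbhs x --> x ord0 i ^+ 2.
  by rewrite expr2; apply: cvgM; exact: coord_continuous.
apply: continuous_comp; last exact: sqrt_continuous.
apply: (@cvg_big _ _ _ _ _ _ _ (nbhs x)) => [|i _]; first exact: add_continuous.
exact: c.
Qed.

Lemma open_eball r : open (@eball R n r).
Proof.
apply: (@open_comp _ _ (@enorm R n) [set t | t < r]) => [y _|]; last exact: open_lt.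
exact: enorm_continuous.
Qed.

Lemma enorm_axis (t : R) i : enorm (t *: ebasis i : 'rV[R]_n) = `|t|.
Proof.
rewrite /enorm (bigD1 i) //= big1 => [|j ji]; first by rewrite !mxE !eqxx mulr1 addr0 sqrtr_sqr.
by rewrite !mxE (negPf ji) andbF mulr0 expr0n.
Qed.

Lemma word_exists s k : size s = k -> exists b : multiindex n k, perm_eq (word_of b) s.
Proof. by move=> <-; exists (multiindex_of s); exact: perm_word_of. Qed.

Lemma perm_eq_nseq (s : seq 'I_n) k i : perm_eq s (nseq k i) -> s = nseq k i.
Proof.
move=> pe; have := perm_size pe; rewrite size_nseq => <-.
by apply/all_pred1P; rewrite (perm_all _ pe) all_pred1_nseq.
Qed.

(** An exact solution on the cube of radius [rho], with control of its derivatives on the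
twice larger one.  The constant in [ls_top] has to stay below half of the number in
[leading_diag], which is at least 2 for the values of the parameter that will be used. *)
Record limit_solution {m : nat} (alpha : R) (a : 'rV[R]_(n + jet_size n N (2 * m)) -> 'rV[R]_N)
    (P : 'I_N -> 'rV[R]_n -> R) (rho B : R) (w : 'rV[R]_n -> 'rV[R]_N) : Prop := LimitSolution {
  ls_derive : forall l s x i, (size s < 2 * m)%N -> `|x| < 2 * rho ->
    is_derive x (ebasis i) (Dw s (component w l)) (Dw (i :: s) (component w l) x);
  ls_modulus : forall l s x y, (size s <= 2 * m)%N -> `|x| < 2 * rho -> `|y| < 2 * rho ->
    `|Dw s (component w l) x - Dw s (component w l) y| <= B * `|x - y| `^ alpha;
  ls_jet0 : forall l s, (size s < 2 * m)%N -> Dw s (component w l) 0 = Dw s (P l) 0;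
  ls_equation : forall l x, `|x| <= rho ->
    iter m (@laplacian R n) (component w l) x = a (jet_point m w x) ord0 l;
  ls_top : forall l s, size s = (2 * m)%N -> `|Dw s (component w l) 0 - Dw s (P l) 0| <= 16^-1
}.

Section Properties.
Context {m : nat} {alpha : R} {a : 'rV[R]_(n + jet_size n N (2 * m)) -> 'rV[R]_N}.
Context {P : 'I_N -> 'rV[R]_n -> R} {rho B : R} {w : 'rV[R]_n -> 'rV[R]_N}.
Hypotheses (al0 : 0 < alpha) (rho0 : 0 < rho) (B0 : 0 <= B).
Hypothesis sol : limit_solution alpha a P rho B w.

Let eball_sup x : eball rho x -> `|x| < 2 * rho.
Proof.
move=> xr; apply: le_lt_trans (norm_le_enorm x) _; apply: (lt_trans xr).
by rewrite mulr_natl mulr2n ltrDl.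
Qed.

Lemma limit_solution_continuous l s x : (size s <= 2 * m)%N -> `|x| < 2 * rho ->
  {for x, continuous (Dw s (component w l))}.
Proof.
move=> sm xr; apply/(@cvgrPdist_le R R _ (nbhs x) (nbhs_filter x)) => eta eta0.
have [d d0 Hd] := powR_small al0 B0 eta0.
near=> y; have yr : `|y| < 2 * rho.
  by near: y; apply: open_nbhs_nbhs; split; [exact: open_norm_lt|].
apply: le_trans (ls_modulus sol l sm xr yr) _; apply: Hd; rewrite normr_ge0 /=.
by near: y; apply: (@cvgr_dist_le _ _ _ (nbhs x)).
Unshelve. all: by end_near. Qed.

Lemma limit_solution_Ck : Ck_holder_on (eball rho) (2 * m) alpha w.
Proof.
move=> l; split.
  apply: (@Ck_on_words (eball rho) (2 * m)%N (component w l) _ _ (2 * m)%N [::]) => //.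
    by move=> s x sm xr; apply: limit_solution_continuous => //; exact: eball_sup.
  by move=> s x i sm xr; have [] := ls_derive sol l i sm (eball_sup xr).
move=> b; exists B => x y xr yr; rewrite !multi_partialE.
have sb : (size (word_of b) <= 2 * m)%N by rewrite size_word_of.
apply: le_trans (ls_modulus sol l sb (eball_sup xr) (eball_sup yr)) _.
rewrite ler_wpM2l //; apply: ge0_ler_powR; rewrite ?nnegrE ?sqrtr_ge0 ?(ltW al0) //.
exact: norm_le_enorm.
Qed.

(** If [w] depended on [|x|] alone, its restrictions to two axes, and hence all their
derivatives, would be the same. *)
Lemma radial_axes l i1 i2 : radially_symmetric_on (eball rho) w ->
  Dw (nseq (2 * m) i1) (component w l) 0 = Dw (nseq (2 * m) i2) (component w l) 0.
Proof.
move=> [g Hg].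
have H j : (j <= 2 * m)%N -> forall t : R, `|t| < rho ->
    Dw (nseq j i1) (component w l) (t *: ebasis i1) = Dw (nseq j i2) (component w l) (t *: ebasis i2).
  elim: j => [|j IH] jm t tr.
    rewrite -[LHS]/(w (t *: ebasis i1) ord0 l) -[RHS]/(w (t *: ebasis i2) ord0 l).
    by rewrite !Hg /eball /= ?enorm_axis.
  have D i : is_derive t 1 (fun h : R => Dw (nseq j i) (component w l) (h *: ebasis i))
      (Dw (nseq j.+1 i) (component w l) (t *: ebasis i)).
    have sj : (size (nseq j i) < 2 * m)%N by rewrite size_nseq.
    have tr2 : `|t *: ebasis i| < 2 * rho.
      by apply: eball_sup; rewrite /eball /= enorm_axis.
    have := ls_derive sol l i sj tr2; rewrite -{1}[t *: ebasis i]add0r => /is_derive_line.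
    by under eq_fun do rewrite add0r.
  have [_ <-] := D i1; have [_ <-] := D i2; apply: near_eq_derive.
  near=> h; apply: IH; first exact: ltnW.
  near: h; apply: (cvgr_lt `|t|) => //; apply: cvg_norm; exact: cvg_id.
have := H (2 * m)%N (leqnn _) 0; rewrite normr0 !scale0r; exact.
Unshelve. all: by end_near. Qed.

Variables (phi : 'rV[R]_n -> 'rV[R]_N) (lam : R) (i1 i2 : 'I_n) (l0 : 'I_N).
Hypotheses (i12 : i1 != i2) (m0 : (0 < m)%N).
Hypothesis PE : P = leading (m := m) (component phi) (fun l => a (jet_point m phi 0) ord0 l) i1 i2 lam.
Hypothesis lam_large : `|a (jet_point m phi 0) ord0 l0| + 1 <= lam.

Let axes_differ :
  Dw (nseq (2 * m) i1) (component w l0) 0 - Dw (nseq (2 * m) i2) (component w l0) 0 != 0.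
Proof.
have s1 : size (nseq (2 * m) i1) = (2 * m)%N by rewrite size_nseq.
have s2 : size (nseq (2 * m) i2) = (2 * m)%N by rewrite size_nseq.
have := ls_top sol l0 s1; have := ls_top sol l0 s2.
have := leading_diag (component phi) (fun l => a (jet_point m phi 0) ord0 l) i12 m0 lam l0.
rewrite -PE; move: lam_large; set a0 : R := a _ _ _; rewrite !ler_norml.
have := ler_norm (- a0); rewrite normrN.
set X1 := Dw _ _ _; set X2 := Dw _ _ _; set Y1 := Dw _ _ _; set Y2 := Dw _ _ _.
move=> H1 H2 H3 /andP[H4 H5] /andP[H6 H7]; apply/eqP => H8.
have H9 := normr_ge0 a0.
clear -H1 H2 H3 H4 H5 H6 H7 H8 H9; lra.
Qed.

Lemma limit_solution_not_radial : ~ radially_symmetric_on (eball rho) w.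
Proof. by move=> /(radial_axes l0 i1 i2) E; move: axes_differ; rewrite E subrr eqxx. Qed.

(** Two pure derivatives of order [2m] differ at the origin, so not all of that order
vanish. *)
Lemma limit_solution_vanishing : exists2 l, (l <= 2 * m)%N & vanishing_order w l.
Proof.
have top : nabla (2 * m) w 0 <> 0.
  move=> Z; have D i : Dw (nseq (2 * m) i) (component w l0) 0 = 0.
    have [b /perm_eq_nseq <-] := word_exists (size_nseq (2 * m) i).
    have /rowP/(_ (enum_rank (b, l0))) := Z; by rewrite nabla_entry enum_rankK mxE.
  by move: axes_differ; rewrite !D subrr eqxx.
have ex : exists l, `[< nabla l w 0 <> 0 >] by exists (2 * m)%N; apply/asboolP.
case: (ex_minnP ex) => l /asboolP l0' lmin; exists l; first by apply: lmin; apply/asboolP.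
split=> // j jl; apply: contrapT => /asboolP /lmin; rewrite leqNgt jl.
by [].
Qed.

Lemma limit_solution_data (c : forall j : 'I_(2 * m), 'rV[R]_(nabla_size n N j)) :
  (forall j : 'I_(2 * m), nabla j phi 0 = c j) -> solution_on (eball rho) a c w.
Proof.
move=> Hc; split=> [x xr l|j].
  by rewrite (ls_equation sol) //; apply: le_trans (norm_le_enorm x) _; exact: ltW.
rewrite -Hc; apply/rowP => k; rewrite !nabla_entry.
have sj : (size (word_of (enum_val k).1) < 2 * m)%N by rewrite size_word_of.
by rewrite (ls_jet0 sol) // PE leading_jet0 // word_of_multiindexK.
Qed.

End Properties.

End LimitSolution.

Section Existence.
Context {R : realType} {n N m : nat}.

Lemma limit_family (alpha : R) (a : 'rV[R]_(n + jet_size n N (2 * m)) -> 'rV[R]_N)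
  (phi : 'rV[R]_n -> 'rV[R]_N) (i1 i2 : 'I_n) (L0 : R) :
  let P := leading (m := m) (component phi) (fun l => a (jet_point m phi 0) ord0 l) i1 i2 in
  (0 < n)%N -> (0 < m)%N -> 0 < alpha < 1 -> C1_holder alpha a -> i1 != i2 ->
  exists (rho B : R) (w : R -> 'rV[R]_n -> 'rV[R]_N), [/\ 0 < rho, 0 <= B,
    (forall lam, `|lam| <= L0 -> limit_solution alpha a (P lam) rho B (w lam)) &
    (forall lam mu l, `|lam| <= L0 -> `|mu| <= L0 ->
        `|lam - mu| * (rho / 4) <=
        `|Dw (nseq (2 * m).-1 i1) (component (w lam) l) ((rho / 2) *: ebasis i1) -
          Dw (nseq (2 * m).-1 i1) (component (w mu) l) ((rho / 2) *: ebasis i1)|)].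
Proof.
move=> P n0 m0 al01 ha i12.
have [rho [B [La [at_ [e [u [[rho0 rho16 B0 Brho Bh] esm [at_eq at_lip] uap usep]]]]]]] :=
  approximate_family phi L0 n0 m0 al01 ha i12.
have [U [UU oU]] := ultraFilterLemma (@eventually_filter).
have eU eta : 0 < eta -> \forall k \near U, e k <= eta by move=> /esm /oU.
have al0 : 0 < alpha by case/andP: al01.
exists rho, B, (fun lam => ultralimit (U := U) (fun k => u k lam)); split=> //.
- move=> lam lamL; have ap k := uap k lam lamL.
  split.
  + by move=> l s x i; apply: (ultralimit_is_derive eU al0 B0 ap).
  + by move=> l s x y; apply: (ultralimit_modulus eU al0 B0 ap).
  + by move=> l s; apply: (ultralimit_jet0 eU al0 rho0 B0 ap).
  + move=> l x xr; rewrite (ultralimit_equation eU al0 rho0 B0 at_lip ap) // at_eq //.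
    apply: le_trans (ultralimit_near eU al0 B0 ap _) Brho.
    by apply: le_lt_trans xr _; rewrite mulr_natl mulr2n ltrDl.
  + by move=> l s ss; apply: le_trans (ultralimit_top eU al0 rho0 B0 ap l ss) Bh.
- move=> lam mu l lamL muL.
  have xr : `|(rho / 2) *: ebasis i1 : 'rV[R]_n| < 2 * rho.
    by apply: le_lt_trans (norm_step _ _) _; lra.
  have sm : (size (nseq (2 * m).-1 i1) <= 2 * m)%N by rewrite size_nseq leq_pred.
  have c nu (nuL : `|nu| <= L0) : (fun k => Dw (nseq (2 * m).-1 i1) (component (u k nu) l)
      ((rho / 2) *: ebasis i1)) @ U -->
      Dw (nseq (2 * m).-1 i1) (component (ultralimit (U := U) (fun k => u k nu)) l) ((rho / 2) *: ebasis i1).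
    exact: (ultralimit_cvg eU al0 B0 (fun k => uap k nu nuL)).
  by apply: (cvgr_to_ge (cvg_norm (cvgB (c lam lamL) (c mu muL)))); apply: filterE => k; apply: usep.
Qed.

End Existence.

(** * Infinitely many solutions *)

Theorem theorem1p1 (R : realType) (n N m : nat) (alpha : R)
  (hn : (3 <= n)%N) (hN : (1 <= N)%N) (hm : (1 <= m)%N)
  (halpha0 : 0 < alpha) (halpha1 : alpha < 1)
  (a : 'rV[R]_(n + jet_size n N (2 * m)) -> 'rV[R]_N)
  (ha : C1_holder alpha a)
  (c : forall j : 'I_(2 * m), 'rV[R]_(nabla_size n N j))
  (hc : appropriate c) :
  exists (r : R) (S : set ('rV[R]_n -> 'rV[R]_N)),
    [/\ 0 < r,
        infinite_set [set restrict (eball r) u | u in S] &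
        forall u, S u ->
          [/\ Ck_holder_on (eball r) (2 * m) alpha u,
              solution_on (eball r) a c u,
              exists2 l : nat, (l <= 2 * m)%N & vanishing_order u l &
              ~ radially_symmetric_on (eball r) u]].
Proof.
have [phi [r0 [_ _ Hphi]]] := hc.
have n0 : (0 < n)%N by exact: leq_trans hn.
pose i1 : 'I_n := Ordinal n0; pose i2 : 'I_n := Ordinal (leq_trans (isT : (1 < 3)%N) hn).
have i12 : i1 != i2 by [].
pose l0 : 'I_N := Ordinal hN.
(* for [lam] at least [A], the number [a0 + 2 lam] of [leading_diag] is at least 2 *)
pose A : R := `|a (jet_point m phi 0) ord0 l0| + 1.
have A0 : 0 <= A by rewrite addr_ge0.
have al01 : 0 < alpha < 1 by rewrite halpha0.
have [rho [B [w [rho0 B0 Hw Hsep]]]] := limit_family phi (A + 1) n0 hm al01 ha i12.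
have AL lam : A <= lam <= A + 1 -> `|lam| <= A + 1.
  by move=> /andP[h1 h2]; rewrite ger0_norm // (le_trans A0).
exists rho, (w @` [set lam | A <= lam <= A + 1]); split=> //; last first.
  move=> _ [lam /= lamA <-]; have sol := Hw lam (AL lam lamA); have /andP[lamA1 _] := lamA.
  split.
  - exact: (limit_solution_Ck halpha0 rho0 B0 sol).
  - exact: (limit_solution_data sol erefl Hphi).
  - exact: (limit_solution_vanishing sol i12 hm erefl lamA1).
  - exact: (limit_solution_not_radial rho0 sol i12 hm erefl lamA1).
(* infinitely many values of the parameter in [[A, A + 1]], kept apart by [Hsep] *)
pose lam (k : nat) : R := A + k.+1%:R^-1.
have lamA k : A <= lam k <= A + 1.
  rewrite /lam lerDl invr_ge0 ler0n /= lerD2l invf_le1 ?ltr0n // ler1n //.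
pose v k := restrict (eball rho) (w (lam k)).
have v_inj : injective v.
  move=> k k' vE.
  have E x : eball rho x -> component (w (lam k)) l0 x = component (w (lam k')) l0 x.
    move=> xr; have := congr1 (fun f : 'rV[R]_n -> 'rV[R]_N => f x ord0 l0) vE.
    by rewrite /v /patch mem_set.
  have xr : eball rho ((rho / 2) *: ebasis i1).
    rewrite /eball /= enorm_axis ger0_norm ?divr_ge0 ?(ltW rho0) //.
    by rewrite ltr_pdivrMr // ltr_pMr // ltr1n.
  have := Hsep (lam k) (lam k') l0 (AL _ (lamA k)) (AL _ (lamA k')).
  rewrite (Dw_eq_on (@open_eball R n rho) E _ xr) subrr normr0 pmulr_lle0 ?divr_gt0 //.
  rewrite normr_le0 subr_eq0 => /eqP /addrI /invr_inj /eqP; rewrite eqr_nat => /eqP [].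
  by [].
have vin k : [set restrict (eball rho) u | u in w @` [set lam | A <= lam <= A + 1]] (v k).
  by exists (w (lam k)) => //; exists (lam k) => //; exact: lamA.
move=> fin; apply: infinite_nat.
have -> : [set: nat] = v @^-1` [set restrict (eball rho) u | u in w @` [set lam | A <= lam <= A + 1]].
  by apply/seteqP; split=> // k _; exact: vin.
by apply: finite_preimage => // k k' _ _; exact: v_inj.
Qed.
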